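(* Let $X_t=x+pt-\sum_{i=1}^{N_t}S_i+\sigma B_t$ be the perturbed Cramér-Lundberg process with exponentially distributed claims of parameter $\gamma>0$ and $\sigma^2>0$ described in the context, and assume $\psi'(0+)=p-\frac{\lambda}{\gamma}>0$. Set $r:=\sqrt{(\gamma\sigma^2-2p)^2+8\lambda\sigma^2}$. Then for all $x>0$ $$\mathbb{E}_x[\tau_0^-\mid\tau_0^-<\infty]=\frac{x\cdot\frac2r\cdot\frac{\gamma\sigma^2-2p+r}{\gamma\sigma^2+2p-r}+A_+^{\uparrow}}{1+\epsilon(x)}+\frac{x\cdot\frac2r\cdot\frac{-(\gamma\sigma^2-2p-r)}{\gamma\sigma^2+2p+r}+A_-^{\uparrow}}{1+\epsilon(x)^{-1}},$$ $$\mathbb{E}_x[(\tau_0^-)^2\mid\tau_0^-<\infty]=\frac{x^2\cdot\frac{4}{r^2}\left(\frac{\gamma\sigma^2-2p+r}{\gamma\sigma^2+2p-r}\right)^2+x\,B_+^{\uparrow}+C_+^{\uparrow}}{1+\epsilon(x)}+\frac{x^2\cdot\frac{4}{r^2}\left(\frac{\gamma\sigma^2-2p-r}{\gamma\sigma^2+2p+r}\right)^2+x\,B_-^{\uparrow}+C_-^{\uparrow}}{1+\epsilon(x)^{-1}},$$ with $$\epsilon(x):=-\frac{\gamma\sigma^2-2p-r}{\gamma\sigma^2-2p+r}\cdot\frac{\gamma\sigma^2+2p-r}{\gamma\sigma^2+2p+r}\,e^{-\frac{r}{\sigma^2}x}$$ and (reading upper signs for $+$ and lower signs for $-$) $$A_{\pm}^{\uparrow}:=-\frac{\lambda}{(p\gamma-\lambda)^2}-\frac{\gamma^2\sigma^2}{2(p\gamma-\lambda)^2}-\frac{2\gamma\sigma^2}{(p\gamma-\lambda)(\gamma\sigma^2+2p\mp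 r)}+\frac{4\sigma^2}{r^2}\left(\frac{\gamma\sigma^2-2p\pm r}{\gamma\sigma^2+2p\mp r}\right)^2\left[1+\frac{16\lambda\gamma\sigma^4}{(\gamma\sigma^2-2p\pm r)^3}\right],$$ $$B_{\pm}^{\uparrow}:=\mp\frac2r\cdot\frac{\gamma\sigma^2-2p\pm r}{\gamma\sigma^2+2p\mp r}\left[\frac{2\lambda+\gamma^2\sigma^2}{(p\gamma-\lambda)^2}+\frac{4\gamma\sigma^2}{(p\gamma-\lambda)(\gamma\sigma^2+2p\mp r)}\right]\pm\frac{24\sigma^2}{r^3}\left(\frac{\gamma\sigma^2-2p\pm r}{\gamma\sigma^2+2p\mp r}\right)^3\left[1+\frac{16\lambda\gamma\sigma^4}{(\gamma\sigma^2-2p\pm r)^3}\right],$$ $$C_{\pm}^{\uparrow}:=-\frac{2\lambda}{(p\gamma-\lambda)^3}-\frac{(2\lambda+\gamma^2\sigma^2)^2}{2(p\gamma-\lambda)^4}\pm\frac{96\gamma\sigma^6}{r^3}\cdot\frac{\gamma\sigma^2-2p\mp r}{(\gamma\sigma^2+2p\mp r)^3}\mp\frac{16\gamma\sigma^4}{r(p\gamma-\lambda)}\cdot\frac{\gamma\sigma^2-2p\pm r}{(\gamma\sigma^2+2p\mp r)^3}\pm\frac{2\sigma^2}{r}\cdot\frac{\gamma\sigma^2-2p\pm r}{\gamma\sigma^2+2p\mp r}\left[1+\frac{16\lambda\gamma\sigma^4}{(\gamma\sigma^2-2p\pm r)^3}\right]B_{\pm}^{\uparrow}.$$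
   Context: Here $x$ is the initial capital, $p>0$ the premium rate, $(N_t)$ a Poisson process with intensity $\lambda>0$, $(B_t)$ a standard Brownian motion, and the claims $S_i$ are i.i.d. exponential with parameter $\gamma>0$ (mean $1/\gamma$); all sources of randomness are independent. $\mathbb{E}_x$ is the expectation given $X_0=x$, and $\tau_0^-:=\inf\{t\ge0:X_t<0\}$ is the ruin time. The Laplace exponent $\psi(\theta)=\frac1t\log\mathbb{E}_0[e^{\theta X_t}]$ is $\psi(\theta)=p\theta+\frac12\theta^2\sigma^2-\frac{\theta\lambda}{\theta+\gamma}$. *)

(* Defs.v *)
From HB Require Import structures.
From mathcomp Require Import all_boot all_order all_algebra finmap.
From mathcomp Require Import all_classical all_reals all_analysis.
Import Order.TTheory GRing.Theory Num.Theory.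
Import numFieldNormedType.Exports.

Set Implicit Arguments.
Unset Strict Implicit.
Unset Printing Implicit Defensive.

Local Open Scope classical_set_scope.
Local Open Scope ring_scope.

Section Independence.
Context {R : realType} {d : measure_display} {T : measurableType d}.
Variable P : probability T R.

Definition mutually_independent {I : choiceType} (F : I -> set (set T)) : Prop :=
  forall (J : {fset I}) (A : I -> set T),
    (forall i, i \in J -> F i (A i)) ->
    P (\bigcap_(i in [set` J]) A i) = (\prod_(i <- J) P (A i))%E.

(* The product rule for pairs is the case where one of the events is [setT]. *)
Definition independent3 (F G H : set (set T)) : Prop :=
  forall A B C, F A -> G B -> H C ->
    P (A `&` B `&` C) = (P A * P B * P C)%E.

Definition sigma_rv {d' : measure_display} {U : measurableType d'}
    (Y : T -> U) : set (set T) :=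
  preimage_set_system setT Y measurable.

Definition sigma_family {I : Type} {d' : measure_display}
    {U : measurableType d'} (D : set I) (Y : I -> T -> U) : set (set T) :=
  <<s \bigcup_(i in D) sigma_rv (Y i) >>.

End Independence.

(* A continuous-time process is a function of the time [t : R]; only the
   times [0 <= t] are constrained or used. *)
Section Processes.
Context {R : realType} {d : measure_display} {T : measurableType d}.
Variable P : probability T R.

(* Infinitely many times [t i] amount to any finite number of them, as the
   sequence may be eventually constant. *)
Definition independent_increments (Y : R -> T -> R) : Prop :=
  forall t : nat -> R, 0 <= t 0%N -> nondecreasing_seq t ->
    mutually_independent P
      (fun i => sigma_rv (fun w => Y (t i.+1) w - Y (t i) w)).

(* Path regularity is required at every sample point, so that ruin times are
   measurable without completing [T]. *)
Record poisson_process (lambda : R) (N : R -> T -> nat) : Prop := {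
  poisson_measurable : forall t, 0 <= t -> measurable_fun setT (N t);
  poisson_start : {ae P, forall w, N 0 w = 0%N};
  poisson_increments : independent_increments (fun t w => (N t w)%:R);
  poisson_law : forall s t k, 0 <= s -> s < t ->
    P [set w | N t w = (N s w + k)%N] = (poisson_pmf (lambda * (t - s)) k)%:E;
  poisson_nondecreasing : forall w s t, 0 <= s -> s <= t -> (N s w <= N t w)%N;
  poisson_right_continuous : forall w t, 0 <= t ->
    N s w @[s --> t^'+] --> N t w }.

(* [normal_prob m s] is parametrized by the standard deviation [s]. *)
Record brownian_motion (B : R -> T -> R) : Prop := {
  brownian_measurable : forall t, 0 <= t -> measurable_fun setT (B t);
  brownian_start : {ae P, forall w, B 0 w = 0};
  brownian_increments : independent_increments B;
  brownian_law : forall s t, 0 <= s -> s < t ->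
    forall A : set R, measurable A ->
      P [set w | A (B t w - B s w)] = normal_prob 0 (Num.sqrt (t - s)) A;
  brownian_continuous : forall w, {within `[0, +oo[, continuous (B ^~ w)} }.

Record iid_exponential (gamma : R) (S : nat -> T -> R) : Prop := {
  claims_measurable : forall i, measurable_fun setT (S i);
  claims_independent : mutually_independent P (fun i => sigma_rv (S i));
  claims_law : forall i (A : set R), measurable A ->
    P (S i @^-1` A) = exponential_prob gamma A }.

Definition independent_sources
    (N : R -> T -> nat) (S : nat -> T -> R) (B : R -> T -> R) : Prop :=
  independent3 P (sigma_family [set t | 0 <= t] N) (sigma_family setT S)
    (sigma_family [set t | 0 <= t] B).

(* The claims are numbered from 0. *)
Definition perturbed_cramer_lundberg (p sigma : R)
    (N : R -> T -> nat) (S : nat -> T -> R) (B : R -> T -> R)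
    (x t : R) (w : T) : R :=
  x + p * t - \sum_(i < N t w) S i w + sigma * B t w.

(* [+oo] when the path never becomes negative. *)
Definition ruin_time (X : R -> T -> R) (w : T) : \bar R :=
  ereal_inf [set t%:E | t in [set t | 0 <= t /\ X t w < 0]].

Definition cond_expectation (Y : T -> \bar R) (A : set T) : \bar R :=
  ((\int[P]_(w in A) Y w) / P A)%E.

End Processes.

(* In the coefficients below, [s = 1] selects the upper signs and [s = -1] the
   lower ones. *)
Section Coefficients.
Context {R : realType}.
Variables p lambda gamma sigma : R.

Definition rr : R :=
  Num.sqrt ((gamma * sigma ^+ 2 - 2 * p) ^+ 2 + 8 * lambda * sigma ^+ 2).

Definition eps (x : R) : R :=
  - ((gamma * sigma ^+ 2 - 2 * p - rr) / (gamma * sigma ^+ 2 - 2 * p + rr))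
  * ((gamma * sigma ^+ 2 + 2 * p - rr) / (gamma * sigma ^+ 2 + 2 * p + rr))
  * expR (- (rr / sigma ^+ 2) * x).

Definition A_up (s : R) : R :=
  - (lambda / (p * gamma - lambda) ^+ 2)
  - gamma ^+ 2 * sigma ^+ 2 / (2 * (p * gamma - lambda) ^+ 2)
  - 2 * gamma * sigma ^+ 2
    / ((p * gamma - lambda) * (gamma * sigma ^+ 2 + 2 * p - s * rr))
  + 4 * sigma ^+ 2 / rr ^+ 2
    * ((gamma * sigma ^+ 2 - 2 * p + s * rr)
       / (gamma * sigma ^+ 2 + 2 * p - s * rr)) ^+ 2
    * (1 + 16 * lambda * gamma * sigma ^+ 4
           / (gamma * sigma ^+ 2 - 2 * p + s * rr) ^+ 3).

Definition B_up (s : R) : R :=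
  - s * (2 / rr)
    * ((gamma * sigma ^+ 2 - 2 * p + s * rr)
       / (gamma * sigma ^+ 2 + 2 * p - s * rr))
    * ((2 * lambda + gamma ^+ 2 * sigma ^+ 2) / (p * gamma - lambda) ^+ 2
       + 4 * gamma * sigma ^+ 2
         / ((p * gamma - lambda) * (gamma * sigma ^+ 2 + 2 * p - s * rr)))
  + s * (24 * sigma ^+ 2 / rr ^+ 3)
    * ((gamma * sigma ^+ 2 - 2 * p + s * rr)
       / (gamma * sigma ^+ 2 + 2 * p - s * rr)) ^+ 3
    * (1 + 16 * lambda * gamma * sigma ^+ 4
           / (gamma * sigma ^+ 2 - 2 * p + s * rr) ^+ 3).

Definition C_up (s : R) : R :=
  - (2 * lambda / (p * gamma - lambda) ^+ 3)
  - (2 * lambda + gamma ^+ 2 * sigma ^+ 2) ^+ 2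
    / (2 * (p * gamma - lambda) ^+ 4)
  + s * (96 * gamma * sigma ^+ 6 / rr ^+ 3)
    * ((gamma * sigma ^+ 2 - 2 * p - s * rr)
       / (gamma * sigma ^+ 2 + 2 * p - s * rr) ^+ 3)
  - s * (16 * gamma * sigma ^+ 4 / (rr * (p * gamma - lambda)))
    * ((gamma * sigma ^+ 2 - 2 * p + s * rr)
       / (gamma * sigma ^+ 2 + 2 * p - s * rr) ^+ 3)
  + s * (2 * sigma ^+ 2 / rr)
    * ((gamma * sigma ^+ 2 - 2 * p + s * rr)
       / (gamma * sigma ^+ 2 + 2 * p - s * rr))
    * (1 + 16 * lambda * gamma * sigma ^+ 4
           / (gamma * sigma ^+ 2 - 2 * p + s * rr) ^+ 3)
    * B_up s.

End Coefficients.

(* Main.v *)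
Require Import Defs.
From HB Require Import structures.
From mathcomp Require Import all_boot all_order all_algebra finmap.
From mathcomp Require Import all_classical all_reals all_analysis.
From mathcomp Require Import measurable_realfun ring lra.
Import Order.TTheory GRing.Theory Num.Theory.
Import numFieldNormedType.Exports.

(* The process is sampled at the times k t^2 with t = 2^-n. Let rho_1, rho_2 be
   the positive solutions of psi(- rho) = q, and let f be the mixture
   c_1 e^(- rho_1 z) + c_2 e^(- rho_2 z) continued by constants below - delta,
   with c_1 + c_2 = 1 and c_1 gamma / (gamma - rho_1) + c_2 gamma / (gamma - rho_2) = 1.
   The second condition makes a claim that jumps below 0 cost 1 on average, so
   one step of the sampled walk started at y >= 0 preserves e^(- q t^2) f up to
   o(t^2) plus an error of order t^2 delta, uniformly in y. Summing over the
   steps until the walk is negative, then letting t and delta tend to 0, gives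
   E_x[e^(- q tau)] = c_1 e^(- rho_1 x) + c_2 e^(- rho_2 x) without stochastic
   calculus. The roots and weights are then expanded to second order at q = 0,
   and the first two moments on {tau < oo} follow from the monotone limit of
   ((1 - e^(- q tau)) / q)^j. *)

Set Implicit Arguments.
Unset Strict Implicit.
Unset Printing Implicit Defensive.

Local Open Scope classical_set_scope.
Local Open Scope ring_scope.

(** * Freezing independent variables *)

(** About 1 / (q t^2) discounted steps are summed, so the error of one step must be o(t^2). A pure
    exponential achieves this for the Brownian part but is unbounded below 0; a function equal to 1
    below 0 has a kink at 0, which already costs order t when the walk is close to 0. Continuing the
    exponential a distance delta past 0 resolves both: a Brownian step from y >= 0 feels the kink at
    - delta only at a cost O(t^3), and the value at ruin lies between 1 and 1 plus a gap vanishing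
    with delta. The constants blow up as delta tends to 0, so t must tend to 0 first. A claim leaves
    a residue proportional to e^(- gamma y) that no single exponential cancels; the second linear
    condition on the weights is exactly this cancellation. Clearing the denominator in psi(- rho) =
    q gives a cubic with roots 0, al, be at q = 0, where al < gamma < be; the roots used are those
    near al and be, and this order makes the weights positive. No moment of tau is assumed finite:
    finiteness comes out of the monotone limits. *)

Section Freezing.
Context {d : measure_display} {T : measurableType d} {R : realType}.
Variable P : probability T R.

(** Dynkin's pi-lambda theorem: the measurable sets that satisfy the product rule with [C] form a
    Dynkin system. *)
Lemma indep_g_sigma (G : set (set T)) (C : set T) :
  setI_closed G -> G `<=` measurable -> measurable C ->
  (forall A, G A -> P (A `&` C) = (P A * P C)%E) ->
  forall A, <<s G >> A -> P (A `&` C) = (P A * P C)%E.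
Proof.
move=> GI Gm mC GC.
pose H := [set A : set T | measurable A /\ P (A `&` C) = (P A * P C)%E].
suff : <<s G >> `<=` H by move=> GH A /GH[].
apply: lambda_system_subset => //; last first.
  by move=> A GA; split; [exact: Gm|exact: GC].
apply/dynkin_lambda_system; split.
- by split => //; rewrite setTI probability_setT mul1e.
- move=> A [mA AC]; split; first exact: measurableC.
  have -> : ~` A `&` C = C `\` (A `&` C).
    by apply/seteqP; split => x /=; tauto.
  rewrite measureD//; last 2 first.
    exact: measurableI.
    by rewrite (le_lt_trans (probability_le1 P mC))// ltry.
  have -> : C `&` (A `&` C) = A `&` C by rewrite setIC -setIA setIid.
  rewrite [X in (_ - X)%E]AC probability_setC//.
  by rewrite muleBl ?mul1e// fin_num_measure.
- move=> F tF HF; split.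
    by apply: bigcup_measurable => k _; case: (HF k).
  rewrite setI_bigcupl !measure_bigcup//=.
  + rewrite muleC -(fineK (fin_num_measure P C mC)) -nneseriesZl//.
    by apply: eq_eseriesr => k _; rewrite fineK ?fin_num_measure// muleC; case: (HF k).
  + by move=> k _; case: (HF k).
  + by move=> k _; apply: measurableI => //; case: (HF k).
  + exact: trivIset_setIr.
Qed.

(** The law of the pair (w, [W w]), with w observed only through the sigma-algebra of [G], agrees
    with a product measure on rectangles, hence everywhere. Tonelli then integrates [W] out with w
    held fixed. *)
Lemma integral_freeze {d'} {U : measurableType d'} (G : set (set T))
    (W : T -> U) (nu : probability U R)
    (phi : g_sigma_algebraType G * U -> \bar R) :
  G `<=` measurable -> measurable_fun setT W ->
  (forall A C, <<s G >> A -> measurable C ->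
    P (A `&` W @^-1` C) = (P A * nu C)%E) ->
  measurable_fun setT phi -> (forall z, 0 <= phi z)%E ->
  (\int[P]_w phi (w, W w) = \int[P]_w \int[nu]_z phi (w, z))%E.
Proof.
move=> Gm mW ind mphi phi0.
(* The identity into [T] with the coarser sigma-algebra: its law is the restriction of [P] to that
   sigma-algebra. *)
have mi : measurable_fun setT (idfun : T -> g_sigma_algebraType G).
  move=> _ A mA; rewrite setTI preimage_id.
  by apply: (@smallest_sub _ (@sigma_algebra T setT) G measurable) mA => //;
    exact: sigma_algebra_measurable.
pose I : {mfun T >-> g_sigma_algebraType G} := HB.pack idfun
  (isMeasurableFun.Build _ _ _ _ _ mi).
have mZ : measurable_fun setT (fun w : T => (idfun w, W w) : g_sigma_algebraType G * U).
  exact/measurable_fun_pairP.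
pose Z : {mfun T >-> (g_sigma_algebraType G * U)%type} := HB.pack
  (fun w : T => (w, W w) : g_sigma_algebraType G * U)
  (isMeasurableFun.Build _ _ _ _ _ mZ).
have eqm : forall X, measurable X ->
    (distribution P I \x nu)%E X = distribution P Z X.
  apply: product_measure_unique => A C mA mC.
  exact: ind.
transitivity (\int[distribution P Z]_z phi z)%E.
  by rewrite ge0_integral_distribution.
rewrite (@eq_measure_integral _ _ _ _ (distribution P I \x nu)%E); last first.
  by move=> A mA _; exact/esym/eqm.
rewrite fubini_tonelli1// /fubini_F ge0_integral_distribution//.
  exact: measurable_fun_fubini_tonelli_F.
by move=> y; apply: integral_ge0.
Qed.

End Freezing.

(** * Integration against a law given by a density *)

Section Density.
Import HBNNSimple.

(** Indicators are covered by the hypothesis on [nu], simple functions by linearity, and [f] by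
    monotone convergence on both sides. *)
Lemma ge0_integral_density (R : realType) (nu : probability (measurableTypeR R) R)
    (g : measurableTypeR R -> R) (f : measurableTypeR R -> \bar R) :
  measurable_fun setT g -> (forall x, 0 <= g x) ->
  (forall A, measurable A ->
    nu A = \int[lebesgue_measure]_(x in A) (g x)%:E)%E ->
  measurable_fun setT f -> (forall x, 0 <= f x)%E ->
  (\int[nu]_x f x = \int[lebesgue_measure]_x (f x * (g x)%:E))%E.
Proof.
move=> mg g0 nuE mf f0.
pose f_ := nnsfun_approx measurableT mf.
have cf x : (fun n => (f_ n x)%:E) @ \oo --> f x.
  by apply: cvg_nnsfun_approx.
have mf_ n : measurable_fun setT (f_ n) by exact: measurable_funP.
have ndf m n (x : measurableTypeR R) : (m <= n)%N -> f_ m x <= f_ n x.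
  by move=> mn; exact/lefP/nd_nnsfun_approx.
have mfg n : measurable_fun setT (fun x : measurableTypeR R => (f_ n x)%:E * (g x)%:E)%E.
  by apply: emeasurable_funM; exact/measurable_EFinP.
transitivity (limn (fun n => \int[nu]_x (f_ n x)%:E))%E.
  rewrite -monotone_convergence//.
  - by apply: eq_integral => x _; exact/esym/cvg_lim.
  - by move=> n; exact/measurable_EFinP/measurable_funP.
  - by move=> n x _; rewrite lee_fin.
  - by move=> x _ m n mn; rewrite lee_fin; exact/lefP/nd_nnsfun_approx.
transitivity (limn (fun n => \int[lebesgue_measure]_x ((f_ n x)%:E * (g x)%:E)))%E; last first.
  rewrite -monotone_convergence//.
  - apply: eq_integral => x _; apply/cvg_lim => //.
    by apply: cvgeZr => //; exact: cf.
  - by move=> n x _; rewrite mule_ge0// lee_fin.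
  - move=> x _ m n mn; apply: lee_wpmul2r; rewrite ?lee_fin//.
    exact: ndf.
congr (limn _); apply/funext => n.
have fE x : ((f_ n x)%:E = \sum_(y \in range (f_ n)) (y * \1_(f_ n @^-1` [set y]) x)%:E)%E.
  by rewrite (fimfunE (f_ n)) -fsumEFin.
have ms y : measurable (f_ n @^-1` [set y]) by exact: measurable_sfunP.
have mI y : measurable_fun setT (fun x : measurableTypeR R => (y * \1_(f_ n @^-1` [set y]) x)%:E).
  by apply/measurable_EFinP; apply: measurable_funM => //; exact: measurable_indic.
have mIg y : measurable_fun setT
    (fun x : measurableTypeR R => (y * \1_(f_ n @^-1` [set y]) x)%:E * (g x)%:E)%E.
  by apply: emeasurable_funM => //; exact/measurable_EFinP.
under eq_integral do rewrite fE.
rewrite ge0_integral_fsum//; last first.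
  by move=> y x _; rewrite EFinM nnfun_muleindic_ge0.
under [RHS]eq_integral => x _.
  rewrite fE ge0_mule_fsuml; last first.
    by move=> y; rewrite EFinM; exact: nnfun_muleindic_ge0.
  over.
rewrite ge0_integral_fsum//; last first.
  by move=> y x _; rewrite mule_ge0 ?lee_fin// -lee_fin EFinM nnfun_muleindic_ge0.
apply: eq_fsbigr => y; rewrite inE => -[x _ fxy].
have y0 : 0 <= y by rewrite -fxy.
under eq_integral do rewrite EFinM.
under [RHS]eq_integral do rewrite EFinM -muleA.
have mI1 : measurable_fun setT (fun x : measurableTypeR R =>
    (\1_(f_ n @^-1` [set y]) x)%:E : \bar R).
  by apply/measurable_EFinP; exact: measurable_indic.
have mIg1 : measurable_fun setT
    (fun x : measurableTypeR R => (\1_(f_ n @^-1` [set y]) x)%:E * (g x)%:E)%E.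
  by apply: emeasurable_funM => //; exact/measurable_EFinP.
rewrite !ge0_integralZl_EFin//; last by move=> z _; rewrite -EFinM lee_fin mulr_ge0.
congr (_ * _)%E; rewrite integral_indic// setIT [LHS]nuE//.
rewrite [LHS]integral_mkcond; apply: eq_integral => z _.
by rewrite patchE indicE; case: ifPn; rewrite ?mul1e ?mul0e.
Qed.

End Density.

(** * Exponential and Gaussian bounds *)

Section ExpBounds.
Context {R : realType}.
Implicit Types x : R.

Lemma expR_sub1_le x : expR x - 1 <= x * expR x.
Proof.
have := expR_ge1Dx (- x); rewrite -(ler_pM2l (expR_gt0 x)) -expRD subrr expR0.
by lra.
Qed.

Lemma norm_expR_sub1 x : `|expR x - 1| <= `|x| * expR `|x|.
Proof.
have [x0|x0] := leP 0 x.
  rewrite (ger0_norm x0) ger0_norm; first exact: expR_sub1_le.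
  by have := expR_ge1Dx x; lra.
have e1 : 1 <= expR (- x) by have := expR_ge1Dx (- x); lra.
rewrite (ltr0_norm x0) ler0_norm; last by rewrite subr_le0 expR_le1 ltW.
have h := expR_ge1Dx x.
by nra.
Qed.

Lemma norm_expR_sub1D x : `|expR x - 1 - x| <= `|x| ^+ 2 * expR `|x|.
Proof.
have h := expR_ge1Dx x.
rewrite ger0_norm; last lra.
have h2 := expR_sub1_le x.
have : expR x - 1 - x <= x * (expR x - 1) by lra.
move=> /le_trans; apply; rewrite expr2 -mulrA.
apply: (le_trans (ler_norm _)); rewrite normrM.
by rewrite ler_wpM2l// norm_expR_sub1.
Qed.

(** The cube of x / 3 <= e^(x / 3). The third power makes a tail e^(- delta / t) negligible against
    t^2. *)
Lemma expRN_le_cube x : 0 < x -> expR (- x) <= 27 / x ^+ 3.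
Proof.
move=> x0; rewrite ler_pdivlMr ?exprn_gt0//.
have h : x / 3 <= expR (x / 3) by have := expR_ge1Dx (x / 3); lra.
have : (x / 3) ^+ 3 <= expR (x / 3) ^+ 3 by rewrite lerXn2r ?nnegrE ?expR_ge0//; lra.
rewrite -expRM_natl (_ : 3%:R * (x / 3) = x); last by field.
rewrite expRN => h3; rewrite ler_pdivrMl ?expR_gt0//.
by rewrite exprMn exprVn in h3; lra.
Qed.

End ExpBounds.

(** * Exponential and absolute moments of the normal law *)

Section NormalMoments.
Context {R : realType}.
Implicit Types s t : R.

Lemma measurable_expRZ t : measurable_fun setT (fun z : R => expR (t * z)).
Proof. by apply: measurableT_comp => //; exact: measurable_funM. Qed.

(** Completing the square: e^(t z) times the centred density is a constant times the density of mean
    t s^2. *)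
Lemma normal_mgf s t : 0 < s ->
  (\int[normal_prob 0 s]_z (expR (t * z))%:E = (expR (t ^+ 2 * s ^+ 2 / 2))%:E)%E.
Proof.
move=> s0; have sN0 : s != 0 by rewrite gt_eqF.
transitivity (\int[lebesgue_measure]_z ((expR (t * z))%:E * (normal_pdf 0 s z)%:E))%E.
  apply: (@ge0_integral_density _ (normal_prob 0 s) (normal_pdf 0 s)
    (fun z => (expR (t * z))%:E)).
  - exact: measurable_normal_pdf.
  - by move=> z; exact: normal_pdf_ge0.
  - by move=> A mA.
  - by apply/measurable_EFinP; exact: measurable_expRZ.
  - by move=> z; rewrite lee_fin expR_ge0.
rewrite -[RHS]mule1 -(integral_normal_pdf (t * s ^+ 2) s).
rewrite -ge0_integralZl_EFin; last 4 first.
- by [].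
- by move=> z _; rewrite lee_fin normal_pdf_ge0.
- by apply/measurable_EFinP; exact: measurable_normal_pdf.
- exact: expR_ge0.
apply: eq_integral => z _; rewrite -!EFinM; congr EFin.
rewrite /normal_pdf !(negbTE sN0) /normal_fun mulrCA [RHS]mulrCA.
congr (_ * _); rewrite -!expRD; congr expR.
by field.
Qed.

Lemma normal_mgfZ s t c : 0 < s -> 0 <= c ->
  (\int[normal_prob 0 s]_z (c * expR (t * z))%:E =
   (c * expR (t ^+ 2 * s ^+ 2 / 2))%:E)%E.
Proof.
move=> s0 c0; under eq_integral do rewrite EFinM.
rewrite ge0_integralZl_EFin; last 4 first.
- by [].
- by move=> v _; rewrite lee_fin expR_ge0.
- by apply/measurable_EFinP; exact: measurable_expRZ.
- by [].
by rewrite (normal_mgf t s0) -EFinM.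
Qed.

(** From |y| <= e^y + e^(- y) at y = z / s. Only the linear dependence on s matters later. *)
Lemma normal_abs_moment s : 0 < s ->
  (\int[normal_prob 0 s]_z (`|z|)%:E <= (s * (2 * expR (2^-1)))%:E)%E.
Proof.
move=> s0.
pose f z : R := s * (expR (s^-1 * z) + expR (- s^-1 * z)).
have mf : measurable_fun setT f.
  by apply: measurable_funM => //; apply: measurable_funD; exact: measurable_expRZ.
apply: (@le_trans _ _ (\int[normal_prob 0 s]_z (f z)%:E)%E).
  apply: ge0_le_integral => //.
  - by apply/measurable_EFinP; exact: normr_measurable.
  - exact/measurable_EFinP.
  move=> z _; rewrite lee_fin /f.
  have -> : `|z| = s * `|s^-1 * z|.
    by rewrite normrM gtr0_norm ?invr_gt0// mulrA divff ?mul1r// gt_eqF.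
  rewrite mulNr ler_pM2l//; set y := s^-1 * z.
  have h1 := expR_ge1Dx y; have h2 := expR_ge1Dx (- y).
  have h3 := expR_gt0 y; have h4 := expR_gt0 (- y).
  by rewrite ler_norml; apply/andP; split; lra.
rewrite /f.
under eq_integral do rewrite EFinM EFinD.
rewrite ge0_integralZl_EFin//; last 3 first.
- by move=> z _; rewrite -EFinD lee_fin addr_ge0// expR_ge0.
- by apply: emeasurable_funD; apply/measurable_EFinP; exact: measurable_expRZ.
- exact: ltW.
rewrite ge0_integralD//; last 2 first.
- by apply/measurable_EFinP; exact: measurable_expRZ.
- by apply/measurable_EFinP; exact: measurable_expRZ.
rewrite !normal_mgf// sqrrN -EFinD -EFinM lee_fin.
have -> : s^-1 ^+ 2 * s ^+ 2 / 2 = 2^-1 by field; rewrite gt_eqF.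
by rewrite ler_pM2l//; lra.
Qed.

End NormalMoments.

(** * Exponentials made constant below - delta *)

Section ClippedExponential.
Context {R : realType}.
Variables (rho delta : R).
Hypothesis (rho0 : 0 < rho) (delta0 : 0 < delta).

(** Bounded and Lipschitz, yet equal to the exponential on a neighbourhood of [0, +oo[, so that
    small Brownian steps from a nonnegative point see a pure exponential. *)
Definition clip_exp (z : R) : R := expR (- rho * Num.max z (- delta)).

Lemma clip_exp_gt0 z : 0 < clip_exp z. Proof. exact: expR_gt0. Qed.

Lemma clip_exp_le z : clip_exp z <= expR (rho * delta).
Proof.
rewrite ler_expR mulNr -mulrN ler_pM2l// lerNl.
by rewrite le_max lexx orbT.
Qed.

Lemma clip_exp_le_exp z : clip_exp z <= expR (- rho * z).
Proof. by rewrite ler_expR !mulNr lerN2 ler_pM2l// le_max lexx. Qed.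

Lemma clip_exp_ge0E z : 0 <= z -> clip_exp z = expR (- rho * z).
Proof. by move=> z0; rewrite /clip_exp max_l// (le_trans _ z0)// oppr_le0 ltW. Qed.

Lemma clip_exp_lt0_ge1 z : z <= 0 -> 1 <= clip_exp z.
Proof.
move=> z0; rewrite -expR0 ler_expR mulNr oppr_ge0 pmulr_rle0//.
by rewrite ge_max z0 oppr_le0 ltW.
Qed.

(** The Lipschitz constant is the slope of the exponential at - delta, the steepest point left by
    clipping. *)
Lemma clip_exp_lip z z' :
  clip_exp z' <= clip_exp z + rho * expR (rho * delta) * `|z' - z|.
Proof.
have := clip_exp_le z'; rewrite /clip_exp.
set b := - rho * Num.max z' _; set a := - rho * Num.max z _ => bM.
have h := expR_ge1Dx (a - b).
have eab : expR a = expR b * expR (a - b) by rewrite -expRD addrC subrK.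
have b0 := expR_gt0 b.
have ba : b - a <= rho * `|z' - z|.
  rewrite /a /b -mulrBr mulNr -mulrN ler_pM2l// opprB /Num.max /Order.max.
  have h1 := ler_norm (z' - z); have h2 := lerNnormlW (lexx `|z' - z|).
  by case: ifPn; case: ifPn; rewrite -?leNgt; lra.
have [ba0|ba0] := leP (b - a) 0.
  have eba : expR b <= expR a by rewrite ler_expR; lra.
  by rewrite (le_trans eba)// lerDl mulr_ge0// mulr_ge0 ?expR_ge0// ltW.
have : expR b * (b - a) <= expR (rho * delta) * (rho * `|z' - z|).
  by apply: ler_pM => //; exact: ltW.
by nra.
Qed.

Lemma measurable_clip_exp : measurable_fun setT clip_exp.
Proof.
apply: measurableT_comp => //; apply: measurable_funM => //.
by apply: measurable_maxr.
Qed.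

(* The cost of clipping, in a form whose Gaussian expectation is explicit. *)
Lemma exp_le_clip_exp a z : 0 <= a ->
  expR (- rho * z) <= clip_exp z + expR (- rho * z - a * (z + delta)).
Proof.
move=> a0; have [zd|zd] := leP (- delta) z.
  by rewrite /clip_exp max_l// lerDl expR_ge0.
have h := ltW (clip_exp_gt0 z).
suff : expR (- rho * z) <= expR (- rho * z - a * (z + delta)) by lra.
by rewrite ler_expR; nra.
Qed.

End ClippedExponential.

Section RealIntegrands.
Context {d : measure_display} {T : measurableType d} {R : realType}.
Implicit Types (mu : {measure set T -> \bar R}) (f g : T -> R).

Lemma integral_comb mu f g (a b : R) : 0 <= a -> 0 <= b ->
  measurable_fun setT f -> measurable_fun setT g ->
  (forall x, 0 <= f x) -> (forall x, 0 <= g x) ->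
  (\int[mu]_x (a * f x + b * g x)%:E =
   a%:E * \int[mu]_x (f x)%:E + b%:E * \int[mu]_x (g x)%:E)%E.
Proof.
move=> a0 b0 mf mg f0 g0.
have mf' : measurable_fun setT (EFin \o f) by exact/measurable_EFinP.
have mg' : measurable_fun setT (EFin \o g) by exact/measurable_EFinP.
under eq_integral do rewrite EFinD !EFinM.
rewrite ge0_integralD//; last 4 first.
- by move=> x _; rewrite mule_ge0// lee_fin.
- exact: emeasurable_funM.
- by move=> x _; rewrite mule_ge0// lee_fin.
- exact: emeasurable_funM.
by congr (_ + _)%E; rewrite ge0_integralZl_EFin// => x _; rewrite lee_fin.
Qed.

Lemma le_integral_real mu f g :
  measurable_fun setT f -> measurable_fun setT g ->
  (forall x, 0 <= f x) -> (forall x, f x <= g x) ->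
  (\int[mu]_x (f x)%:E <= \int[mu]_x (g x)%:E)%E.
Proof.
move=> mf mg f0 fg; apply: ge0_le_integral => //.
- by move=> x _; rewrite lee_fin.
- exact/measurable_EFinP.
- exact/measurable_EFinP.
- by move=> x _; rewrite lee_fin.
Qed.

Lemma integral_probability_cst (P : probability T R) (c : R) :
  (\int[P]_x c%:E = c%:E)%E.
Proof. by rewrite integral_cst//= probability_setT mule1. Qed.

End RealIntegrands.

(** * One step of the discretized process *)

Section Step.
Context {R : realType}.
Variables (p sigma : R).
Hypothesis p0 : 0 < p.

Definition diffusion_step (t : R) (F : R -> R) (z : R) : \bar R :=
  (\int[normal_prob 0 t]_v (F (z + p * t ^+ 2 + sigma * v))%:E)%E.

Lemma measurable_diffusion_arg t (F : R -> R) z : measurable_fun setT F ->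
  measurable_fun setT (fun v : measurableTypeR R => F (z + p * t ^+ 2 + sigma * v)).
Proof.
move=> mF; apply: measurableT_comp => //; exact: measurable_funD.
Qed.

Lemma diffusion_step_ge0 t F z : (forall y, 0 <= F y) -> (0 <= diffusion_step t F z)%E.
Proof. by move=> F0; apply: integral_ge0 => v _; rewrite lee_fin. Qed.

Lemma measurable_diffusion_step t (F : R -> R) :
  measurable_fun setT F -> (forall z, 0 <= F z) ->
  measurable_fun setT (diffusion_step t F).
Proof.
move=> mF F0.
pose f (zv : measurableTypeR R * measurableTypeR R) : \bar R :=
  (F (zv.1 + p * t ^+ 2 + sigma * zv.2))%:E.
have mf : measurable_fun setT f.
  apply/measurable_EFinP; apply: measurableT_comp => //.
  apply: measurable_funD; first exact: measurable_funD.
  exact: measurable_funM.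
have := @measurable_fun_fubini_tonelli_F _ _ (measurableTypeR R)
  (measurableTypeR R) R (normal_prob 0 t) f.
by apply=> // z; rewrite lee_fin.
Qed.

Lemma diffusion_stepD t (F G : R -> R) (a b z : R) : 0 <= a -> 0 <= b ->
  measurable_fun setT F -> measurable_fun setT G ->
  (forall y, 0 <= F y) -> (forall y, 0 <= G y) ->
  (diffusion_step t (fun y => a * F y + b * G y)%R z =
   a%:E * diffusion_step t F z + b%:E * diffusion_step t G z)%E.
Proof.
move=> a0 b0 mF mG F0 G0; rewrite /diffusion_step.
have mF' := measurable_diffusion_arg t z mF.
have mG' := measurable_diffusion_arg t z mG.
exact: integral_comb.
Qed.

Lemma diffusion_step_clip_exp_le (t rho delta z : R) : 0 < t -> 0 < rho ->
  (diffusion_step t (clip_exp rho delta) z <=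
   (expR (- rho * z) * expR ((- rho * p + rho ^+ 2 * sigma ^+ 2 / 2) * t ^+ 2))%:E)%E.
Proof.
move=> t0 rho0.
have -> : expR (- rho * z) * expR ((- rho * p + rho ^+ 2 * sigma ^+ 2 / 2) * t ^+ 2) =
  expR (- rho * (z + p * t ^+ 2)) * expR ((- rho * sigma) ^+ 2 * t ^+ 2 / 2).
  by rewrite -!expRD; congr expR; field.
rewrite -(normal_mgfZ (- rho * sigma) t0) ?expR_ge0//.
apply: le_integral_real.
- by apply: measurable_diffusion_arg; exact: measurable_clip_exp.
- by apply: measurable_funM => //; exact: measurable_expRZ.
- by move=> v; rewrite ltW ?clip_exp_gt0.
- move=> v; apply: (le_trans (clip_exp_le_exp _ _ _)) => //.
  by rewrite -expRD ler_expR; lra.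
Qed.

(** The converse of the previous bound. Its error O(t^3) is negligible against the length t^2 of the
    step, though the constant degenerates with delta. *)
Lemma exp_le_diffusion_step_clip (t rho delta z : R) :
  0 < t -> t <= 1 -> 0 < rho -> 0 < delta -> 0 <= z ->
  ((expR (- rho * z) * expR ((- rho * p + rho ^+ 2 * sigma ^+ 2 / 2) * t ^+ 2))%:E <=
   diffusion_step t (clip_exp rho delta) z +
   (expR ((rho + 1) ^+ 2 * sigma ^+ 2 / 2) * (27 / delta ^+ 3) * t ^+ 3)%:E)%E.
Proof.
move=> t0 t1 rho0 delta0 z0.
have -> : expR (- rho * z) * expR ((- rho * p + rho ^+ 2 * sigma ^+ 2 / 2) * t ^+ 2) =
  expR (- rho * (z + p * t ^+ 2)) * expR ((- rho * sigma) ^+ 2 * t ^+ 2 / 2).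
  by rewrite -!expRD; congr expR; field.
(* With a = 1 / t the Gaussian factor stays bounded, the increment having standard deviation t,
   while e^(- a delta) is at most 27 t^3 / delta^3. *)
pose a := t^-1; have a0 : 0 <= a by rewrite invr_ge0 ltW.
apply: (@le_trans _ _ (diffusion_step t (clip_exp rho delta) z +
  (expR (- a * delta) * expR ((- (rho + a) * sigma) ^+ 2 * t ^+ 2 / 2))%:E)%E).
  rewrite -(normal_mgfZ (- rho * sigma) t0) ?expR_ge0//.
  rewrite -(normal_mgfZ (- (rho + a) * sigma) t0) ?expR_ge0//.
  rewrite -(mul1e (diffusion_step _ _ _)) -[X in (_ + X)%E]mul1e.
  rewrite -integral_comb//; last 3 first.
  - by apply: measurable_diffusion_arg; exact: measurable_clip_exp.
  - by apply: measurable_funM => //; exact: measurable_expRZ.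
  - by move=> v; rewrite ltW ?clip_exp_gt0.
  apply: le_integral_real.
  - by apply: measurable_funM => //; exact: measurable_expRZ.
  - apply: measurable_funD.
      apply: measurable_funM => //.
      by apply: measurable_diffusion_arg; exact: measurable_clip_exp.
    by apply: measurable_funM => //; apply: measurable_funM => //; exact: measurable_expRZ.
  - by move=> v; rewrite mulr_ge0 ?expR_ge0.
  move=> v; rewrite !mul1r -!expRD.
  set y := z + p * t ^+ 2 + sigma * v.
  have -> : - rho * (z + p * t ^+ 2) + - rho * sigma * v = - rho * y by rewrite /y; ring.
  apply: (le_trans (exp_le_clip_exp rho delta y a0)).
  rewrite lerD2l ler_expR /y.
  have h : 0 <= (rho + a) * (z + p * t ^+ 2).
    rewrite mulr_ge0 ?addr_ge0 ?(ltW rho0)// mulr_ge0 ?sqr_ge0// ltW//.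
  by lra.
rewrite leeD2l// lee_fin -expRD.
have ta : (rho + a) * t = rho * t + 1 by rewrite mulrDl mulVf// gt_eqF.
have -> : (- (rho + a) * sigma) ^+ 2 * t ^+ 2 / 2 = (rho * t + 1) ^+ 2 * (sigma ^+ 2 / 2).
  by rewrite -ta; field.
rewrite expRD mulrC -mulrA; apply: ler_pM; rewrite ?expR_ge0//.
  rewrite ler_expR mulrA ler_wpM2r//.
  rewrite ler_wpM2r ?sqr_ge0// lerXn2r ?nnegrE ?addr_ge0 ?mulr_ge0 ?(ltW t0) ?(ltW rho0)//.
  by rewrite lerD2r ger_pMr.
have ad0 : 0 < a * delta by rewrite mulr_gt0// invr_gt0.
rewrite mulNr; apply: (le_trans (expRN_le_cube ad0)).
rewrite [leLHS](_ : _ = 27 / delta ^+ 3 * t ^+ 3)// /a.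
by field; rewrite !gt_eqF.
Qed.

(** The Lipschitz constant of the clipped exponential times a bound, for t <= 1, on 1 / t times the
    mean of |p t^2 + sigma v|. *)
Definition diffusion_lip (rho delta : R) : R :=
  rho * expR (rho * delta) * (p + `|sigma| * (2 * expR (2^-1))).

Lemma diffusion_lip_moment (t rho delta : R) (F : R -> R) :
  0 < t -> t <= 1 -> 0 < rho ->
  measurable_fun setT (F : measurableTypeR R -> R) -> (forall v, 0 <= F v) ->
  (\int[normal_prob 0 t]_v (F v + rho * expR (rho * delta) *
      (p * t ^+ 2 + `|sigma| * `|v|))%:E <=
   \int[normal_prob 0 t]_v (F v)%:E + (diffusion_lip rho delta * t)%:E)%E.
Proof.
move=> t0 t1 rho0 mF F0.
set L := rho * expR (rho * delta).
have L0 : 0 <= L by rewrite mulr_ge0 ?expR_ge0// ltW.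
have mN : measurable_fun setT (fun v : measurableTypeR R => `|v|) by exact: normr_measurable.
have c0 : 0 <= L * (p * t ^+ 2) by rewrite mulr_ge0// mulr_ge0 ?sqr_ge0// ltW.
under eq_integral => v _.
  rewrite (_ : F v + _ = 1 * (F v + L * (p * t ^+ 2)) + (L * `|sigma|) * `|v|); last by ring.
  over.
rewrite integral_comb ?(mulr_ge0 L0)//; last 2 first.
- exact: measurable_funD.
- by move=> v; rewrite addr_ge0.
under [X in (_ * X + _)%E]eq_integral => v _.
  rewrite (_ : F v + _ = 1 * F v + 1 * (L * (p * t ^+ 2))); last by ring.
  over.
rewrite integral_comb// !mul1e integral_probability_cst -addeA leeD2l//.
apply: (@le_trans _ _ ((L * (p * t ^+ 2))%:E +
  (L * `|sigma|)%:E * (t * (2 * expR (2^-1)))%:E)%E).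
  by rewrite leeD2l// lee_wpmul2l ?lee_fin ?(mulr_ge0 L0)//; exact: normal_abs_moment.
rewrite -EFinM -EFinD lee_fin /diffusion_lip -/L.
have : p * t ^+ 2 <= p * t by rewrite ler_pM2l// expr2 ger_pMr.
by move=> h; have := ler_wpM2l L0 h; lra.
Qed.

(** Lipschitz continuity gives only an error of order t. This suffices because the bound serves
    after a claim, an event of probability of order t^2. *)
Lemma diffusion_step_le_clip_exp (t rho delta z : R) : 0 < t -> t <= 1 -> 0 < rho ->
  (diffusion_step t (clip_exp rho delta) z <=
   (clip_exp rho delta z + diffusion_lip rho delta * t)%:E)%E.
Proof.
move=> t0 t1 rho0.
rewrite EFinD -[X in (_ <= X + _)%E](integral_probability_cst (normal_prob 0 t)).
apply: le_trans (diffusion_lip_moment delta t0 t1 rho0 _ _) => //; last first.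
  by move=> _; rewrite ltW ?clip_exp_gt0.
apply: le_integral_real.
- by apply: measurable_diffusion_arg; exact: measurable_clip_exp.
- apply: measurable_funD => //; apply: measurable_funM => //; apply: measurable_funD => //.
  by apply: measurable_funM => //; exact: normr_measurable.
- by move=> v; rewrite ltW ?clip_exp_gt0.
move=> v; apply: (le_trans (clip_exp_lip delta rho0 z _)).
rewrite lerD2l ler_wpM2l ?mulr_ge0 ?expR_ge0 ?(ltW rho0)//.
rewrite (_ : z + _ + _ - z = p * t ^+ 2 + sigma * v); last by ring.
apply: (le_trans (ler_normD _ _)); rewrite (normrM sigma) lerD2r ger0_norm// mulr_ge0 ?sqr_ge0//.
exact: ltW.
Qed.

Lemma clip_exp_le_diffusion_step (t rho delta z : R) : 0 < t -> t <= 1 -> 0 < rho ->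
  ((clip_exp rho delta z)%:E <=
   diffusion_step t (clip_exp rho delta) z + (diffusion_lip rho delta * t)%:E)%E.
Proof.
move=> t0 t1 rho0.
rewrite -[X in (X <= _)%E](integral_probability_cst (normal_prob 0 t)).
have mC := measurable_diffusion_arg t z (measurable_clip_exp rho delta).
apply: le_trans (diffusion_lip_moment delta t0 t1 rho0 _ _) => //; last first.
  by move=> v; rewrite ltW ?clip_exp_gt0.
apply: le_integral_real.
- by [].
- apply: measurable_funD => //; apply: measurable_funM => //; apply: measurable_funD => //.
  by apply: measurable_funM => //; exact: normr_measurable.
- by move=> v; rewrite ltW ?clip_exp_gt0.
move=> v; apply: (le_trans (clip_exp_lip delta rho0 (z + p * t ^+ 2 + sigma * v) _)).
rewrite lerD2l ler_wpM2l ?mulr_ge0 ?expR_ge0 ?(ltW rho0)//.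
rewrite distrC (_ : z + _ + _ - z = p * t ^+ 2 + sigma * v); last by ring.
apply: (le_trans (ler_normD _ _)); rewrite (normrM sigma) lerD2r ger0_norm// mulr_ge0 ?sqr_ge0//.
exact: ltW.
Qed.

End Step.

(** * Exponential claims and ruin caused by a claim *)

Section Claims.
Context {R : realType}.
Variables (gamma : R) (mu : probability (measurableTypeR R) R).
Hypotheses (gamma0 : 0 < gamma)
  (muE : forall A, measurable A -> mu A = exponential_prob gamma A).

Lemma integral_claims (f : measurableTypeR R -> R) :
  measurable_fun setT f -> (forall s, 0 <= f s) ->
  (\int[mu]_s (f s)%:E =
   \int[lebesgue_measure]_(s in `[0%R, +oo[) (f s * (gamma * expR (- gamma * s)))%:E)%E.
Proof.
move=> mf f0.
transitivity (\int[lebesgue_measure]_s ((f s)%:E * (exponential_pdf gamma s)%:E))%E.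
  apply: (@ge0_integral_density _ mu (exponential_pdf gamma) (fun s => (f s)%:E)).
  - exact: measurable_exponential_pdf.
  - by move=> z; apply: exponential_pdf_ge0; exact: ltW.
  - by move=> A mA; rewrite muE.
  - exact/measurable_EFinP.
  - by move=> z; rewrite lee_fin.
rewrite [RHS]integral_mkcond; apply: eq_integral => s _.
rewrite patchE /exponential_pdf patchE.
by case: ifPn => _; rewrite ?mulr0 ?mule0// -EFinM.
Qed.

(** The limit of [clip_exp rho delta (y - s)] as delta decreases to 0: a reserve driven below 0 by
    the claim counts as 1. *)
Definition ruin_value (rho y s : R) : R := if s <= y then expR (- rho * (y - s)) else 1.

(** The complement 1 - [ruin_value] vanishes for s > y, which leaves a compact interval and the
    explicit primitive [H]. *)
Lemma integral_ruin_value_compl (rho y : R) : 0 < rho -> rho != gamma -> 0 < y ->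
  (\int[lebesgue_measure]_(s in `[0%R, y])
     ((1 - expR (- rho * (y - s))) * (gamma * expR (- gamma * s)))%:E =
   (1 - (gamma / (gamma - rho) * (expR (- rho * y) - expR (- gamma * y))
         + expR (- gamma * y)))%:E)%E.
Proof.
move=> rho0 rg y0.
have gr0 : gamma - rho != 0 by rewrite subr_eq0 eq_sym.
pose H (s : R) : R := - expR (- gamma * s)
  + gamma / (gamma - rho) * expR (- rho * y) * expR (- (gamma - rho) * s).
have HD (s : R) : is_derive s 1 H ((1 - expR (- rho * (y - s))) * (gamma * expR (- gamma * s))).
  rewrite /H; apply: is_derive_eq.
  rewrite (_ : expR (- (gamma - rho) * s) = expR (- gamma * s) * expR (rho * s)); last first.
    by rewrite -expRD; congr expR; ring.
  rewrite (_ : expR (- rho * (y - s)) = expR (- rho * y) * expR (rho * s)); last first.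
    by rewrite -expRD; congr expR; ring.
  rewrite /GRing.scale /=.
  move: (expR (- gamma * s)) (expR (rho * s)) (expR (- rho * y)) => a b c.
  by field.
have Hc (s : R) : {for s, continuous H}.
  by apply/differentiable_continuous/derivable1_diffP; exact: (@ex_derive _ _ _ _ _ _ _ (HD s)).
have Gc (s : R) : {for s, continuous (fun x : R =>
    (1 - expR (- rho * (y - x))) * (gamma * expR (- gamma * x)))}.
  have e1 (a b : R) : {for s, continuous (fun x : R => expR (a * (b - x)))}.
    apply: continuous_comp; last exact: continuous_expR.
    apply: continuousM; first exact: cst_continuous.
    by apply: continuousB => //; exact: cst_continuous.
  have e2 (a : R) : {for s, continuous (fun x : R => expR (a * x))}.
    apply: continuous_comp; last exact: continuous_expR.
    by apply: continuousM => //; exact: cst_continuous.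
  apply: continuousM; first by apply: continuousB; [exact: cst_continuous|exact: e1].
  by apply: continuousM; [exact: cst_continuous|exact: e2].
rewrite (@continuous_FTC2 _ _ H)//.
- rewrite /H -EFinB; congr EFin.
  rewrite !mulr0 expR0 (_ : expR (- (gamma - rho) * y) = expR (- gamma * y) * expR (rho * y)).
    rewrite (_ : expR (- rho * y) = (expR (rho * y))^-1); last by rewrite mulNr expRN.
    have : expR (rho * y) != 0 by rewrite gt_eqF ?expR_gt0.
    move: (expR (- gamma * y)) (expR (rho * y)) => a b b0.
    by field; rewrite b0 gr0.
  by rewrite -expRD; congr expR; ring.
- by apply: continuous_subspaceT => s; exact: Gc.
- split.
  + by move=> s _; exact: (@ex_derive _ _ _ _ _ _ _ (HD s)).
  + exact/cvg_at_right_filter/Hc.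
  + exact/cvg_at_left_filter/Hc.
- by move=> s _; rewrite derive1E; exact: (@derive_val _ _ _ _ _ _ _ (HD s)).
Qed.

Lemma integral_ruin_value (rho y : R) : 0 < rho -> rho != gamma -> 0 <= y ->
  (\int[mu]_s (ruin_value rho y s)%:E =
   (gamma / (gamma - rho) * (expR (- rho * y) - expR (- gamma * y))
    + expR (- gamma * y))%:E)%E.
Proof.
move=> rho0 rg y0; set W := _ + _.
have V1 s : ruin_value rho y s <= 1.
  rewrite /ruin_value; case: ifPn => // sy.
  by rewrite expR_le1 mulNr oppr_le0 mulr_ge0 ?subr_ge0// ltW.
have V0 s : 0 <= ruin_value rho y s.
  by rewrite /ruin_value; case: ifPn => // _; exact: expR_ge0.
have mV : measurable_fun setT (ruin_value rho y : measurableTypeR R -> R).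
  apply: measurable_fun_ifT => //.
    by apply: measurable_fun_ler.
  apply: measurableT_comp => //; apply: measurable_funM => //.
  exact: measurable_funB.
have h1 : (\int[mu]_s (1 - ruin_value rho y s)%:E = (1 - W)%:E)%E.
  rewrite integral_claims; last 2 first.
  - exact: measurable_funB.
  - by move=> s; rewrite subr_ge0.
  (* The case y = 0 is treated apart: the interval degenerates and the integrand vanishes
     identically. *)
  move: y0; rewrite le_eqVlt => /predU1P[y0|y0].
    rewrite integral0_eq; last first.
      move=> s; rewrite /= in_itv/= andbT => s0; rewrite /ruin_value -y0.
      case: ifPn => s0'; last by rewrite subrr mul0r.
      by rewrite (_ : s = 0) ?subrr ?mulr0 ?expR0 ?subrr ?mul0r//; apply/le_anti/andP.
    by rewrite /W -y0 !mulr0 expR0 !subrr mulr0 add0r subrr.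
  rewrite -integral_ruin_value_compl// [LHS]integral_mkcond [RHS]integral_mkcond.
  apply: eq_integral => s _; rewrite !patchE !mem_setE !in_itv/= andbT /ruin_value.
  case: (leP 0 s) => //= s0; case: ifPn => //.
  by rewrite subrr mul0r.
have : (\int[mu]_s (1 * ruin_value rho y s + 1 * (1 - ruin_value rho y s))%:E = 1%:E)%E.
  rewrite -(integral_probability_cst mu 1); apply: eq_integral => s _; congr EFin; ring.
rewrite integral_comb//; last 2 first.
- exact: measurable_funB.
- by move=> s; rewrite subr_ge0.
rewrite h1 !mul1e.
have : (\int[mu]_s (ruin_value rho y s)%:E)%E \is a fin_num.
  rewrite ge0_fin_numE; last by apply: integral_ge0 => s _; rewrite lee_fin.
  apply: (@le_lt_trans _ _ 1%:E); last exact: ltry.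
  by rewrite -(integral_probability_cst mu 1); exact: le_integral_real.
by move/fineK => <-; rewrite -EFinD => -[h]; congr EFin; lra.
Qed.

End Claims.

Section OneStep.
Context {R : realType}.
Variables (p sigma lambda gamma q : R) (mu : probability (measurableTypeR R) R).
Hypotheses (p0 : 0 < p) (lambda0 : 0 < lambda) (gamma0 : 0 < gamma) (q0 : 0 < q)
  (muE : forall A, measurable A -> mu A = exponential_prob gamma A).

Definition claim_step (t : R) (F : R -> R) (y : R) : \bar R :=
  (\int[mu]_s diffusion_step p sigma t F (y - s))%E.

Lemma measurable_claim_arg (f : R -> \bar R) y : measurable_fun setT f ->
  measurable_fun setT (fun s : measurableTypeR R => f (y - s)).
Proof. by move=> mf; apply: measurableT_comp => //; exact: measurable_funB. Qed.

Lemma claim_step_comb t (F G : R -> R) (a b y : R) : 0 <= a -> 0 <= b ->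
  measurable_fun setT F -> measurable_fun setT G ->
  (forall z, 0 <= F z) -> (forall z, 0 <= G z) ->
  (claim_step t (fun z => a * F z + b * G z)%R y =
   a%:E * claim_step t F y + b%:E * claim_step t G y)%E.
Proof.
move=> a0 b0 mF mG F0 G0; rewrite /claim_step.
have mF' := measurable_claim_arg y (measurable_diffusion_step p sigma t mF F0).
have mG' := measurable_claim_arg y (measurable_diffusion_step p sigma t mG G0).
under eq_integral do rewrite diffusion_stepD//.
rewrite ge0_integralD//; last 4 first.
- by move=> x _; rewrite mule_ge0 ?lee_fin// diffusion_step_ge0.
- exact: emeasurable_funM.
- by move=> x _; rewrite mule_ge0 ?lee_fin// diffusion_step_ge0.
- exact: emeasurable_funM.
by congr (_ + _)%E; rewrite ge0_integralZl_EFin// => x _; rewrite diffusion_step_ge0.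
Qed.

Local Notation ruin_int rho y :=
  (gamma / (gamma - rho) * (expR (- rho * y) - expR (- gamma * y)) + expR (- gamma * y)).

Lemma measurable_ruin_value (rho y : R) :
  measurable_fun setT (ruin_value rho y : measurableTypeR R -> R).
Proof.
apply: measurable_fun_ifT => //; first by apply: measurable_fun_ler.
apply: measurableT_comp => //; apply: measurable_funM => //.
exact: measurable_funB.
Qed.

Lemma ruin_value_ge0 (rho y s : R) : 0 <= ruin_value rho y s.
Proof. by rewrite /ruin_value; case: ifPn => // _; exact: expR_ge0. Qed.

(** Below 0 the clipped exponential may exceed 1 by as much as e^(rho delta) - 1. This error does
    not vanish with t. *)
Lemma claim_step_le (t rho delta y : R) : 0 < t -> t <= 1 -> 0 < rho -> 0 < delta ->
  rho != gamma -> 0 <= y ->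
  (claim_step t (clip_exp rho delta) y <=
   (ruin_int rho y + (expR (rho * delta) - 1)
    + diffusion_lip p sigma rho delta * t)%:E)%E.
Proof.
move=> t0 t1 rho0 delta0 rg y0.
set eta := expR (rho * delta) - 1; set k := _ * t.
have eta0 : 0 <= eta.
  by have := expR_ge1Dx (rho * delta); have := mulr_gt0 rho0 delta0; rewrite /eta; lra.
have k0 : 0 <= k.
  by rewrite !mulr_ge0 ?addr_ge0 ?mulr_ge0 ?expR_ge0 ?(ltW rho0) ?(ltW t0) ?(ltW p0).
have mV := measurable_ruin_value rho y.
have mD := measurable_claim_arg y (measurable_diffusion_step p sigma t
  (measurable_clip_exp rho delta) (fun z => ltW (clip_exp_gt0 _ _ z))).
apply: (@le_trans _ _ (\int[mu]_s (1 * ruin_value rho y s + 1 * (eta + k))%:E)%E).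
  apply: ge0_le_integral => //.
  - by move=> s _; rewrite diffusion_step_ge0// => z; rewrite ltW ?clip_exp_gt0.
  - apply/measurable_EFinP; apply: measurable_funD => //.
    exact: measurable_funM.
  move=> s _; apply: (le_trans (diffusion_step_le_clip_exp _ p0 delta (y - s) t0 t1 rho0)).
  rewrite lee_fin !mul1r addrA lerD2r /ruin_value; case: ifPn => sy.
    by rewrite clip_exp_ge0E ?subr_ge0// lerDl.
  rewrite /eta addrC subrK; exact: clip_exp_le.
rewrite integral_comb//; last 2 first.
- by move=> s; exact: ruin_value_ge0.
- by move=> s; rewrite addr_ge0.
by rewrite integral_probability_cst (integral_ruin_value gamma0 muE)// !mul1e -EFinD addrA.
Qed.

(** On this side there is no separate term in delta: below 0 the clipped exponential is at least
    1. *)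
Lemma ruin_int_le_claim_step (t rho delta y : R) : 0 < t -> t <= 1 -> 0 < rho -> 0 < delta ->
  rho != gamma -> 0 <= y ->
  ((ruin_int rho y)%:E <=
   claim_step t (clip_exp rho delta) y + (diffusion_lip p sigma rho delta * t)%:E)%E.
Proof.
move=> t0 t1 rho0 delta0 rg y0.
set k := _ * t.
have k0 : 0 <= k.
  by rewrite !mulr_ge0 ?addr_ge0 ?mulr_ge0 ?expR_ge0 ?(ltW rho0) ?(ltW t0) ?(ltW p0).
have mV := measurable_ruin_value rho y.
have mD := measurable_claim_arg y (measurable_diffusion_step p sigma t
  (measurable_clip_exp rho delta) (fun z => ltW (clip_exp_gt0 _ _ z))).
have D0 z : (0 <= diffusion_step p sigma t (clip_exp rho delta) z)%E.
  by rewrite diffusion_step_ge0// => u; rewrite ltW ?clip_exp_gt0.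
rewrite -(integral_ruin_value gamma0 muE)//.
rewrite -[X in (_ + X)%E](integral_probability_cst mu) -ge0_integralD//.
apply: ge0_le_integral => //.
- by move=> s _; rewrite lee_fin ruin_value_ge0.
- exact/measurable_EFinP.
- exact: emeasurable_funD.
move=> s _.
apply: le_trans (clip_exp_le_diffusion_step _ p0 delta (y - s) t0 t1 rho0).
rewrite lee_fin /ruin_value; case: ifPn => sy.
  by rewrite clip_exp_ge0E ?subr_ge0.
by apply: clip_exp_lt0_ge1 => //; rewrite subr_le0 ltW// ltNge.
Qed.

End OneStep.

(** In use h = t^2, A = q + lambda and m = lambda gamma / (gamma - rho). The factor e^(- A h) joins
    the discount to the probability of no claim, e^((A - m) h) is the growth under diffusion and m h
    the contribution of one claim; the first-order terms cancel. *)
Lemma discount_expansion (R : realType) (m A : R) : 0 <= A -> exists2 K, 0 <= K &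
  forall h, 0 <= h -> h <= 1 ->
  `|expR (- A * h) * (expR ((A - m) * h) + m * h) - 1| <= K * h ^+ 2.
Proof.
move=> A0; exists (m ^+ 2 * expR `|m| + `|m| * (A * expR A)).
  by rewrite addr_ge0// mulr_ge0 ?sqr_ge0 ?expR_ge0// mulr_ge0 ?expR_ge0.
move=> h h0 h1.
have -> : expR (- A * h) * (expR ((A - m) * h) + m * h) - 1 =
    (expR (- (m * h)) - 1 - - (m * h)) + m * h * (expR (- (A * h)) - 1).
  rewrite mulrDr -expRD (_ : - A * h + (A - m) * h = - (m * h)); last by ring.
  by rewrite mulNr; ring.
apply: (le_trans (ler_normD _ _)); rewrite mulrDl; apply: lerD.
  apply: (le_trans (norm_expR_sub1D _)).
  rewrite normrN normrM (ger0_norm h0) exprMn real_normK ?num_real//.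
  rewrite [leRHS]mulrAC (ler_wpM2l (mulr_ge0 (sqr_ge0 _) (sqr_ge0 _)))//.
  by rewrite ler_expR ler_piMr.
rewrite !normrM (ger0_norm h0) (_ : _ * h ^+ 2 = `|m| * h * (A * h * expR A)); last by ring.
rewrite ler_wpM2l ?mulr_ge0//.
apply: (le_trans (norm_expR_sub1 _)); rewrite normrN normrM !ger0_norm//.
rewrite ler_wpM2l ?mulr_ge0//.
by rewrite ler_expR ler_piMr.
Qed.

(** * The one-step operator and its approximate invariants *)

Section WalkStep.
Context {R : realType}.
Variables (p sigma lambda gamma q : R) (mu : probability (measurableTypeR R) R).
Hypotheses (p0 : 0 < p) (lambda0 : 0 < lambda) (gamma0 : 0 < gamma) (q0 : 0 < q)
  (muE : forall A, measurable A -> mu A = exponential_prob gamma A).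

(* The time step is [t ^+ 2], so that the Brownian increment has standard
   deviation [t]; steps with two or more claims are left out. *)
Definition walk_step (t : R) (F : R -> R) (y : R) : \bar R :=
  ((expR (- (q + lambda) * t ^+ 2))%:E * diffusion_step p sigma t F y +
   (lambda * t ^+ 2 * expR (- (q + lambda) * t ^+ 2))%:E * claim_step p sigma mu t F y)%E.

(** The value [v] keeps the residue of order t^2, proportional to e^(- gamma y), that comes from
    claims jumping below 0. It is too large for the error term and has to wait for a mixture of two
    exponentials. *)
Lemma walk_step_clip_exp (rho delta : R) : 0 < rho -> 0 < delta -> rho != gamma ->
  - rho * p + rho ^+ 2 * sigma ^+ 2 / 2 + lambda * (gamma / (gamma - rho)) = q + lambda ->
  exists2 K, 0 <= K & forall t y, 0 < t -> t <= 1 -> 0 <= y ->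
  let v := expR (- rho * y) + lambda * t ^+ 2 * expR (- (q + lambda) * t ^+ 2)
             * (expR (- gamma * y) * (1 - gamma / (gamma - rho))) in
  (walk_step t (clip_exp rho delta) y <=
    (v + t ^+ 2 * (lambda * (expR (rho * delta) - 1) + K * t))%:E)%E /\
  (v%:E <= walk_step t (clip_exp rho delta) y + (t ^+ 2 * (K * t))%:E)%E.
Proof.
move=> rho0 delta0 rg; set kap := - rho * p + _; set om := gamma / _ => kapE.
have qlam0 : 0 <= q + lambda by rewrite ltW// addr_gt0.
have [K0 K00 HK0] := discount_expansion (lambda * om) qlam0.
set K1 := diffusion_lip p sigma rho delta.
set K3 := expR ((rho + 1) ^+ 2 * sigma ^+ 2 / 2) * (27 / delta ^+ 3).
have K10 : 0 <= K1.
  by rewrite !mulr_ge0 ?addr_ge0 ?mulr_ge0 ?expR_ge0 ?(ltW rho0) ?(ltW p0).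
have K30 : 0 <= K3 by rewrite mulr_ge0 ?expR_ge0// divr_ge0// exprn_ge0// ltW.
have eta0 : 0 <= expR (rho * delta) - 1.
  by have := expR_ge1Dx (rho * delta); have := mulr_gt0 rho0 delta0; lra.
exists (K0 + lambda * K1 + K3).
  by rewrite !addr_ge0// mulr_ge0// ltW.
move=> t y t0 t1 y0.
have h0 : 0 <= t ^+ 2 by exact: sqr_ge0.
have h1 : t ^+ 2 <= 1 by rewrite expr_le1// ltW.
rewrite /walk_step; set a := expR (- (q + lambda) * _); set b := _ * a.
have a0 : 0 <= a by exact: expR_ge0.
have a1 : a <= 1 by rewrite expR_le1 mulNr oppr_le0 mulr_ge0.
have lh0 : 0 <= lambda * t ^+ 2 by rewrite mulr_ge0// ltW.
have b0 : 0 <= b by rewrite mulr_ge0.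
have bl : b <= lambda * t ^+ 2 by rewrite /b ler_piMr.
have E0 : 0 <= expR (- rho * y) by exact: expR_ge0.
have E1 : expR (- rho * y) <= 1 by rewrite expR_le1 mulNr oppr_le0 mulr_ge0// ltW.
have hth : t ^+ 2 * t ^+ 2 <= t ^+ 2 * t by rewrite ler_wpM2l// expr2 ger_pMr// ltW.
have := HK0 _ h0 h1.
(* The equation for [rho] says that the diffusion rate [kap] is q + lambda - lambda om, the rate
   under which [discount_expansion] cancels to first order. *)
rewrite (_ : q + lambda - lambda * om = kap); last by rewrite -kapE; ring.
rewrite -/a; set ek := expR (kap * _) => th.
have {th} [th1 th2] : a * (ek + lambda * om * t ^+ 2) - 1 <= K0 * (t ^+ 2 * t) /\
    1 - a * (ek + lambda * om * t ^+ 2) <= K0 * (t ^+ 2 * t).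
  have kk : K0 * (t ^+ 2) ^+ 2 <= K0 * (t ^+ 2 * t) by rewrite ler_wpM2l.
  by move: th; rewrite ler_norml => /andP[th1 th2]; split; lra.
set v := _ + b * _.
have vE : v + expR (- rho * y) * (a * (ek + lambda * om * t ^+ 2) - 1) =
  a * (expR (- rho * y) * ek) +
  b * (om * (expR (- rho * y) - expR (- gamma * y)) + expR (- gamma * y)).
  by rewrite /v /b; ring.
have M0 : 0 <= K0 * (t ^+ 2 * t) by rewrite !mulr_ge0// ltW.
have thE1 : expR (- rho * y) * (a * (ek + lambda * om * t ^+ 2) - 1) <= K0 * (t ^+ 2 * t).
  by apply: le_trans (ler_wpM2l E0 th1) _; rewrite ler_piMl.
have thE2 : - (expR (- rho * y) * (a * (ek + lambda * om * t ^+ 2) - 1)) <= K0 * (t ^+ 2 * t).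
  rewrite -mulrN opprB.
  by apply: le_trans (ler_wpM2l E0 th2) _; rewrite ler_piMl.
have bK1 : b * (K1 * t) <= lambda * K1 * (t ^+ 2 * t).
  rewrite (_ : lambda * _ * _ = lambda * t ^+ 2 * (K1 * t)); last by ring.
  by rewrite ler_wpM2r// mulr_ge0// ltW.
split.
  apply: (@le_trans _ _ (a%:E * (expR (- rho * y) * ek)%:E +
    b%:E * (om * (expR (- rho * y) - expR (- gamma * y)) + expR (- gamma * y)
     + (expR (rho * delta) - 1) + K1 * t)%:E)%E).
    apply: leeD; apply: lee_wpmul2l; rewrite ?lee_fin//.
      exact: diffusion_step_clip_exp_le.
    by apply: claim_step_le.
  rewrite -!EFinM -EFinD lee_fin.
  have be : b * (expR (rho * delta) - 1) <= t ^+ 2 * (lambda * (expR (rho * delta) - 1)).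
    by rewrite mulrCA mulrA ler_wpM2r.
  have := mulr_ge0 K30 (mulr_ge0 h0 (ltW t0)).
  by rewrite mulrDr; move: vE thE1 bK1 be; rewrite !mulrDr; lra.
apply: (@le_trans _ _ (a%:E * (expR (- rho * y) * ek)%:E +
    b%:E * (om * (expR (- rho * y) - expR (- gamma * y)) + expR (- gamma * y))%:E
    + (K0 * (t ^+ 2 * t))%:E)%E).
  by rewrite -!EFinM -!EFinD lee_fin -vE; lra.
apply: (@le_trans _ _ (a%:E * (diffusion_step p sigma t (clip_exp rho delta) y + (K3 * t ^+ 3)%:E)
   + b%:E * (claim_step p sigma mu t (clip_exp rho delta) y + (K1 * t)%:E)
   + (K0 * (t ^+ 2 * t))%:E)%E).
  rewrite leeD2r//; apply: leeD; apply: lee_wpmul2l; rewrite ?lee_fin//.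
    exact: exp_le_diffusion_step_clip.
  by apply: ruin_int_le_claim_step.
have D0 z : (0 <= diffusion_step p sigma t (clip_exp rho delta) z)%E.
  by rewrite diffusion_step_ge0// => u; rewrite ltW ?clip_exp_gt0.
have C0 : (0 <= claim_step p sigma mu t (clip_exp rho delta) y)%E by apply: integral_ge0.
move: (D0 y) C0 => {D0}.
move: (diffusion_step _ _ _ _ _) (claim_step _ _ _ _ _ _) => D C D0 C0.
have K1t0 : 0 <= K1 * t by rewrite mulr_ge0// ltW.
have K3t0 : 0 <= K3 * t ^+ 3 by rewrite mulr_ge0// exprn_ge0// ltW.
rewrite !ge0_muleDr ?lee_fin//.
rewrite [leLHS](_ : _ = a%:E * D + b%:E * C + (a%:E * (K3 * t ^+ 3)%:E +
  b%:E * (K1 * t)%:E + (K0 * (t ^+ 2 * t))%:E))%E; last first.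
  by rewrite -!addeA; congr (_ + _)%E; rewrite addeCA.
apply: leeD2l; rewrite -!EFinM -!EFinD lee_fin.
have : a * (K3 * t ^+ 3) <= K3 * (t ^+ 2 * t).
  by rewrite -exprSr ler_piMl.
have := bK1; rewrite (_ : t ^+ 2 * ((K0 + lambda * K1 + K3) * t) =
  K0 * (t ^+ 2 * t) + lambda * K1 * (t ^+ 2 * t) + K3 * (t ^+ 2 * t)); last by ring.
by lra.
Qed.

Definition clip_mix (c1 c2 rho1 rho2 delta : R) (z : R) : R :=
  c1 * clip_exp rho1 delta z + c2 * clip_exp rho2 delta z.

(** For weights of sum 1, the excess over 1 of [clip_mix] at - delta. *)
Definition clip_gap (c1 c2 rho1 rho2 delta : R) : R :=
  c1 * (expR (rho1 * delta) - 1) + c2 * (expR (rho2 * delta) - 1).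

Lemma walk_step_comb t (F G : R -> R) (a b y : R) : 0 <= a -> 0 <= b ->
  measurable_fun setT F -> measurable_fun setT G ->
  (forall z, 0 <= F z) -> (forall z, 0 <= G z) ->
  (walk_step t (fun z => a * F z + b * G z)%R y =
   a%:E * walk_step t F y + b%:E * walk_step t G y)%E.
Proof.
move=> a0 b0 mF mG F0 G0; rewrite /walk_step diffusion_stepD// claim_step_comb//.
have h0 : 0 <= lambda * t ^+ 2 * expR (- (q + lambda) * t ^+ 2).
  by rewrite mulr_ge0 ?expR_ge0// mulr_ge0 ?sqr_ge0// ltW.
have e0 := expR_ge0 (- (q + lambda) * t ^+ 2).
have := diffusion_step_ge0 p sigma t y F0; have := diffusion_step_ge0 p sigma t y G0.
have : (0 <= claim_step p sigma mu t F y)%E.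
  by apply: integral_ge0 => s _; exact: diffusion_step_ge0.
have : (0 <= claim_step p sigma mu t G y)%E.
  by apply: integral_ge0 => s _; exact: diffusion_step_ge0.
move: (diffusion_step _ _ _ F _) (diffusion_step _ _ _ G _) => D1 D2.
move: (claim_step _ _ _ _ F _) (claim_step _ _ _ _ G _) => C1 C2 C20 C10 D20 D10.
rewrite !ge0_muleDr ?mule_ge0 ?lee_fin//.
rewrite !(muleCA (expR _)%:E) !(muleCA (lambda * _ * _)%:E).
by rewrite -!addeA; congr (_ + _)%E; rewrite addeCA.
Qed.

(** The residues proportional to e^(- gamma y) cancel by the condition on the numbers gamma / (gamma
    - rho_i). What remains is lambda t^2 times the clipping gap, and O(t^3). *)
Lemma walk_step_clip_mix (c1 c2 rho1 rho2 delta : R) :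
  0 <= c1 -> 0 <= c2 -> c1 + c2 = 1 ->
  0 < rho1 -> 0 < rho2 -> 0 < delta -> rho1 != gamma -> rho2 != gamma ->
  c1 * (gamma / (gamma - rho1)) + c2 * (gamma / (gamma - rho2)) = 1 ->
  - rho1 * p + rho1 ^+ 2 * sigma ^+ 2 / 2 + lambda * (gamma / (gamma - rho1)) = q + lambda ->
  - rho2 * p + rho2 ^+ 2 * sigma ^+ 2 / 2 + lambda * (gamma / (gamma - rho2)) = q + lambda ->
  let F := clip_mix c1 c2 rho1 rho2 delta in
  exists2 K, 0 <= K & forall t y, 0 < t -> t <= 1 -> 0 <= y ->
  let err := t ^+ 2 * (lambda * clip_gap c1 c2 rho1 rho2 delta + K * t) in
  (walk_step t F y <= (F y + err)%:E)%E /\ ((F y)%:E <= walk_step t F y + err%:E)%E.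
Proof.
move=> c10 c20 c12 rho10 rho20 delta0 rg1 rg2 com kap1 kap2 F.
have [K1 K10 HK1] := walk_step_clip_exp rho10 delta0 rg1 kap1.
have [K2 K20 HK2] := walk_step_clip_exp rho20 delta0 rg2 kap2.
exists (c1 * K1 + c2 * K2); first by rewrite addr_ge0// mulr_ge0.
move=> t y t0 t1 y0 err.
have [u1 l1] := HK1 _ _ t0 t1 y0; have [u2 l2] := HK2 _ _ t0 t1 y0.
rewrite /F /clip_mix walk_step_comb//; last 4 first.
- exact: measurable_clip_exp.
- exact: measurable_clip_exp.
- by move=> z; rewrite ltW ?clip_exp_gt0.
- by move=> z; rewrite ltW ?clip_exp_gt0.
rewrite !clip_exp_ge0E//.
have W0 rho : (0 <= walk_step t (clip_exp rho delta) y)%E.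
  have D0 z : (0 <= diffusion_step p sigma t (clip_exp rho delta) z)%E.
    by rewrite diffusion_step_ge0// => u; rewrite ltW ?clip_exp_gt0.
  apply: adde_ge0; apply: mule_ge0; rewrite ?lee_fin ?expR_ge0//.
    by rewrite mulr_ge0 ?expR_ge0// mulr_ge0 ?sqr_ge0// ltW.
  exact: integral_ge0.
have key : c1 * (1 - gamma / (gamma - rho1)) + c2 * (1 - gamma / (gamma - rho2)) = 0 by lra.
set b := lambda * t ^+ 2 * expR (- (q + lambda) * t ^+ 2) in u1 u2 l1 l2.
set g := expR (- gamma * y) in u1 u2 l1 l2.
have key2 : b * g * (c1 * (1 - gamma / (gamma - rho1)) + c2 * (1 - gamma / (gamma - rho2))) = 0.
  by rewrite key mulr0.
have eta0 rho : 0 < rho -> 0 <= expR (rho * delta) - 1.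
  by move=> r0; have := expR_ge1Dx (rho * delta); have := mulr_gt0 r0 delta0; lra.
split.
  apply: le_trans (leeD (lee_wpmul2l _ u1) (lee_wpmul2l _ u2)) _; rewrite ?lee_fin//.
  rewrite /err /clip_gap -subr_ge0 [leRHS](_ : _ = - (b * g *
    (c1 * (1 - gamma / (gamma - rho1)) + c2 * (1 - gamma / (gamma - rho2))))); last by ring.
  by rewrite key2 oppr0.
have : (c1%:E * (expR (- rho1 * y) + b * (g * (1 - gamma / (gamma - rho1))))%:E +
  c2%:E * (expR (- rho2 * y) + b * (g * (1 - gamma / (gamma - rho2))))%:E <=
  c1%:E * (walk_step t (clip_exp rho1 delta) y + (t ^+ 2 * (K1 * t))%:E) +
  c2%:E * (walk_step t (clip_exp rho2 delta) y + (t ^+ 2 * (K2 * t))%:E))%E.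
  by apply: leeD; apply: lee_wpmul2l; rewrite ?lee_fin.
have k1 : 0 <= t ^+ 2 * (K1 * t) by rewrite mulr_ge0 ?sqr_ge0// mulr_ge0// ltW.
have k2 : 0 <= t ^+ 2 * (K2 * t) by rewrite mulr_ge0 ?sqr_ge0// mulr_ge0// ltW.
move: (W0 rho1) (W0 rho2) => {W0 u1 u2 l1 l2}.
move: (walk_step t (clip_exp rho1 _) _) (walk_step t (clip_exp rho2 _) _) => W1 W2 W10 W20.
rewrite !ge0_muleDr ?lee_fin//.
rewrite -!EFinM -EFinD (_ : c1 * _ + c2 * _ =
  c1 * expR (- rho1 * y) + c2 * expR (- rho2 * y)); last first.
  by apply/eqP; rewrite -subr_eq0 -[X in _ == X]key2; apply/eqP; ring.
move/le_trans; apply.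
rewrite [leLHS](_ : _ = c1%:E * W1 + c2%:E * W2 +
  ((c1 * (t ^+ 2 * (K1 * t)))%:E + (c2 * (t ^+ 2 * (K2 * t)))%:E))%E; last first.
  by rewrite -!addeA; congr (_ + _)%E; rewrite addeCA.
apply: leeD2l; rewrite -EFinD lee_fin /err /clip_gap.
rewrite -subr_ge0 (_ : _ - _ = t ^+ 2 * (lambda * (c1 * (expR (rho1 * delta) - 1) +
  c2 * (expR (rho2 * delta) - 1)))); last by ring.
by rewrite mulr_ge0 ?sqr_ge0// mulr_ge0 ?(ltW lambda0)// addr_ge0// mulr_ge0// eta0.
Qed.

End WalkStep.

(** * Independence of the past *)

Section FreezeOn.
Context {d : measure_display} {T : measurableType d} {R : realType}.
Variable P : probability T R.

Lemma sub_g_sigma_measurable (G : set (set T)) : G `<=` measurable -> <<s G >> `<=` measurable.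
Proof. by move=> Gm; apply: smallest_sub => //; exact: sigma_algebra_measurable. Qed.

Lemma integral_freeze_on (G : set (set T)) (A : set T) (W : T -> R) (Y : T -> R)
    (nu : probability (measurableTypeR R) R)
    (psi : measurableTypeR R * measurableTypeR R -> \bar R) :
  G `<=` measurable -> <<s G >> A ->
  measurable_fun setT (Y : g_sigma_algebraType G -> measurableTypeR R) ->
  measurable_fun setT W ->
  (forall B C, <<s G >> B -> measurable C -> P (B `&` W @^-1` C) = (P B * nu C)%E) ->
  measurable_fun setT psi -> (forall z, 0 <= psi z)%E ->
  (\int[P]_(w in A) psi (Y w, W w) = \int[P]_(w in A) \int[nu]_z psi (Y w, z))%E.
Proof.
move=> Gm GA mY mW ind mpsi psi0.
pose phi (wz : g_sigma_algebraType G * measurableTypeR R) : \bar R :=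
  ((\1_A wz.1)%:E * psi (Y wz.1, wz.2))%E.
have mphi : measurable_fun setT phi.
  apply: emeasurable_funM.
    by apply/measurable_EFinP; apply: measurableT_comp.
  apply: measurableT_comp => //; apply/measurable_fun_pairP; split.
    exact: (measurableT_comp mY measurable_fst).
  exact: measurable_snd.
have E f : (\int[P]_(w in A) f w = \int[P]_w ((\1_A w)%:E * f w))%E.
  rewrite integral_mkcond; apply: eq_integral => w _; rewrite patchE indicE.
  by case: ifPn; rewrite ?mul1e ?mul0e.
rewrite !E.
have := @integral_freeze _ _ _ P _ (measurableTypeR R) G W nu phi Gm mW ind mphi.
rewrite /phi /= => -> //; last first.
  by move=> z; rewrite mule_ge0// lee_fin.
apply: eq_integral => w _; rewrite ge0_integralZl_EFin//.
by apply: measurableT_comp => //; exact: measurable_pair1.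
Qed.

End FreezeOn.

Section Independence.
Context {d : measure_display} {T : measurableType d} {R : realType}.
Variable P : probability T R.

Lemma sigma_rv_measurable (Y : T -> R) : measurable_fun setT Y ->
  sigma_rv Y `<=` measurable.
Proof. by move=> mY _ [B mB <-]; exact: mY. Qed.

Lemma sigma_rv_setI (Y : T -> R) : setI_closed (sigma_rv Y).
Proof.
move=> _ _ [A mA <-] [B mB <-]; exists (A `&` B); first exact: measurableI.
by rewrite preimage_setI !setTI.
Qed.

Lemma sigma_rv_setT (Y : T -> R) : sigma_rv Y setT.
Proof. by exists setT => //; rewrite preimage_setT setTI. Qed.

Fixpoint fset_below (k : nat) : {fset nat} :=
  if k is k'.+1 then (k' |` fset_below k')%fset else fset0.

Lemma in_fset_below (i k : nat) : (i \in fset_below k) = (i < k)%N.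
Proof.
elim: k => [|k ih]; first by rewrite in_fset0.
by rewrite /= in_fset1U ih ltnS [RHS]leq_eqVlt.
Qed.

(** Intersections of one event per index below [k] form a pi-system generating the past. On it the
    product rule follows by comparing mutual independence over the first [k] and the first [k.+1]
    indices. *)
Lemma sequence_past_indep (Y : nat -> T -> R) (k : nat) (A C : set T) :
  (forall i, measurable_fun setT (Y i)) ->
  mutually_independent P (fun i => sigma_rv (Y i)) ->
  sigma_family `I_k Y A -> sigma_rv (Y k) C ->
  P (A `&` C) = (P A * P C)%E.
Proof.
move=> mY ind GA YC.
have mC := sigma_rv_measurable (mY k) YC.
pose G : set (set T) := [set A | exists B : nat -> set T,
  (forall i, sigma_rv (Y i) (B i)) /\ A = \bigcap_(i in [set` fset_below k]) B i].
have GI : setI_closed G.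
  move=> _ _ [B [YB ->]] [B' [YB' ->]]; exists (fun i => B i `&` B' i).
  by split; [move=> i; exact: sigma_rv_setI|rewrite bigcapI].
have Gm : G `<=` measurable.
  move=> _ [B [YB ->]]; apply: fin_bigcap_measurable; first exact: finite_fset.
  by move=> i _; apply: sigma_rv_measurable (YB i).
apply: (indep_g_sigma GI Gm mC); last first.
  move: A GA; apply: smallest_sub; first exact: smallest_sigma_algebra.
  move=> A [i ik YA]; apply: sub_sigma_algebra.
  exists (fun j => if j == i then A else setT); split.
    by move=> j; case: eqP => [->//|_]; exact: sigma_rv_setT.
  apply/seteqP; split => w.
    by move=> Aw j _; case: eqP.
  by move/(_ i); rewrite eqxx; apply; rewrite /= in_fset_below.
move=> _ [B [YB ->]].
pose B' i := if i == k then C else B i.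
have YB' i : sigma_rv (Y i) (B' i) by rewrite /B'; case: eqP => [->|_].
have kk : k \notin fset_below k by rewrite in_fset_below ltnn.
have BB' i : i \in fset_below k -> B' i = B i.
  by rewrite /B'; case: eqP => // ->; rewrite (negbTE kk).
have e1 := ind (fset_below k.+1) B' (fun i _ => YB' i).
have e2 := ind (fset_below k) B (fun i _ => YB i).
rewrite e2; transitivity (P (\bigcap_(i in [set` fset_below k.+1]) B' i)).
  congr (P _); apply/seteqP; split => w /=.
    move=> [Bw Cw] i; rewrite /= in_fset1U => /predU1P[->|ik].
      by rewrite /B' eqxx.
    by rewrite BB'//; exact: Bw.
  move=> h; split; last first.
    by have := h k; rewrite /B' eqxx; apply; rewrite /= in_fset1U eqxx.
  by move=> i ik; rewrite -BB'//; apply: h; rewrite /= in_fset1U ik orbT.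
rewrite e1 /= big_fsetU1//= muleC /B' eqxx; congr (_ * _)%E.
apply: eq_fbigr => i ik _ /=; congr (P _); exact: BB'.
Qed.

(** When the three factors are closed under intersection, a pi-system; it generates the joint
    information of three sources. *)
Definition rect (F G H : set (set T)) : set (set T) :=
  [set D | exists A B C, [/\ F A, G B, H C & D = A `&` B `&` C]].

(** On a rectangle, independence of the sources splits off the second and third factors, and the
    assumption on [F0] separates [A] from [E]. In use [F0] is the past of one source and [E] an
    event of its next term, while the other two sources enter with all their information. *)
Lemma rect_indep (F G H F0 G0 H0 : set (set T)) (E : set T) :
  independent3 P F G H -> F setT -> G setT -> H setT ->
  setI_closed F -> setI_closed F0 -> setI_closed G0 -> setI_closed H0 ->
  F `<=` measurable -> G `<=` measurable -> H `<=` measurable ->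
  F0 `<=` F -> G0 `<=` G -> H0 `<=` H -> F E ->
  (forall A, F0 A -> P (A `&` E) = (P A * P E)%E) ->
  forall A, <<s rect F0 G0 H0 >> A -> P (A `&` E) = (P A * P E)%E.
Proof.
move=> ind FT GT HT FI F0I G0I H0I Fm Gm Hm F0F G0G H0H FE indE.
apply: indep_g_sigma => //.
- move=> _ _ [A [B [C [FA GB HC ->]]]] [A' [B' [C' [FA' GB' HC' ->]]]].
  exists (A `&` A'), (B `&` B'), (C `&` C'); split.
  + exact: F0I.
  + exact: G0I.
  + exact: H0I.
  + by rewrite (setIACA (A `&` B)) (setIACA A).
- move=> _ [A [B [C [FA GB HC ->]]]].
  by apply: measurableI; [apply: measurableI|]; [apply/Fm/F0F|apply/Gm/G0G|apply/Hm/H0H].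
- exact: Fm.
move=> _ [A [B [C [FA GB HC ->]]]].
have -> : A `&` B `&` C `&` E = A `&` E `&` B `&` C.
  by rewrite setIAC (setIAC A B).
rewrite (ind (A `&` E)) ?(ind A)//; [|exact: F0F|exact: G0G|exact: H0H|..].
- by rewrite indE// -!muleA; congr (_ * _)%E; rewrite muleC -muleA.
- by apply: FI => //; exact: F0F.
- exact: G0G.
- exact: H0H.
Qed.

(** With the rotation below, this brings any source to the first place, the one singled out by
    [rect_indep]. *)
Lemma independent3C F G H : independent3 P F G H -> independent3 P G F H.
Proof. by move=> ind A B C GA FB HC; rewrite (setIC A) ind// (muleC (P B)). Qed.

Lemma independent3R F G H : independent3 P F G H -> independent3 P H F G.
Proof.
move=> ind A B C HA FB GC.
by rewrite -setIA setIC ind// muleC muleA.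
Qed.

Lemma rectC F G H : rect F G H = rect G F H.
Proof.
by apply/seteqP; split => _ [A [B [C [? ? ? ->]]]]; exists B, A, C; split => //; rewrite (setIC A).
Qed.

Lemma rectR F G H : rect F G H = rect H F G.
Proof.
apply/seteqP; split => _ [A [B [C [? ? ? ->]]]].
  by exists C, A, B; split => //; rewrite setIC setIA.
by exists B, C, A; split => //; rewrite -setIA setIC.
Qed.

End Independence.

Section SigmaFamily.
Context {d : measure_display} {T : measurableType d} {R : realType}.

Lemma sigma_family_measurable {I : Type} (D : set I) (Y : I -> T -> R) :
  (forall i, D i -> measurable_fun setT (Y i)) -> sigma_family D Y `<=` measurable.
Proof.
move=> mY; apply: sub_g_sigma_measurable => A [i Di YA].
exact: sigma_rv_measurable (mY i Di) _ YA.
Qed.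

Lemma sigma_familyT {I : Type} (D : set I) (Y : I -> T -> R) : sigma_family D Y setT.
Proof. exact: (@measurableT _ (g_sigma_algebraType (\bigcup_(i in D) sigma_rv (Y i)))). Qed.

Lemma sigma_familyI {I : Type} (D : set I) (Y : I -> T -> R) : setI_closed (sigma_family D Y).
Proof.
move=> A B; exact: (@measurableI _ (g_sigma_algebraType (\bigcup_(i in D) sigma_rv (Y i)))).
Qed.

Lemma sub_sigma_family {I : Type} (D D' : set I) (Y : I -> T -> R) :
  D `<=` D' -> sigma_family D Y `<=` sigma_family D' Y.
Proof.
move=> DD'; apply: sub_smallest2r; first exact: smallest_sigma_algebra.
by move=> A [i Di YA]; exists i => //; exact: DD'.
Qed.

Lemma sigma_rv_family {I : Type} (D : set I) (Y : I -> T -> R) i : D i ->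
  sigma_rv (Y i) `<=` sigma_family D Y.
Proof. by move=> Di A YA; apply: sub_sigma_algebra; exists i. Qed.

Lemma measurable_gsigma (G : set (set T)) (Y : T -> R) : sigma_rv Y `<=` <<s G >> ->
  measurable_fun setT (Y : g_sigma_algebraType G -> R).
Proof. by move=> h _ A mA; apply: h; exists A. Qed.

Lemma measurable_of_gsigma (G : set (set T)) (Y : T -> R) : G `<=` measurable ->
  measurable_fun setT (Y : g_sigma_algebraType G -> R) -> measurable_fun setT Y.
Proof. by move=> Gm mY _ A mA; apply: (sub_g_sigma_measurable Gm); exact: mY. Qed.

Lemma measurable_gsigmaS (G G' : set (set T)) (Y : T -> R) : <<s G >> `<=` <<s G' >> ->
  measurable_fun setT (Y : g_sigma_algebraType G -> R) ->
  measurable_fun setT (Y : g_sigma_algebraType G' -> R).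
Proof. by move=> h mY _ A mA; apply: h; exact: mY. Qed.

Lemma rectS (F G H F' G' H' : set (set T)) : F `<=` F' -> G `<=` G' -> H `<=` H' ->
  rect F G H `<=` rect F' G' H'.
Proof.
move=> FF GG HH _ [A [B [C [FA GB HC ->]]]]; exists A, B, C.
by split; [exact: FF|exact: GG|exact: HH|].
Qed.

Lemma rect_measurable (F G H : set (set T)) : F `<=` measurable -> G `<=` measurable ->
  H `<=` measurable -> rect F G H `<=` measurable.
Proof.
move=> Fm Gm Hm _ [A [B [C [FA GB HC ->]]]].
by apply: measurableI; [apply: measurableI|]; [exact: Fm|exact: Gm|exact: Hm].
Qed.

End SigmaFamily.

(** * The stopped random walk *)

Section Walk.
Context {d : measure_display} {T : measurableType d} {R : realType}.
Variable P : probability T R.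
Variables (n s b : nat -> T -> R) (cnt : nat -> T -> nat).
Variables (x p sigma lambda t : R) (mu : probability (measurableTypeR R) R).
Hypotheses (mn : forall i, measurable_fun setT (n i))
  (ms : forall i, measurable_fun setT (s i)) (mb : forall i, measurable_fun setT (b i)).
Hypotheses (cnt0 : forall w, cnt 0 w = 0%N)
  (cntS : forall k w, (cnt k.+1 w)%:R = (cnt k w)%:R + n k w)
  (cnt_le : forall k w, (cnt k w <= cnt k.+1 w)%N).
Let FN := sigma_family setT n.
Let FS := sigma_family setT s.
Let FB := sigma_family setT b.
Hypothesis ind : independent3 P FN FS FB.
Hypotheses (indn : mutually_independent P (fun i => sigma_rv (n i)))
  (inds : mutually_independent P (fun i => sigma_rv (s i)))
  (indb : mutually_independent P (fun i => sigma_rv (b i))).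
Hypotheses (lawn0 : forall k, P (n k @^-1` [set 0]) = (expR (- (lambda * t ^+ 2)))%:E)
  (lawn1 : forall k, P (n k @^-1` [set 1]) =
    (lambda * t ^+ 2 * expR (- (lambda * t ^+ 2)))%:E)
  (lawb : forall k A, measurable A -> P (b k @^-1` A) = normal_prob 0 t A)
  (laws : forall k A, measurable A -> P (s k @^-1` A) = mu A).

Lemma cnt_sum k w : (cnt k w)%:R = \sum_(i < k) n i w.
Proof.
elim: k => [|k ih]; first by rewrite cnt0 big_ord0.
by rewrite cntS ih big_ord_recr.
Qed.

Lemma cnt_mono j k w : (j <= k)%N -> (cnt j w <= cnt k w)%N.
Proof.
move=> jk; rewrite -(subnK jk); elim: (k - j)%N => [//|i ih].
by rewrite addSn (leq_trans ih).
Qed.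

Definition walk (k : nat) (w : T) : R :=
  x + p * t ^+ 2 * k%:R - \sum_(i < cnt k w) s i w + sigma * \sum_(i < k) b i w.

(* On the event [cnt k <= m] the random number of claims is replaced by the
   fixed bound [m], which makes the measurability visible. *)
Definition walk_capped (m k : nat) (w : T) : R :=
  x + p * t ^+ 2 * k%:R
  - \sum_(i < m) (if i%:R < \sum_(j < k) n j w then s i w else 0)
  + sigma * \sum_(i < k) b i w.

Lemma walk_cappedE m k w : (cnt k w <= m)%N -> walk k w = walk_capped m k w.
Proof.
move=> km; rewrite /walk /walk_capped -cnt_sum; congr (_ - _ + _).
rewrite (big_ord_widen _ (fun i => s i w) km) big_mkcond/=.
by apply: eq_bigr => i _; rewrite ltr_nat.
Qed.

(** Claims are indexed by number and not by time: after [k] steps and [m] claims the variables still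
    to come are [n k], [s m] and [b k]. *)
Definition past (k m : nat) : set (set T) :=
  rect (sigma_family `I_k n) (sigma_family `I_m s) (sigma_family `I_k b).

Lemma past_measurable k m : past k m `<=` measurable.
Proof. by apply: rect_measurable; apply: sigma_family_measurable. Qed.

Lemma rect1 (F G H : set (set T)) : G setT -> H setT -> F `<=` <<s rect F G H >>.
Proof.
move=> GT HT A FA; apply: sub_sigma_algebra; exists A, setT, setT.
by rewrite !setIT.
Qed.

Lemma rect2 (F G H : set (set T)) : F setT -> H setT -> G `<=` <<s rect F G H >>.
Proof. by move=> FT HT; rewrite rectC; exact: rect1. Qed.

Lemma rect3 (F G H : set (set T)) : F setT -> G setT -> H `<=` <<s rect F G H >>.
Proof. by move=> FT GT; rewrite rectR; exact: rect1. Qed.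

Lemma measurable_walk_capped k m j : (j <= k)%N ->
  measurable_fun setT (walk_capped m j : g_sigma_algebraType (past k m) -> R).
Proof.
move=> jk.
have mn' i : (i < k)%N -> measurable_fun setT (n i : g_sigma_algebraType (past k m) -> R).
  move=> ik; apply: measurable_gsigma => A YA.
  apply: rect1; [exact: sigma_familyT|exact: sigma_familyT|].
  exact: sigma_rv_family YA.
have mb' i : (i < k)%N -> measurable_fun setT (b i : g_sigma_algebraType (past k m) -> R).
  move=> ik; apply: measurable_gsigma => A YA.
  apply: rect3; [exact: sigma_familyT|exact: sigma_familyT|].
  exact: sigma_rv_family YA.
have ms' i : (i < m)%N -> measurable_fun setT (s i : g_sigma_algebraType (past k m) -> R).
  move=> ik; apply: measurable_gsigma => A YA.
  apply: rect2; [exact: sigma_familyT|exact: sigma_familyT|].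
  exact: sigma_rv_family YA.
rewrite /walk_capped; apply: measurable_funD.
  apply: measurable_funB => //; apply: measurable_sum => i.
  apply: measurable_fun_ifT => //; last exact: ms'.
  apply: measurable_fun_ltr => //; apply: measurable_sum => l.
  by apply: mn'; exact: leq_trans jk.
apply: measurable_funM => //; apply: measurable_sum => l.
by apply: mb'; exact: leq_trans jk.
Qed.

Definition alive (k : nat) : set T := [set w | forall j, (j <= k)%N -> 0 <= walk j w].

(** Fixing the number of claims turns the next claim [s (cnt k w) w], whose index is random, into
    the fixed variable [s m]. *)
Definition alive_cnt (k m : nat) : set T := alive k `&` [set w | cnt k w = m].

(** On this event all earlier counts are at most [m], so every value of the walk up to [k] is a
    value of the capped walk. *)
Lemma alive_cnt_past k m : <<s past k m >> (alive_cnt k m).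
Proof.
have -> : alive_cnt k m = [set w | \sum_(j < k) n j w = m%:R] `&`
    \bigcap_(j in `I_k.+1) [set w | 0 <= walk_capped m j w].
  apply/seteqP; split => w /=.
    move=> [al <-]; split; first by rewrite cnt_sum.
    move=> j /= jk; rewrite -walk_cappedE ?cnt_mono//; exact: al.
  rewrite -cnt_sum => -[/eqP]; rewrite eqr_nat => /eqP cm h.
  split => // j jk; rewrite (@walk_cappedE m) -?cm ?cnt_mono// cm.
  exact: h.
apply: (@measurableI _ (g_sigma_algebraType (past k m))).
  have mS : measurable_fun setT (fun w : g_sigma_algebraType (past k m) => \sum_(j < k) n j w).
    apply: measurable_sum => l; apply: measurable_gsigma => A YA.
    apply: rect1; [exact: sigma_familyT|exact: sigma_familyT|].
    by apply: (@sigma_rv_family _ _ _ _ `I_k n l) => //=.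
  by rewrite -[X in measurable X]setTI; exact: (mS measurableT [set m%:R] (measurable_set1 _)).
apply: (@fin_bigcap_measurable _ (g_sigma_algebraType (past k m))) => // j jk.
rewrite (_ : [set w | _] = walk_capped m j @^-1` `[0, +oo[); last first.
  by apply/seteqP; split => w /=; rewrite in_itv/= andbT.
rewrite -[X in measurable X]setTI.
have jk' : (j <= k)%N by [].
exact: (@measurable_walk_capped k m j jk' measurableT `[0, +oo[%classic (measurable_itv _)).
Qed.

Lemma measurable_alive_cnt k m : measurable (alive_cnt k m).
Proof. exact: sub_g_sigma_measurable (@past_measurable k m) _ (@alive_cnt_past k m). Qed.

Lemma walk_no_claim k w : n k w = 0 ->
  walk k.+1 w = walk k w + p * t ^+ 2 + sigma * b k w.
Proof.
move=> n0; have c : cnt k.+1 w = cnt k w.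
  by apply/eqP; rewrite -(eqr_nat R) cntS n0 addr0.
by rewrite /walk c big_ord_recr/= -natr1; ring.
Qed.

Lemma walk_one_claim k w : n k w = 1 ->
  walk k.+1 w = walk k w - s (cnt k w) w + p * t ^+ 2 + sigma * b k w.
Proof.
move=> n1; have c : cnt k.+1 w = (cnt k w).+1.
  by apply/eqP; rewrite -(eqr_nat R) cntS n1 natr1.
by rewrite /walk c !big_ord_recr/= -natr1; ring.
Qed.

Lemma sub_g_sigma (G G' : set (set T)) : G `<=` <<s G' >> -> <<s G >> `<=` <<s G' >>.
Proof. by apply: smallest_sub; exact: smallest_sigma_algebra. Qed.

Lemma past_sub k m (D E F : set nat) : `I_k `<=` D -> `I_m `<=` E -> `I_k `<=` F ->
  <<s past k m >> `<=` <<s rect (sigma_family D n) (sigma_family E s) (sigma_family F b) >>.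
Proof.
move=> kD mE kF; apply: sub_g_sigma => A pA; apply: sub_sigma_algebra.
by move: A pA; apply: rectS; exact: sub_sigma_family.
Qed.

(** Claims and noise enter with their whole sigma-algebras: the count is integrated out first, while
    the next claim and the next noise are still in the integrand. *)
Lemma count_indep k A C : <<s rect (sigma_family `I_k n) FS FB >> A -> measurable C ->
  P (A `&` n k @^-1` C) = (P A * P (n k @^-1` C))%E.
Proof.
move=> GA mC; apply: (rect_indep (F0 := sigma_family `I_k n) (G0 := FS) (H0 := FB) ind) => //.
all: try exact: sigma_familyT.
all: try exact: sigma_familyI.
all: try by apply: sigma_family_measurable.
- exact: sub_sigma_family.
- by apply: sigma_rv_family; last by exists C => //; rewrite setTI.
- move=> B GB; apply: (sequence_past_indep (k := k) mn indn) => //.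
  by exists C => //; rewrite setTI.
Qed.

Lemma brownian_indep k A C : <<s rect FN FS (sigma_family `I_k b) >> A -> measurable C ->
  P (A `&` b k @^-1` C) = (P A * normal_prob 0 t C)%E.
Proof.
move=> GA mC; rewrite -(lawb k mC).
rewrite rectR in GA.
apply: (rect_indep (F0 := sigma_family `I_k b) (G0 := FN) (H0 := FS) (independent3R ind)) => //.
all: try exact: sigma_familyT.
all: try exact: sigma_familyI.
all: try by apply: sigma_family_measurable.
- exact: sub_sigma_family.
- by apply: sigma_rv_family; last by exists C => //; rewrite setTI.
- move=> B GB; apply: (sequence_past_indep (k := k) mb indb) => //.
  by exists C => //; rewrite setTI.
Qed.

Lemma claim_indep k A C : <<s rect FN (sigma_family `I_k s) FB >> A -> measurable C ->
  P (A `&` s k @^-1` C) = (P A * mu C)%E.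
Proof.
move=> GA mC; rewrite -(laws k mC).
rewrite rectC in GA.
apply: (rect_indep (F0 := sigma_family `I_k s) (G0 := FN) (H0 := FB) (independent3C ind)) => //.
all: try exact: sigma_familyT.
all: try exact: sigma_familyI.
all: try by apply: sigma_family_measurable.
- exact: sub_sigma_family.
- by apply: sigma_rv_family; last by exists C => //; rewrite setTI.
- move=> B GB; apply: (sequence_past_indep (k := k) ms inds) => //.
  by exists C => //; rewrite setTI.
Qed.

Lemma integral_count k (c : R) (A : set T) (Y : T -> R) (F : R -> R) :
  let G := rect (sigma_family `I_k n) FS FB in
  <<s G >> A -> measurable_fun setT (Y : g_sigma_algebraType G -> R) ->
  measurable_fun setT F -> (forall z, 0 <= F z) ->
  (\int[P]_(w in A `&` n k @^-1` [set c]) (F (Y w))%:E =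
   P (n k @^-1` [set c]) * \int[P]_(w in A) (F (Y w))%:E)%E.
Proof.
move=> G GA mY mF F0.
have Gm : G `<=` measurable by apply: rect_measurable; apply: sigma_family_measurable.
have mn' : measurable_fun setT (n k : T -> measurableTypeR R) by exact: mn.
pose X : {mfun T >-> measurableTypeR R} := HB.pack (n k : T -> measurableTypeR R)
  (isMeasurableFun.Build _ _ _ _ _ mn').
pose psi (z : measurableTypeR R * measurableTypeR R) : \bar R :=
  ((F z.1)%:E * (\1_[set c] z.2)%:E)%E.
have mpsi : measurable_fun setT psi.
  apply: emeasurable_funM; apply/measurable_EFinP.
    by apply: measurableT_comp => //; exact: measurable_fst.
  apply: measurableT_comp; last exact: measurable_snd.
  by apply: measurable_indic; exact: measurable_set1.
transitivity (\int[P]_(w in A) psi (Y w, n k w))%E.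
  rewrite integral_mkcondr; apply: eq_integral => w _; rewrite patchE /psi /= indicE.
  rewrite (_ : (w \in n k @^-1` [set c]) = (n k w \in [set c])); last first.
    by apply/idP/idP; rewrite !inE.
  by case: ifPn => _; rewrite ?mule1 ?mule0.
rewrite (@integral_freeze_on _ _ _ P G A (n k) Y (distribution P X) psi)//; last 2 first.
  by move=> B C GB mC; exact: count_indep.
  by move=> z; rewrite mule_ge0// lee_fin.
rewrite /psi /= -ge0_integralZl; last 4 first.
- exact: sub_g_sigma_measurable Gm _ GA.
- apply/measurable_EFinP; apply: measurable_funTS; apply: measurableT_comp => //.
  exact: measurable_of_gsigma mY.
- by move=> w _; rewrite lee_fin.
- exact: measure_ge0.
apply: eq_integral => w _; rewrite ge0_integralZl_EFin//; last first.
  by apply/measurable_EFinP; apply: measurable_indic; exact: measurable_set1.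
rewrite integral_indic ?setIT//=.
by rewrite muleC.
Qed.

Lemma integral_brownian k (A : set T) (Y : T -> R) (F : R -> R) :
  let G := rect FN FS (sigma_family `I_k b) in
  <<s G >> A -> measurable_fun setT (Y : g_sigma_algebraType G -> R) ->
  measurable_fun setT F -> (forall z, 0 <= F z) ->
  (\int[P]_(w in A) (F (Y w + p * t ^+ 2 + sigma * b k w))%:E =
   \int[P]_(w in A) diffusion_step p sigma t F (Y w))%E.
Proof.
move=> G GA mY mF F0.
have Gm : G `<=` measurable by apply: rect_measurable; apply: sigma_family_measurable.
pose psi (z : measurableTypeR R * measurableTypeR R) : \bar R :=
  (F (z.1 + p * t ^+ 2 + sigma * z.2))%:E.
have mpsi : measurable_fun setT psi.
  apply/measurable_EFinP; apply: measurableT_comp => //.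
  apply: measurable_funD; first exact: measurable_funD.
  exact: measurable_funM.
apply: (@integral_freeze_on _ _ _ P G A (b k) Y (normal_prob 0 t) psi Gm GA mY (mb k)) => //.
  by move=> B C GB mC; exact: brownian_indep.
by move=> z; rewrite lee_fin.
Qed.

Lemma integral_claim k (A : set T) (Y : T -> R) (D : R -> \bar R) :
  let G := rect FN (sigma_family `I_k s) FB in
  <<s G >> A -> measurable_fun setT (Y : g_sigma_algebraType G -> R) ->
  measurable_fun setT D -> (forall z, 0 <= D z)%E ->
  (\int[P]_(w in A) D (Y w - s k w)%R = \int[P]_(w in A) \int[mu]_z D (Y w - z)%R)%E.
Proof.
move=> G GA mY mD D0.
have Gm : G `<=` measurable by apply: rect_measurable; apply: sigma_family_measurable.
pose psi (z : measurableTypeR R * measurableTypeR R) : \bar R := D (z.1 - z.2).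
have mpsi : measurable_fun setT psi.
  by apply: measurableT_comp => //; exact: measurable_funB.
apply: (@integral_freeze_on _ _ _ P G A (s k) Y mu psi Gm GA mY (ms k)) => //.
  by move=> B C GB mC; exact: claim_indep.
by move=> z; exact: D0.
Qed.

Lemma walk_capped_measurableS k m (D E F : set nat) :
  `I_k `<=` D -> `I_m `<=` E -> `I_k `<=` F ->
  measurable_fun setT (walk_capped m k : g_sigma_algebraType
    (rect (sigma_family D n) (sigma_family E s) (sigma_family F b)) -> R).
Proof.
move=> kD mE kF; apply: (measurable_gsigmaS (past_sub kD mE kF)).
exact: measurable_walk_capped.
Qed.

Lemma rv_measurable2 (D E F : set nat) m : E m ->
  measurable_fun setT (s m : g_sigma_algebraType
    (rect (sigma_family D n) (sigma_family E s) (sigma_family F b)) -> R).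
Proof.
move=> Em; apply: measurable_gsigma => A YA.
apply: rect2; [exact: sigma_familyT|exact: sigma_familyT|].
exact: (sigma_rv_family Em).
Qed.

Lemma rv_measurable3 (D E F : set nat) k : F k ->
  measurable_fun setT (b k : g_sigma_algebraType
    (rect (sigma_family D n) (sigma_family E s) (sigma_family F b)) -> R).
Proof.
move=> Fk; apply: measurable_gsigma => A YA.
apply: rect3; [exact: sigma_familyT|exact: sigma_familyT|].
exact: (sigma_rv_family Fk).
Qed.

Variable F : R -> R.
Hypotheses (mF : measurable_fun setT F) (F0 : forall z, 0 <= F z).

Lemma integral_no_claim k m :
  (\int[P]_(w in alive_cnt k m `&` n k @^-1` [set 0%R]) (F (walk k.+1 w))%:E =
   (expR (- (lambda * t ^+ 2)))%:E *
   \int[P]_(w in alive_cnt k m) diffusion_step p sigma t F (walk k w))%E.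
Proof.
have wE w : alive_cnt k m w -> walk_capped m k w = walk k w.
  by move=> [_ /= cm]; rewrite (@walk_cappedE m)// cm.
transitivity (\int[P]_(w in alive_cnt k m `&` n k @^-1` [set 0%R])
   (F (walk_capped m k w + p * t ^+ 2 + sigma * b k w))%:E)%E.
  apply: eq_integral => w; rewrite inE => -[Gw nw].
  by rewrite wE// walk_no_claim.
rewrite (@integral_count k 0 (alive_cnt k m)
  (fun w => walk_capped m k w + p * t ^+ 2 + sigma * b k w))//; last 2 first.
- exact: (past_sub _ _ _ (@alive_cnt_past k m)).
- apply: measurable_funD.
    by apply: measurable_funD => //; exact: walk_capped_measurableS.
  by apply: measurable_funM => //; exact: rv_measurable3.
rewrite lawn0; congr (_ * _)%E.
rewrite (@integral_brownian k (alive_cnt k m) (walk_capped m k)); last 4 first.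
- exact: (past_sub _ _ _ (@alive_cnt_past k m)).
- exact: walk_capped_measurableS.
- exact: mF.
- exact: F0.
by apply: eq_integral => w; rewrite inE => Gw; rewrite wE.
Qed.

(** The count, the noise and the claim are integrated out in this order, each being independent of
    the variables that remain. *)
Lemma integral_one_claim k m :
  (\int[P]_(w in alive_cnt k m `&` n k @^-1` [set 1%R]) (F (walk k.+1 w))%:E =
   (lambda * t ^+ 2 * expR (- (lambda * t ^+ 2)))%:E *
   \int[P]_(w in alive_cnt k m) claim_step p sigma mu t F (walk k w))%E.
Proof.
have wE w : alive_cnt k m w -> walk_capped m k w = walk k w.
  by move=> [_ /= cm]; rewrite (@walk_cappedE m)// cm.
transitivity (\int[P]_(w in alive_cnt k m `&` n k @^-1` [set 1%R])
   (F (walk_capped m k w - s m w + p * t ^+ 2 + sigma * b k w))%:E)%E.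
  apply: eq_integral => w; rewrite inE => -[Gw nw].
  by rewrite wE// walk_one_claim//; case: Gw => _ /= ->.
rewrite (@integral_count k 1 (alive_cnt k m)
  (fun w => walk_capped m k w - s m w + p * t ^+ 2 + sigma * b k w))//; last 2 first.
- exact: (past_sub _ _ _ (@alive_cnt_past k m)).
- apply: measurable_funD.
    apply: measurable_funD => //; apply: measurable_funB; first exact: walk_capped_measurableS.
    exact: rv_measurable2.
  by apply: measurable_funM => //; exact: rv_measurable3.
rewrite lawn1; congr (_ * _)%E.
rewrite (@integral_brownian k (alive_cnt k m) (fun w => walk_capped m k w - s m w)); last 4 first.
- exact: (past_sub _ _ _ (@alive_cnt_past k m)).
- apply: measurable_funB; first exact: walk_capped_measurableS.
  exact: rv_measurable2.
- exact: mF.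
- exact: F0.
rewrite (@integral_claim m (alive_cnt k m) (walk_capped m k)
  (diffusion_step p sigma t F)); last 4 first.
- exact: (past_sub _ _ _ (@alive_cnt_past k m)).
- exact: walk_capped_measurableS.
- exact: measurable_diffusion_step.
- by move=> z; exact: diffusion_step_ge0.
by apply: eq_integral => w; rewrite inE => Gw; rewrite wE.
Qed.

Variables (q M err : R).
Hypotheses (lambda0 : 0 <= lambda) (q0 : 0 < q) (t0 : 0 < t) (FM : forall z, F z <= M)
  (err0 : 0 <= err)
  (stepF : forall y, 0 <= y ->
    (walk_step p sigma lambda q mu t F y <= (F y + err)%:E)%E /\
    ((F y)%:E <= walk_step p sigma lambda q mu t F y + err%:E)%E).

Let h0 : 0 <= lambda * t ^+ 2.
Proof. by rewrite mulr_ge0 ?sqr_ge0. Qed.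

Lemma measurable_cnt k m : measurable [set w | cnt k w = m].
Proof.
rewrite (_ : [set w | _] = (fun w => \sum_(j < k) n j w) @^-1` [set m%:R]).
  rewrite -[X in measurable X]setTI.
  have mS : measurable_fun setT (fun w => \sum_(j < k) n j w) by exact: measurable_sum.
  exact: (mS measurableT [set m%:R] (measurable_set1 _)).
apply/seteqP; split => w /=; rewrite -cnt_sum; first by move=> ->.
by move=> /eqP; rewrite eqr_nat => /eqP.
Qed.

Lemma measurable_walk k : measurable_fun setT (walk k).
Proof.
move=> _ B mB; rewrite setTI.
rewrite (_ : _ @^-1` B = \bigcup_m ([set w | cnt k w = m] `&` walk_capped m k @^-1` B)).
  apply: bigcup_measurable => m _; apply: measurableI; first exact: measurable_cnt.
  have mw := measurable_of_gsigma (@past_measurable k m) (@measurable_walk_capped k m k (leqnn k)).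
  by rewrite -[X in measurable X]setTI; exact: mw.
apply/seteqP; split => w /=.
  by move=> Bw; exists (cnt k w) => //; split => //=; rewrite -walk_cappedE.
by move=> [m _ [/= cm]]; rewrite -walk_cappedE ?cm.
Qed.

Lemma measurable_claim_step : measurable_fun setT (claim_step p sigma mu t F).
Proof.
pose psi (z : measurableTypeR R * measurableTypeR R) : \bar R :=
  diffusion_step p sigma t F (z.1 - z.2).
have mpsi : measurable_fun setT psi.
  apply: measurableT_comp; first exact: measurable_diffusion_step.
  exact: measurable_funB.
have := @measurable_fun_fubini_tonelli_F _ _ (measurableTypeR R)
  (measurableTypeR R) R mu psi.
by apply=> // z; exact: diffusion_step_ge0.
Qed.

Lemma claim_step_ge0 y : (0 <= claim_step p sigma mu t F y)%E.
Proof. by apply: integral_ge0 => z _; exact: diffusion_step_ge0. Qed.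

Lemma walk_step_ge0 y : (0 <= walk_step p sigma lambda q mu t F y)%E.
Proof.
apply: adde_ge0; apply: mule_ge0; rewrite ?lee_fin ?expR_ge0//.
- exact: diffusion_step_ge0.
- by rewrite mulr_ge0 ?expR_ge0.
- exact: claim_step_ge0.
Qed.

Lemma measurable_walk_step : measurable_fun setT (walk_step p sigma lambda q mu t F).
Proof.
apply: emeasurable_funD; apply: emeasurable_funM => //.
  exact: measurable_diffusion_step.
exact: measurable_claim_step.
Qed.

Let many (k : nat) : set T := n k @^-1` ~` ([set 0] `|` [set 1]).

(** With v = lambda t^2, the bound 1 - e^(- v) (1 + v) <= v^2 is e^(- v) >= 1 - v multiplied by 1 +
    v. *)
Lemma prob_many k A : <<s rect (sigma_family `I_k n) FS FB >> A ->
  (P (A `&` many k) <= P A * ((lambda * t ^+ 2) ^+ 2)%:E)%E.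
Proof.
move=> GA; rewrite (count_indep GA); last first.
  by apply: measurableC; apply: measurableU; exact: measurable_set1.
apply: lee_wpmul2l => //.
have mn_ c : measurable (n k @^-1` [set c]).
  by rewrite -[X in measurable X]setTI; apply: mn => //; exact: measurable_set1.
rewrite -preimage_setC preimage_setU probability_setC; last exact: measurableU.
rewrite measureU//; last first.
  by apply/seteqP; split => w //= -[/= ->] /eqP; rewrite eq_sym oner_eq0.
rewrite [leLHS](_ : _ = (1 - (expR (- (lambda * t ^+ 2)) +
  lambda * t ^+ 2 * expR (- (lambda * t ^+ 2))))%:E); last first.
  by rewrite [X in (_ - (X + _))%E]lawn0 [X in (_ - (_ + X))%E]lawn1.
rewrite lee_fin.
have := expR_ge1Dx (- (lambda * t ^+ 2)).
move: h0; move: (lambda * t ^+ 2) => v v0; move: (expR _) => e e1.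
have := mulr_ge0 (addr_ge0 ler01 v0) (_ : 0 <= e - (1 + - v)); rewrite subr_ge0 => /(_ e1).
by lra.
Qed.

(** The step is split according to its number of claims. The parts with none and with one make up
    [walk_step] exactly, where the discount e^(- q t^2) is merged with e^(- lambda t^2). *)
Lemma walk_identity k m :
  ((expR (- (q * t ^+ 2)))%:E * \int[P]_(w in alive_cnt k m) (F (walk k.+1 w))%:E =
   \int[P]_(w in alive_cnt k m) walk_step p sigma lambda q mu t F (walk k w) +
   (expR (- (q * t ^+ 2)))%:E *
     \int[P]_(w in alive_cnt k m `&` many k) (F (walk k.+1 w))%:E)%E.
Proof.
have mA := measurable_alive_cnt k m.
have mn_ c : measurable (n k @^-1` [set c]).
  by rewrite -[X in measurable X]setTI; apply: mn => //; exact: measurable_set1.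
have mmany : measurable (many k).
  by rewrite /many -preimage_setC preimage_setU; apply: measurableC; exact: measurableU.
have mFX : measurable_fun setT (fun w => (F (walk k.+1 w))%:E).
  by apply/measurable_EFinP; apply: measurableT_comp => //; exact: measurable_walk.
rewrite [in LHS](_ : alive_cnt k m = (alive_cnt k m `&` n k @^-1` [set 0]) `|`
    ((alive_cnt k m `&` n k @^-1` [set 1]) `|` (alive_cnt k m `&` many k))); last first.
  rewrite -setIUr -setIUr /many -preimage_setC preimage_setU.
  by rewrite setUA setUCr setIT.
have d12 : [disjoint alive_cnt k m `&` n k @^-1` [set 1] & alive_cnt k m `&` many k].
  apply/disj_setPS => w [[_ w1] [_ w2]]; apply: w2; right; exact: w1.
have d0 : [disjoint alive_cnt k m `&` n k @^-1` [set 0] &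
    alive_cnt k m `&` n k @^-1` [set 1] `|` alive_cnt k m `&` many k].
  apply/disj_setPS => w [[_ /= w1] [[_ /= w2]|[_ w2]]].
    by move: w1; rewrite w2 => /eqP; rewrite oner_eq0.
  by apply: w2; left; exact: w1.
have FX0 w : (0 <= (F (walk k.+1 w))%:E)%E by rewrite lee_fin.
rewrite ge0_integral_setU//; last 3 first.
- exact: measurableI.
- by apply: measurableU; exact: measurableI.
- exact: measurable_funTS.
rewrite ge0_integral_setU//; last 3 first.
- exact: measurableI.
- exact: measurableI.
- exact: measurable_funTS.
rewrite integral_no_claim integral_one_claim.
have mwalk : measurable_fun setT (fun w => walk k w) by exact: measurable_walk.
have mD : measurable_fun (alive_cnt k m) (fun w => diffusion_step p sigma t F (walk k w)).
  apply: measurable_funTS; apply: measurableT_comp => //.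
  exact: measurable_diffusion_step.
have mC : measurable_fun (alive_cnt k m) (fun w => claim_step p sigma mu t F (walk k w)).
  apply: measurable_funTS; apply: measurableT_comp => //.
  exact: measurable_claim_step.
have b0 : 0 <= lambda * t ^+ 2 * expR (- (q + lambda) * t ^+ 2) by rewrite mulr_ge0 ?expR_ge0.
rewrite [X in _ = (X + _)%E](_ : _ =
    (expR (- (q + lambda) * t ^+ 2))%:E *
      \int[P]_(w in alive_cnt k m) diffusion_step p sigma t F (walk k w) +
    (lambda * t ^+ 2 * expR (- (q + lambda) * t ^+ 2))%:E *
      \int[P]_(w in alive_cnt k m) claim_step p sigma mu t F (walk k w))%E; last first.
  rewrite /walk_step ge0_integralD; last 5 first.
  - exact: mA.
  - by move=> w _; rewrite mule_ge0 ?lee_fin ?expR_ge0// diffusion_step_ge0.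
  - exact: emeasurable_funM.
  - by move=> w _; rewrite mule_ge0 ?lee_fin// claim_step_ge0.
  - exact: emeasurable_funM.
  congr (_ + _)%E; rewrite ge0_integralZl_EFin ?expR_ge0// => w _.
    exact: diffusion_step_ge0.
  exact: claim_step_ge0.
have D0 : (0 <= \int[P]_(w in alive_cnt k m) diffusion_step p sigma t F (walk k w))%E.
  by apply: integral_ge0 => w _; exact: diffusion_step_ge0.
have C0 : (0 <= \int[P]_(w in alive_cnt k m) claim_step p sigma mu t F (walk k w))%E.
  by apply: integral_ge0 => w _; exact: claim_step_ge0.
have I0 : (0 <= \int[P]_(w in alive_cnt k m `&` many k) (F (walk k.+1 w))%:E)%E.
  by apply: integral_ge0.
move: (integral _ _ _) (integral _ _ _) (integral _ _ _) D0 C0 I0 => D C I D0 C0 I0.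
have vE0 : 0 <= lambda * t ^+ 2 * expR (- (lambda * t ^+ 2)) by rewrite mulr_ge0 ?expR_ge0.
rewrite !ge0_muleDr ?adde_ge0 ?mule_ge0 ?lee_fin ?expR_ge0//.
rewrite !muleA -!EFinM addeA; congr (_%:E * _ + _%:E * _ + _)%E.
  by rewrite -expRD; congr expR; ring.
by rewrite mulrCA -expRD; congr (_ * expR _); ring.
Qed.

(** The second summand pays for the steps with two or more claims, on which [F] is simply bounded by
    [M]. *)
Definition step_err : R := err + M * (lambda * t ^+ 2) ^+ 2.

Let M0 : 0 <= M. Proof. exact: le_trans (F0 0) (FM 0). Qed.

Let integral_many_le k m :
  ((expR (- (q * t ^+ 2)))%:E *
     \int[P]_(w in alive_cnt k m `&` many k) (F (walk k.+1 w))%:E <=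
   \int[P]_(w in alive_cnt k m) (M * (lambda * t ^+ 2) ^+ 2)%:E)%E.
Proof.
have mA := measurable_alive_cnt k m.
have mmany : measurable (many k).
  rewrite /many -[X in measurable X]setTI; apply: mn => //.
  by apply: measurableC; apply: measurableU; exact: measurable_set1.
have mFX : measurable_fun setT (fun w => (F (walk k.+1 w))%:E).
  by apply/measurable_EFinP; apply: measurableT_comp => //; exact: measurable_walk.
apply: (@le_trans _ _ (\int[P]_(w in alive_cnt k m `&` many k) M%:E)%E).
  apply: (@le_trans _ _ (\int[P]_(w in alive_cnt k m `&` many k) (F (walk k.+1 w))%:E)%E).
    rewrite -[leRHS]mul1e; apply: lee_wpmul2r; first by apply: integral_ge0 => w _; rewrite lee_fin.
    by rewrite lee_fin expR_le1 oppr_le0 mulr_ge0 ?sqr_ge0// ltW.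
  apply: ge0_le_integral => //; first exact: measurableI.
  - by move=> w _; rewrite lee_fin.
  - exact: measurable_funTS.
  - by move=> w _; rewrite lee_fin.
rewrite !integral_cst//; last exact: measurableI.
rewrite EFinM -muleA; apply: lee_wpmul2l => //.
rewrite muleC; apply: prob_many.
exact: (past_sub _ _ _ (@alive_cnt_past k m)).
Qed.

Lemma alive_cntE k : alive k = \bigcup_m alive_cnt k m.
Proof.
by apply/seteqP; split => [w aw|w [m _ [aw _]]//]; exists (cnt k w).
Qed.

Lemma measurable_alive k : measurable (alive k).
Proof. by rewrite alive_cntE; apply: bigcup_measurable => m _; exact: measurable_alive_cnt. Qed.

Lemma alive_ge0 k w : alive k w -> 0 <= walk k w. Proof. by apply. Qed.

Let mFX k : measurable_fun setT (fun w => F (walk k w)).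
Proof. by apply: measurableT_comp => //; exact: measurable_walk. Qed.

Let step_cnt_le k m :
  ((expR (- (q * t ^+ 2)))%:E * \int[P]_(w in alive_cnt k m) (F (walk k.+1 w))%:E <=
   \int[P]_(w in alive_cnt k m) (F (walk k w) + step_err)%:E)%E.
Proof.
have mA := measurable_alive_cnt k m.
rewrite walk_identity; apply: (le_trans (leeD (lexx _) (integral_many_le k m))).
rewrite -ge0_integralD; last 5 first.
- exact: mA.
- by move=> w _; exact: walk_step_ge0.
- apply: measurable_funTS; apply: measurableT_comp; first exact: measurable_walk_step.
  exact: measurable_walk.
- by move=> w _; rewrite lee_fin mulr_ge0// sqr_ge0.
- exact: measurable_cst.
apply: ge0_le_integral => //.
- by move=> w _; rewrite adde_ge0 ?walk_step_ge0// lee_fin mulr_ge0// sqr_ge0.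
- apply: emeasurable_funD => //; apply: measurable_funTS.
  apply: measurableT_comp; first exact: measurable_walk_step.
  exact: measurable_walk.
- by apply/measurable_EFinP; apply: measurable_funTS; apply: measurable_funD.
- move=> w [/alive_ge0 aw _]; rewrite /step_err addrA EFinD leeD2r//.
  by case: (stepF aw).
Qed.

Let cnt_le_step k m :
  (\int[P]_(w in alive_cnt k m) (F (walk k w))%:E <=
  (expR (- (q * t ^+ 2)))%:E * \int[P]_(w in alive_cnt k m) (F (walk k.+1 w))%:E
  + \int[P]_(w in alive_cnt k m) step_err%:E)%E.
Proof.
have mA := measurable_alive_cnt k m.
have v2 : 0 <= M * (lambda * t ^+ 2) ^+ 2 by rewrite mulr_ge0// sqr_ge0.
apply: (@le_trans _ _ (\int[P]_(w in alive_cnt k m) walk_step p sigma lambda q mu t F (walk k w) +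
   \int[P]_(w in alive_cnt k m) step_err%:E)%E).
  rewrite -ge0_integralD; last 5 first.
  - exact: mA.
  - by move=> w _; exact: walk_step_ge0.
  - apply: measurable_funTS; apply: measurableT_comp; first exact: measurable_walk_step.
    exact: measurable_walk.
  - by move=> w _; rewrite lee_fin /step_err addr_ge0.
  - exact: measurable_cst.
  apply: ge0_le_integral => //.
  - by move=> w _; rewrite lee_fin.
  - by apply/measurable_EFinP; exact: measurable_funTS.
  - apply: emeasurable_funD => //; apply: measurable_funTS.
    apply: measurableT_comp; first exact: measurable_walk_step.
    exact: measurable_walk.
  - move=> w [/alive_ge0 aw _]; apply: (le_trans (stepF aw).2).
    by rewrite leeD2l// lee_fin /step_err lerDl.
rewrite walk_identity leeD2r// leeDl// mule_ge0 ?lee_fin ?expR_ge0//.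
by apply: integral_ge0 => w _; rewrite lee_fin.
Qed.

Lemma integral_alive k (f : T -> R) : measurable_fun setT f -> (forall w, 0 <= f w) ->
  (\int[P]_(w in alive k) (f w)%:E = \sum_(0 <= m <oo) \int[P]_(w in alive_cnt k m) (f w)%:E)%E.
Proof.
move=> mf f0; rewrite alive_cntE ge0_integral_bigcup//.
- by move=> m; exact: measurable_alive_cnt.
- by apply/measurable_EFinP; exact: measurable_funTS.
- by move=> w _; rewrite lee_fin.
- apply/trivIsetP => i j _ _ /eqP ij; apply/seteqP; split => // w [[_ /= wi] [_ /= wj]].
  by apply: ij; rewrite -wi -wj.
Qed.

Let e0 : 0 <= step_err.
Proof. by rewrite addr_ge0// mulr_ge0 ?sqr_ge0. Qed.

Lemma step_alive_le k :
  ((expR (- (q * t ^+ 2)))%:E * \int[P]_(w in alive k) (F (walk k.+1 w))%:E <=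
   \int[P]_(w in alive k) (F (walk k w) + step_err)%:E)%E.
Proof.
rewrite (integral_alive k (f := fun w => F (walk k.+1 w)))//.
rewrite (integral_alive k (f := fun w => F (walk k w) + step_err)); last 2 first.
- exact: measurable_funD.
- by move=> w; rewrite addr_ge0.
rewrite -nneseriesZl; last first.
  by move=> m _; apply: integral_ge0 => w _; rewrite lee_fin.
apply: lee_nneseries => m _; last exact: step_cnt_le.
by move=> _; rewrite mule_ge0 ?lee_fin ?expR_ge0//; apply: integral_ge0 => w _; rewrite lee_fin.
Qed.

Lemma alive_le_step k :
  (\int[P]_(w in alive k) (F (walk k w))%:E <=
   (expR (- (q * t ^+ 2)))%:E * \int[P]_(w in alive k) (F (walk k.+1 w))%:E
   + \int[P]_(w in alive k) step_err%:E)%E.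
Proof.
rewrite (integral_alive k (f := fun w => F (walk k w)))//.
rewrite (integral_alive k (f := fun w => F (walk k.+1 w)))//.
rewrite (integral_alive k (f := cst step_err))//.
have I0 m j : (0 <= \int[P]_(w in alive_cnt k m) (F (walk j w))%:E)%E.
  by apply: integral_ge0 => w _; rewrite lee_fin.
rewrite -nneseriesZl// -nneseriesD//; last 2 first.
- by move=> m _ _; rewrite mule_ge0 ?lee_fin ?expR_ge0.
- by move=> m _ _; apply: integral_ge0 => w _; rewrite lee_fin.
by apply: lee_nneseries => m _//; exact: cnt_le_step.
Qed.

(** The first index at which the walk is negative, or [k] if there is none up to [k]. *)
Fixpoint stop (k : nat) (w : T) : nat :=
  if k is k'.+1 then (if `[< alive k' w >] then k else stop k' w) else 0%N.

Lemma stop_alive k w : alive k w -> stop k w = k.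
Proof.
case: k => [//|k] aw /=; case: asboolP => // naw; exfalso; apply: naw => j jk.
by apply: aw; exact: leqW.
Qed.

(** The discounted stopped process, a martingale up to the one-step errors. *)
Definition stopped (k : nat) (w : T) : R :=
  expR (- (q * t ^+ 2) * (stop k w)%:R) * F (walk (stop k w) w).

Lemma stopped_ge0 k w : 0 <= stopped k w.
Proof. by rewrite mulr_ge0 ?expR_ge0. Qed.

Lemma measurable_stopped k : measurable_fun setT (stopped k).
Proof.
elim: k => [|k ih].
  rewrite (_ : stopped 0 = fun w => F (walk 0 w)); first exact: mFX.
  by apply/funext => w; rewrite /stopped /= mulr0 expR0 mul1r.
rewrite (_ : stopped k.+1 = fun w => if `[< alive k w >] then
    expR (- (q * t ^+ 2) * k.+1%:R) * F (walk k.+1 w) else stopped k w).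
  apply: measurable_fun_ifT => //; last by apply: measurable_funM => //; exact: (mFX k.+1).
  apply: (@measurable_fun_bool _ _ setT _ true); rewrite setTI.
  rewrite (_ : _ @^-1` _ = alive k); first exact: measurable_alive.
  by apply/seteqP; split => w /=; [move/asboolP|move=> h; exact/asboolP].
by apply/funext => w; rewrite /stopped /=; case: asboolP.
Qed.

Lemma integral_split k (f : T -> R) : measurable_fun setT f -> (forall w, 0 <= f w) ->
  (\int[P]_w (f w)%:E = \int[P]_(w in alive k) (f w)%:E + \int[P]_(w in ~` alive k) (f w)%:E)%E.
Proof.
move=> mf f0; rewrite -ge0_integral_setU//.
- by rewrite setUCr.
- exact: measurable_alive.
- by apply: measurableC; exact: measurable_alive.
- by apply/measurable_EFinP; exact: measurable_funTS.
- by move=> w _; rewrite lee_fin.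
- exact/disj_setPCl.
Qed.

Let r := expR (- (q * t ^+ 2)).

Let r0 : 0 <= r. Proof. exact: expR_ge0. Qed.

(** Only the paths alive at [k] move between [stopped k] and [stopped k.+1]. *)
Let stoppedS k : (\int[P]_w (stopped k.+1 w)%:E =
  (r ^+ k)%:E * (r%:E * \int[P]_(w in alive k) (F (walk k.+1 w))%:E) +
  \int[P]_(w in ~` alive k) (stopped k w)%:E)%E.
Proof.
rewrite (integral_split k (measurable_stopped k.+1) (stopped_ge0 k.+1)); congr (_ + _)%E.
  rewrite muleA -EFinM -exprSr -ge0_integralZl_EFin; last 4 first.
  - exact: measurable_alive.
  - by move=> w _; rewrite lee_fin.
  - by apply/measurable_EFinP; exact: measurable_funTS.
  - exact: exprn_ge0.
  apply: eq_integral => w; rewrite inE => aw; rewrite -EFinM /stopped /=.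
  by case: asboolP => // _; rewrite (mulrC (- _)) expRM_natl.
apply: eq_integral => w; rewrite inE => naw; rewrite /stopped /=.
by case: asboolP.
Qed.

Let stoppedE k : (\int[P]_w (stopped k w)%:E =
  (r ^+ k)%:E * (\int[P]_(w in alive k) (F (walk k w))%:E) +
  \int[P]_(w in ~` alive k) (stopped k w)%:E)%E.
Proof.
rewrite (integral_split k (measurable_stopped k) (stopped_ge0 k)); congr (_ + _)%E.
rewrite -ge0_integralZl_EFin; last 4 first.
- exact: measurable_alive.
- by move=> w _; rewrite lee_fin.
- by apply/measurable_EFinP; exact: measurable_funTS.
- exact: exprn_ge0.
apply: eq_integral => w; rewrite inE => aw; rewrite -EFinM /stopped stop_alive//.
by rewrite (mulrC (- _)) expRM_natl.
Qed.

Let rerr k : ((r ^+ k)%:E * \int[P]_(w in alive k) step_err%:E <= (r ^+ k * step_err)%:E)%E.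
Proof.
rewrite EFinM; apply: lee_wpmul2l; first by rewrite lee_fin exprn_ge0.
rewrite integral_cst//; last exact: measurable_alive.
rewrite -[leRHS]mule1; apply: lee_wpmul2l; first by rewrite lee_fin.
by apply: probability_le1; exact: measurable_alive.
Qed.

Lemma stoppedS_le k :
  (\int[P]_w (stopped k.+1 w)%:E <= \int[P]_w (stopped k w)%:E + (r ^+ k * step_err)%:E)%E.
Proof.
rewrite stoppedS stoppedE addeAC; apply: leeD => //.
apply: le_trans (leeD (lexx _) (rerr k)).
rewrite -ge0_muleDr; last 2 first.
- by apply: integral_ge0 => w _; rewrite lee_fin.
- by apply: integral_ge0 => w _; rewrite lee_fin.
apply: lee_wpmul2l; first by rewrite lee_fin exprn_ge0.
apply: (le_trans (step_alive_le k)).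
rewrite -ge0_integralD//; first exact: measurable_alive.
  by move=> w _; rewrite lee_fin.
by apply/measurable_EFinP; exact: measurable_funTS.
Qed.

Lemma stopped_leS k :
  (\int[P]_w (stopped k w)%:E <= \int[P]_w (stopped k.+1 w)%:E + (r ^+ k * step_err)%:E)%E.
Proof.
rewrite stoppedS stoppedE addeAC; apply: leeD => //.
apply: le_trans (leeD (lexx _) (rerr k)).
rewrite -ge0_muleDr; last 2 first.
- by rewrite mule_ge0 ?lee_fin//; apply: integral_ge0 => w _; rewrite lee_fin.
- by apply: integral_ge0 => w _; rewrite lee_fin.
apply: lee_wpmul2l; first by rewrite lee_fin exprn_ge0.
exact: alive_le_step.
Qed.

Lemma walk0 w : walk 0 w = x.
Proof. by rewrite /walk cnt0 !big_ord0 !mulr0 subr0 !addr0. Qed.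

Lemma stopped_telescope k :
  (\int[P]_w (stopped k w)%:E <= (F x + \sum_(j < k) r ^+ j * step_err)%:E)%E /\
  ((F x)%:E <= \int[P]_w (stopped k w)%:E + (\sum_(j < k) r ^+ j * step_err)%:E)%E.
Proof.
elim: k => [|k [ih1 ih2]].
  rewrite big_ord0 addr0 adde0.
  have -> : (\int[P]_w (stopped 0 w)%:E = (F x)%:E)%E.
    rewrite -(integral_probability_cst P (F x)); apply: eq_integral => w _.
    by rewrite /stopped /= walk0 mulr0 expR0 mul1r.
  by [].
rewrite big_ord_recr/=; split.
  by apply: (le_trans (stoppedS_le k)); rewrite addrA [leRHS]EFinD leeD2r.
apply: (le_trans ih2); rewrite EFinD addeCA addeC.
by apply: leeD2l; exact: stopped_leS.
Qed.

(** The error of step j is discounted by r^j, so the total is at most 1 / (1 - r) errors, uniformly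
    in the horizon [k]. Then 1 / (1 - e^(- u)) <= (1 + u) / u with u = q t^2 <= q. *)
Lemma stopped_bound k : t <= 1 ->
  let e := step_err * ((1 + q) / (q * t ^+ 2)) in
  (\int[P]_w (stopped k w)%:E <= (F x + e)%:E)%E /\
  ((F x)%:E <= \int[P]_w (stopped k w)%:E + e%:E)%E.
Proof.
move=> t1 e; have [h1 h2] := stopped_telescope k.
have tt0 : 0 < t ^+ 2 by rewrite exprn_gt0.
have tt1 : t ^+ 2 <= 1 by rewrite expr_le1// ltW.
have qt0 : 0 < q * t ^+ 2 by rewrite mulr_gt0.
have r1 : r * (1 + q * t ^+ 2) <= 1.
  rewrite /r expRN mulrC ler_pdivrMr ?expR_gt0// mul1r; exact: expR_ge1Dx.
have S0 : 0 <= \sum_(j < k) r ^+ j by apply: sumr_ge0 => j _; exact: exprn_ge0.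
have S1 : (1 - r) * \sum_(j < k) r ^+ j <= 1.
  have -> : (1 - r) * \sum_(j < k) r ^+ j = 1 - r ^+ k.
    by rewrite -opprB mulNr -subrX1 opprB.
  by rewrite gerBl exprn_ge0.
have Se : \sum_(j < k) r ^+ j * step_err <= e.
  rewrite -mulr_suml mulrC /e ler_wpM2l// ler_pdivlMr//.
  move: r1 S1 S0; move: (\sum_(j < k) r ^+ j) => S r1 S1 S0.
  have r2 : r <= 1 by rewrite expR_le1 oppr_le0 ltW.
  have qq : q * t ^+ 2 <= q by rewrite ler_piMr// ltW.
  have h3 : (1 - r) * (1 + q * t ^+ 2) <= (1 - r) * (1 + q).
    by rewrite ler_wpM2l ?subr_ge0// lerD2l.
  have : S * (q * t ^+ 2) <= S * ((1 - r) * (1 + q)) by rewrite ler_wpM2l//; lra.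
  have := ler_wpM2r (addr_ge0 ler01 (ltW q0)) S1; lra.
split; first by apply: (le_trans h1); rewrite lee_fin lerD2l.
by apply: (le_trans h2); rewrite leeD2l// lee_fin.
Qed.

End Walk.

(** * Passage to continuous time *)

Section RightNegativity.
Context {R : realType}.
Variables (x p sigma : R) (N : R -> nat) (S : nat -> R) (B : R -> R).
Hypotheses (Nrc : forall t : R, 0 <= t -> N s @[s --> t^'+] --> N t)
  (Bc : {within `[0, +oo[, continuous B}).

Let X (t : R) : R := x + p * t - \sum_(i < N t) S i + sigma * B t.

(** A right-continuous integer count is constant just after [u], and with a constant count the path
    varies continuously. *)
Lemma path_right_neg (u : R) : 0 <= u -> X u < 0 ->
  exists2 e, 0 < e & forall v, u <= v -> v < u + e -> X v < 0.
Proof.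
move=> u0 Xu.
have Nn : \forall v \near u^'+, N v = N u.
  (* A singleton is a neighbourhood in [nat], so convergence means eventual equality. *)
  have /(_ [set N u]) := Nrc u0; rewrite nbhs_principalE; apply.
  exact/principal_filterP.
have Bn : B v @[v --> u^'+] --> B u.
  have [B1 B2] := (continuous_within_itvcyP 0 B).1 Bc.
  move: u0; rewrite le_eqVlt => /predU1P[<-//|u0].
  by apply: cvg_at_right_filter; apply: B1; rewrite in_itv/= u0.
have : \forall v \near u^'+, X v < 0.
  have : (x + p * v - \sum_(i < N u) S i + sigma * B v) @[v --> u^'+] --> X u.
    apply: cvgD; last by apply: cvgM => //; exact: cvg_cst.
    apply: cvgB; last exact: cvg_cst.
    apply: cvgD; first exact: cvg_cst.
    apply: cvgM; first exact: cvg_cst.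
    by apply: cvg_at_right_filter; exact: cvg_id.
  move=> /cvgr_lt/(_ _ Xu) Xn.
  near=> v; rewrite /X (near Nn v)//; near: v; exact: Xn.
move=> [e /= e0 he]; exists e => // v uv vue.
move: uv; rewrite le_eqVlt => /predU1P[<-//|uv].
apply: he => //=; rewrite /ball/= ltr0_norm ?subr_lt0// opprB.
by rewrite ltrBlDl.
Unshelve. all: by end_near. Qed.

End RightNegativity.

Section Grid.
Context {R : realType}.

Definition mesh (m : nat) : R := (2^-1 ^+ m) ^+ 2.

Lemma mesh_gt0 m : 0 < mesh m.
Proof. by rewrite !exprn_gt0// invr_gt0. Qed.

Lemma cvg_half : (2^-1 ^+ m : R) @[m --> \oo] --> (0 : R).
Proof. by apply: cvg_expr; rewrite ger0_norm ?invr_ge0//; lra. Qed.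

Lemma cvg_mesh : mesh m @[m --> \oo] --> (0 : R).
Proof.
rewrite (_ : mesh = fun m => 2^-1 ^+ m * 2^-1 ^+ m); last first.
  by apply/funext => m; rewrite /mesh expr2.
by rewrite -[X in _ --> X](mulr0 0); apply: cvgM; exact: cvg_half.
Qed.

Lemma grid_point u m : 0 <= u -> exists j : nat,
  u <= j%:R * mesh m /\ j%:R * mesh m <= u + mesh m.
Proof.
move=> u0; have h0 := mesh_gt0 m.
have /andP[l1 l2] := truncn_itv (divr_ge0 u0 (ltW h0)).
exists (Num.trunc (u / mesh m)).+1; split; first by rewrite -ler_pdivrMr// ltW.
by rewrite -natr1 mulrDl mul1r lerD2r -ler_pdivlMr.
Qed.

End Grid.

(** * The walk obtained by sampling the process on a grid *)

Section Sampling.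
Context {R : realType} {d : measure_display} {T : measurableType d}.
Variable P : probability T R.
Variables (N : R -> T -> nat) (S : nat -> T -> R) (B : R -> T -> R).
Variables (p lambda gamma sigma : R).
Hypotheses (lambda0 : 0 < lambda) (hN : poisson_process P lambda N)
  (hS : iid_exponential P gamma S) (hB : brownian_motion P B)
  (hind : independent_sources P N S B).

Lemma measurable_random_sum (n : T -> nat) (s : nat -> T -> R) :
  measurable_fun setT n -> (forall i, measurable_fun setT (s i)) ->
  measurable_fun setT (fun w => \sum_(i < n w) s i w).
Proof.
move=> mn ms _ A mA; rewrite setTI.
rewrite (_ : _ @^-1` A = \bigcup_m ([set w | n w = m] `&`
    [set w | A (\sum_(i < m) s i w)])); last first.
  apply/seteqP; split => w /=; first by move=> Aw; exists (n w).
  by move=> [m _ [/= ->]].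
apply: bigcup_measurable => m _; apply: measurableI.
  by rewrite -[X in measurable X]setTI; exact: (mn measurableT [set m]).
have ms' : measurable_fun setT (fun w => \sum_(i < m) s i w) by exact: measurable_sum.
by rewrite -[X in measurable X]setTI; exact: ms'.
Qed.

Lemma measurable_perturbed x t : 0 <= t ->
  measurable_fun setT (perturbed_cramer_lundberg p sigma N S B x t).
Proof.
move=> t0; apply: measurable_funD.
  apply: measurable_funB => //; apply: measurable_random_sum.
    exact: poisson_measurable hN _ t0.
  exact: claims_measurable hS.
by apply: measurable_funM => //; exact: brownian_measurable hB _ t0.
Qed.

Section Mesh.
Variable t : R.
Hypothesis t0 : 0 < t.

Definition grid (i : nat) : R := i%:R * t ^+ 2.

Definition counts (i : nat) (w : T) : R := (N (grid i.+1) w)%:R - (N (grid i) w)%:R.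

Definition noise (i : nat) (w : T) : R := B (grid i.+1) w - B (grid i) w.

(** [N 0] is subtracted because it vanishes only almost surely, while the walk requires a count that
    starts at 0 on every path. *)
Definition total (k : nat) (w : T) : nat := (N (grid k) w - N 0 w)%N.

Lemma grid_ge0 i : 0 <= grid i.
Proof. by rewrite mulr_ge0// sqr_ge0. Qed.

Lemma grid_lt i : grid i < grid i.+1.
Proof. by rewrite /grid -natr1 mulrDl mul1r ltrDl exprn_gt0. Qed.

Lemma gridB i : grid i.+1 - grid i = t ^+ 2.
Proof. by rewrite /grid -natr1 mulrDl mul1r addrAC subrr add0r. Qed.

Lemma nondecreasing_grid : nondecreasing_seq grid.
Proof. by move=> i j ij; rewrite ler_wpM2r ?sqr_ge0// ler_nat. Qed.

Let N_le w u v : 0 <= u -> u <= v -> (N u w <= N v w)%N.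
Proof. exact: poisson_nondecreasing hN w u v. Qed.

Lemma measurable_counting u : 0 <= u -> measurable_fun setT (fun w => (N u w)%:R : R).
Proof. by move=> u0; apply: measurableT_comp => //; exact: poisson_measurable hN _ u0. Qed.

Lemma measurable_counts i : measurable_fun setT (counts i).
Proof. by apply: measurable_funB; apply: measurable_counting; exact: grid_ge0. Qed.

Lemma measurable_noise i : measurable_fun setT (noise i).
Proof. by apply: measurable_funB; apply: brownian_measurable hB _ _; exact: grid_ge0. Qed.

Lemma total0 w : total 0 w = 0%N.
Proof. by rewrite /total /grid mul0r subnn. Qed.

Lemma totalS k w : (total k.+1 w)%:R = (total k w)%:R + counts k w :> R.
Proof.
have g0 := grid_ge0 k; have gk := grid_ge0 k.+1.
by rewrite /total /counts !natrB ?N_le//; ring.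
Qed.

Lemma total_le k w : (total k w <= total k.+1 w)%N.
Proof. by rewrite leq_sub2r// N_le ?grid_ge0// ltW// grid_lt. Qed.

Lemma counts_family : sigma_family setT counts `<=` sigma_family [set u | 0 <= u] N.
Proof.
apply: sub_g_sigma => A [i _].
have mN u : 0 <= u -> measurable_fun setT (fun w : g_sigma_algebraType
    (\bigcup_(u in [set u | 0 <= u]) sigma_rv (N u)) => (N u w)%:R : R).
  move=> u0; apply: measurableT_comp => // _ A' mA'; rewrite setTI.
  by apply: sub_sigma_algebra; exists u => //; exists A' => //; rewrite setTI.
have mc : measurable_fun setT (counts i : g_sigma_algebraType
    (\bigcup_(u in [set u | 0 <= u]) sigma_rv (N u)) -> R).
  by apply: measurable_funB; apply: mN; exact: grid_ge0.
by move=> [C mC <-]; exact: mc.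
Qed.

Lemma noise_family : sigma_family setT noise `<=` sigma_family [set u | 0 <= u] B.
Proof.
apply: sub_g_sigma => A [i _].
have mB u : 0 <= u -> measurable_fun setT (B u : g_sigma_algebraType
    (\bigcup_(u in [set u | 0 <= u]) sigma_rv (B u)) -> R).
  by move=> u0; apply: measurable_gsigma; exact: sigma_rv_family.
have mc : measurable_fun setT (noise i : g_sigma_algebraType
    (\bigcup_(u in [set u | 0 <= u]) sigma_rv (B u)) -> R).
  by apply: measurable_funB; apply: mB; exact: grid_ge0.
by move=> [C mC <-]; exact: mc.
Qed.

Lemma sampled_indep : independent3 P (sigma_family setT counts)
  (sigma_family setT S) (sigma_family setT noise).
Proof.
by move=> A C D cA sC nD; apply: hind => //; [exact: counts_family|exact: noise_family].
Qed.

Lemma counts_indep : mutually_independent P (fun i => sigma_rv (counts i)).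
Proof. by apply: (poisson_increments hN); [exact: grid_ge0|exact: nondecreasing_grid]. Qed.

Lemma noise_indep : mutually_independent P (fun i => sigma_rv (noise i)).
Proof. by apply: (brownian_increments hB); [exact: grid_ge0|exact: nondecreasing_grid]. Qed.

Lemma counts_law i k : P (counts i @^-1` [set k%:R]) = (poisson_pmf (lambda * t ^+ 2) k)%:E.
Proof.
rewrite -(gridB i) -(poisson_law hN k (grid_ge0 i) (grid_lt i)); congr (P _).
apply/seteqP; split => w /=; rewrite /counts.
  by move=> /eqP; rewrite subr_eq -natrD eqr_nat addnC => /eqP.
by move=> ->; rewrite natrD addrAC subrr add0r.
Qed.

Lemma counts_law0 i : P (counts i @^-1` [set 0]) = (expR (- (lambda * t ^+ 2)))%:E.
Proof.
rewrite (counts_law i 0) /poisson_pmf mulr_gt0 ?exprn_gt0//.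
by rewrite expr0 fact0 invr1 mulr1 mul1r.
Qed.

Lemma counts_law1 i : P (counts i @^-1` [set 1]) =
  (lambda * t ^+ 2 * expR (- (lambda * t ^+ 2)))%:E.
Proof.
rewrite (counts_law i 1) /poisson_pmf mulr_gt0 ?exprn_gt0//.
by rewrite expr1 divr1.
Qed.

Lemma noise_law i A : measurable A -> P (noise i @^-1` A) = normal_prob 0 t A.
Proof.
move=> mA; have := brownian_law hB (grid_ge0 i) (grid_lt i) mA; rewrite gridB sqrtr_sqr gtr0_norm//.
Qed.

End Mesh.

End Sampling.

Section Stop.
Context {d : measure_display} {T : measurableType d} {R : realType}.
Variables (s b : nat -> T -> R) (cnt : nat -> T -> nat) (x p sigma t : R).
Local Notation walk := (walk s b cnt x p sigma t).
Local Notation alive := (alive s b cnt x p sigma t).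
Local Notation stop := (stop s b cnt x p sigma t).

Lemma stop_dead k w : ~ alive k w -> walk (stop k w) w < 0.
Proof.
elim: k => [|k ih] na.
  by rewrite /= ltNge; apply/negP => w0; apply: na => j; rewrite leqn0 => /eqP ->.
rewrite /=; case: asboolP => ak; last by apply: ih.
rewrite ltNge; apply/negP => w0; apply: na => j.
by rewrite leq_eqVlt ltnS => /predU1P[->//|]; exact: ak.
Qed.

Lemma stop_le k j w : walk j w < 0 -> (stop k w <= j)%N.
Proof.
move=> wj; elim: k => [//|k ih] /=; case: asboolP => // ak.
by rewrite ltnNge; apply/negP => jk; move: wj; rewrite ltNge ak.
Qed.

End Stop.

(** * Convergence of the sampled ruin time along one path *)

Section Path.
Context {R : realType}.

(** Steps of length 4^(- m) then reach the time m, so the horizon tends to infinity as the grid is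
    refined. *)
Definition steps (m : nat) : nat := (m * 4 ^ m)%N.

Lemma steps_mesh m : (steps m)%:R * mesh m = m%:R :> R.
Proof.
rewrite /steps /mesh natrM -exprM mulnC exprM expr2 -mulrA natrX -exprMn.
by rewrite (_ : 4%:R * _ = 1) ?expr1n ?mulr1//; field.
Qed.

(** The default 0 is the value of e^(- q y) at y = +oo: paths without ruin drop out of the Laplace
    transform. *)
Definition discounted (q : R) (y : \bar R) : R :=
  if y is r%:E then expR (- q * r) else 0.

Definition first_negative (Y : R -> R) : \bar R :=
  ereal_inf [set t%:E | t in [set t | 0 <= t /\ Y t < 0]].

Variable Y : R -> R.
Hypothesis Yneg : forall u : R, 0 <= u -> Y u < 0 ->
  exists2 e : R, 0 < e & forall v : R, u <= v -> v < u + e -> Y v < 0.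
Let tau := first_negative Y.

Lemma first_negative_ge0 : (0 <= tau)%E.
Proof. by apply: le_ereal_inf_tmp => _ [t [t0 _] <-]; rewrite lee_fin. Qed.

Lemma first_negative_le u : 0 <= u -> Y u < 0 -> (tau <= u%:E)%E.
Proof. by move=> u0 Yu; apply: ereal_inf_lbound; exists u. Qed.

Lemma negative_grid u (e : R) : 0 <= u -> Y u < 0 -> 0 < e ->
  \forall m \near \oo, exists j : nat, j%:R * mesh m < u + e /\ Y (j%:R * mesh m) < 0.
Proof.
move=> u0 Yu e0; have [e' e'0 h] := Yneg u0 Yu.
have ee : 0 < Num.min e e' by rewrite lt_min e0.
near=> m; have [j [uj ju]] := grid_point m u0.
have : mesh m < Num.min e e' by near: m; exact: cvgr_lt (@cvg_mesh R) _ ee.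
rewrite lt_min => /andP[m1 m2].
exists j; split; first by rewrite (le_lt_trans ju)// ltrD2l.
by apply: h => //; rewrite (le_lt_trans ju)// ltrD2l.
Unshelve. all: by end_near. Qed.

(** A path that becomes negative stays so for a short while and is caught by every fine enough grid.
    Only countably many times remain, whence the measurability of the ruin time. *)
Lemma first_negative_lt (a : R) : (tau < a%:E)%E <->
  exists m j : nat, j%:R * mesh m < a /\ Y (j%:R * mesh m) < 0.
Proof.
split; last first.
  move=> [m [j [ja Yj]]]; apply: (@le_lt_trans _ _ (j%:R * mesh m)%:E); last by rewrite lte_fin.
  by apply: first_negative_le => //; rewrite mulr_ge0// ltW// mesh_gt0.
move=> /ereal_inf_lt[_ [u [u0 Yu] <-]]; rewrite lte_fin => ua.
have ua0 : 0 < a - u by rewrite subr_gt0.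
have [m _ /(_ m (leqnn m))[j]] := negative_grid u0 Yu ua0.
by rewrite addrC subrK => h; exists m, j.
Qed.

Variables (st : nat -> nat) (q : R).
Hypotheses (q0 : 0 < q)
  (st_le : forall m j, Y (j%:R * mesh m) < 0 -> (st m <= j)%N)
  (st_neg : forall m, st m = steps m \/ Y ((st m)%:R * mesh m) < 0).

(** If tau = +oo, every stop is at the horizon m and e^(- q m) tends to 0. If tau = r, the stop is
    at least r as soon as m >= r, and at most any negative grid time; fine grids have such times
    arbitrarily close to r. *)
Lemma discounted_cvg :
  expR (- q * ((st m)%:R * mesh m)) @[m --> \oo] --> discounted q tau.
Proof.
have h0 m : 0 < mesh m :> R := mesh_gt0 m.
have := first_negative_ge0; case E : tau => [r||]// r0; last first.
  rewrite (_ : (fun m => _) = (fun m => expR (- q) ^+ m)); last first.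
    apply/funext => m; have [->|Yn] := st_neg m.
      by rewrite steps_mesh mulrC expRM_natl.
    have : (tau <= ((st m)%:R * mesh m)%:E)%E.
      by apply: first_negative_le => //; rewrite mulr_ge0// ltW.
    by rewrite E.
  by apply: cvg_expr; rewrite ger0_norm ?expR_ge0// expR_lt1 oppr_lt0.
rewrite lee_fin in r0.
have c : (st m)%:R * mesh m @[m --> \oo] --> r.
  apply/cvgrPdist_lt => e e0.
  have e20 : 0 < e / 2 by rewrite divr_gt0.
  have [u [[u0 Yu] ur]] : exists u, (0 <= u /\ Y u < 0) /\ u < r + e / 2.
    have : (tau < (r + e / 2)%:E)%E by rewrite E lte_fin ltrDl.
    by move=> /ereal_inf_lt[_ [u uY <-]]; rewrite lte_fin => ?; exists u.
  near=> m.
  have [j [ju Yj]] : exists j : nat, j%:R * mesh m < u + e / 2 /\ Y (j%:R * mesh m) < 0.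
    by near: m; exact: negative_grid.
  have stj : (st m)%:R * mesh m <= j%:R * mesh m :> R.
    by rewrite ler_wpM2r ?ler_nat ?st_le ?(ltW (h0 m)).
  have rst : r <= (st m)%:R * mesh m.
    have [->|Yn] := st_neg m.
      by rewrite steps_mesh; near: m; exact: nbhs_infty_ger.
    by rewrite -lee_fin -E first_negative_le// mulr_ge0// ltW.
  rewrite distrC ger0_norm ?subr_ge0//; lra.
have c2 : - q * ((st m)%:R * mesh m) @[m --> \oo] --> - q * r.
  by apply: cvgM; [exact: cvg_cst|exact: c].
exact: (cvg_comp _ _ c2 (@continuous_expR R (- q * r))).
Unshelve. all: by end_near. Qed.

End Path.

Section ClipMix.
Context {R : realType}.
Variables (c1 c2 rho1 rho2 : R).
Hypotheses (c10 : 0 <= c1) (c20 : 0 <= c2) (c12 : c1 + c2 = 1)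
  (rho10 : 0 < rho1) (rho20 : 0 < rho2).

Lemma clip_mix_ge0 delta z : 0 <= clip_mix c1 c2 rho1 rho2 delta z.
Proof. by rewrite addr_ge0// mulr_ge0// ltW// clip_exp_gt0. Qed.

Lemma clip_mix_le delta z :
  clip_mix c1 c2 rho1 rho2 delta z <= 1 + clip_gap c1 c2 rho1 rho2 delta.
Proof.
have := ler_wpM2l c10 (clip_exp_le delta rho10 z).
have := ler_wpM2l c20 (clip_exp_le delta rho20 z).
rewrite /clip_mix /clip_gap; move: c12.
by move: (expR _) (expR _) (clip_exp _ _ _) (clip_exp _ _ _) => a b u v; lra.
Qed.

Lemma clip_mix_ge1 delta z : 0 < delta -> z <= 0 -> 1 <= clip_mix c1 c2 rho1 rho2 delta z.
Proof.
move=> d0 z0; have := ler_wpM2l c10 (clip_exp_lt0_ge1 rho10 d0 z0).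
have := ler_wpM2l c20 (clip_exp_lt0_ge1 rho20 d0 z0).
by rewrite /clip_mix; move: c12; move: (clip_exp _ _ _) (clip_exp _ _ _) => u v; lra.
Qed.

Lemma clip_mix_ge0E delta z : 0 < delta -> 0 <= z ->
  clip_mix c1 c2 rho1 rho2 delta z = c1 * expR (- rho1 * z) + c2 * expR (- rho2 * z).
Proof. by move=> d0 z0; rewrite /clip_mix !clip_exp_ge0E. Qed.

Lemma measurable_clip_mix delta : measurable_fun setT (clip_mix c1 c2 rho1 rho2 delta).
Proof. by apply: measurable_funD; apply: measurable_funM => //; exact: measurable_clip_exp. Qed.

Lemma clip_gap_ge0 delta : 0 < delta -> 0 <= clip_gap c1 c2 rho1 rho2 delta.
Proof.
move=> d0; apply: addr_ge0; apply: mulr_ge0 => //; rewrite subr_ge0;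
  rewrite (le_trans _ (expR_ge1Dx _))// lerDl mulr_ge0// ltW//.
Qed.

Lemma cvg_clip_gap : clip_gap c1 c2 rho1 rho2 delta @[delta --> (0 : R)^'+] --> (0 : R).
Proof.
have c (rho : R) : expR (rho * delta) @[delta --> (0 : R)^'+] --> (1 : R).
  have h : rho * delta @[delta --> (0 : R)^'+] --> rho * 0.
    by apply: cvgM; [exact: cvg_cst|apply: cvg_at_right_filter; exact: cvg_id].
  rewrite mulr0 in h; rewrite -[X in _ --> X](@expR0 R).
  exact: (cvg_comp _ _ h (@continuous_expR R 0)).
rewrite [X in _ --> X](_ : 0 = c1 * (1 - 1) + c2 * (1 - 1)); last by ring.
by apply: cvgD; apply: cvgM; try exact: cvg_cst; apply: cvgB; try exact: cvg_cst; exact: c.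
Qed.

End ClipMix.

Section Measurability.
Context {d : measure_display} {T : measurableType d} {R : realType}.

Lemma discounted_ge0 (q : R) y : 0 <= discounted q y.
Proof. by case: y => [r||]//=; exact: expR_ge0. Qed.

Lemma discounted_le1 (q : R) y : 0 <= q -> (0 <= y)%E -> discounted q y <= 1.
Proof.
by case: y => [r||]//= q0; rewrite lee_fin => r0; rewrite expR_le1 mulNr oppr_le0 mulr_ge0.
Qed.

Lemma measurable_discounted (q : R) (f : T -> \bar R) : measurable_fun setT f ->
  measurable_fun setT (fun w => discounted q (f w)).
Proof.
move=> mf; rewrite (_ : (fun w => _) = fun w =>
    if f w \is a fin_num then expR (- q * fine (f w)) else 0); last first.
  by apply/funext => w; case: (f w).
apply: measurable_fun_ifT => //.
  by apply: (measurable_fun_bool true); exact: emeasurable_fin_num.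
apply: measurableT_comp => //; apply: measurable_funM => //.
exact: measurableT_comp.
Qed.

Lemma measurable_first_negative (X : R -> T -> R) :
  (forall t, 0 <= t -> measurable_fun setT (X t)) ->
  (forall w (u : R), 0 <= u -> X u w < 0 ->
    exists2 e : R, 0 < e & forall v : R, u <= v -> v < u + e -> X v w < 0) ->
  measurable_fun setT (fun w => first_negative (X ^~ w)).
Proof.
move=> mX Xneg; apply: (measurability _ (ErealGenInftyO.measurableE R)).
move=> _ [_ [a ->] <-]; rewrite setTI.
rewrite (_ : _ @^-1` _ = \bigcup_m \bigcup_j
   (if j%:R * mesh m < a then [set w | X (j%:R * mesh m) w < 0] else set0)).
  apply: bigcup_measurable => m _; apply: bigcup_measurable => j _.
  case: ifP => // _; rewrite -[X in measurable X]setTI.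
  have g0 : 0 <= j%:R * mesh m :> R by rewrite mulr_ge0// ltW// mesh_gt0.
  rewrite (_ : [set w | _] = X (j%:R * mesh m) @^-1` `]-oo, 0[).
    by apply: mX => //; exact: measurable_itv.
  by apply/seteqP; split => w /=; rewrite in_itv.
apply/seteqP; split => w /=.
  rewrite in_itv/= => /(first_negative_lt (Xneg w) a).1[m [j [ja Xj]]].
  by exists m => //; exists j => //; rewrite ja.
move=> [m _ [j _]]; case: ifP => // ja Xj.
by rewrite in_itv/=; apply: (first_negative_lt (Xneg w) a).2; exists m, j.
Qed.

End Measurability.

Lemma integral_addr_cst {d : measure_display} {T : measurableType d} {R : realType}
    (P : probability T R) (f : T -> R) (c : R) :
  measurable_fun setT f -> (forall w, 0 <= f w) -> 0 <= c ->
  (\int[P]_w (f w + c)%:E = \int[P]_w (f w)%:E + c%:E)%E.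
Proof.
move=> mf f0 c0; rewrite -[in RHS](integral_probability_cst P c) -ge0_integralD//.
- by move=> w _; rewrite lee_fin.
- exact/measurable_EFinP.
Qed.

(** * The Laplace transform of the ruin time *)

Section Laplace.
Context {R : realType} {d : measure_display} {T : measurableType d}.
Variable P : probability T R.
Variables (N : R -> T -> nat) (S : nat -> T -> R) (B : R -> T -> R).
Variables (p lambda gamma sigma x : R).
Hypotheses (p0 : 0 < p) (lambda0 : 0 < lambda) (gamma0 : 0 < gamma) (x0 : 0 <= x)
  (hN : poisson_process P lambda N) (hS : iid_exponential P gamma S)
  (hB : brownian_motion P B) (hind : independent_sources P N S B).
Let X := perturbed_cramer_lundberg p sigma N S B x.
Let tau := ruin_time X.

Lemma perturbed_right_neg w (u : R) : 0 <= u -> X u w < 0 ->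
  exists2 e : R, 0 < e & forall v : R, u <= v -> v < u + e -> X v w < 0.
Proof.
apply: (@path_right_neg R x p sigma (N ^~ w) (S ^~ w) (B ^~ w)).
  by move=> t t0; exact: poisson_right_continuous hN w t t0.
exact: brownian_continuous hB w.
Qed.

Lemma measurable_ruin_time : measurable_fun setT tau.
Proof.
apply: (@measurable_first_negative _ _ _ X); last exact: perturbed_right_neg.
by move=> t t0; exact: (measurable_perturbed p sigma hN hS hB x t0).
Qed.

Lemma ruin_time_ge0 w : (0 <= tau w)%E.
Proof. exact: (first_negative_ge0 (X ^~ w)). Qed.

Let t (m : nat) : R := 2^-1 ^+ m.

Let t0 m : 0 < t m. Proof. by rewrite exprn_gt0// invr_gt0. Qed.

Let t1 m : t m <= 1. Proof. by rewrite exprn_ile1// ?invr_ge0//; lra. Qed.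

Let Y m := walk S (noise B (t m)) (total N (t m)) x p sigma (t m).

Lemma walk_sampled m k w : N 0 w = 0%N -> B 0 w = 0 -> Y m k w = X (k%:R * mesh m) w.
Proof.
move=> N0 B0; rewrite /Y /walk /X /perturbed_cramer_lundberg /total N0 subn0.
have -> : \sum_(i < k) noise B (t m) i w = B (k%:R * mesh m) w.
  rewrite -(big_mkord xpredT (fun i => noise B (t m) i w)) /noise.
  rewrite (telescope_sumr (fun i => B (grid (t m) i) w) (leq0n k)).
  by rewrite /grid mul0r B0 subr0.
by rewrite -mulrA (mulrC (_ ^+ 2)).
Qed.

Variable q : R.
Hypothesis q0 : 0 < q.

Let stp m := stop S (noise B (t m)) (total N (t m)) x p sigma (t m) (steps m).

Let disc m w : R := expR (- q * ((stp m w)%:R * mesh m)).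

Let mdisc m : measurable_fun setT (disc m).
Proof.
(* For the constant function 1 in place of [F], the stopped process is the discount factor
   itself. *)
have := measurable_stopped x p sigma (t m) (measurable_counts hN (t m)) (claims_measurable hS)
  (measurable_noise hB (t m)) (total0 N (t m)) (totalS hN (t m)) (total_le hN (t0 m))
  (measurable_cst (1 : R)) q (steps m).
rewrite (_ : stopped _ _ _ _ _ _ _ _ _ _ = disc m)//; apply/funext => w.
by rewrite /stopped /disc /= mulr1 -/(stp m w) /mesh -/(t m); congr expR; ring.
Qed.

Let disc0 m w : 0 <= disc m w. Proof. exact: expR_ge0. Qed.

Let disc1 m w : disc m w <= 1.
Proof. by rewrite expR_le1 mulNr oppr_le0 !mulr_ge0// ltW// mesh_gt0. Qed.

Let disc_cvg w : N 0 w = 0%N -> B 0 w = 0 ->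
  disc m w @[m --> \oo] --> discounted q (tau w).
Proof.
move=> N0 B0; apply: (@discounted_cvg R (X ^~ w) (@perturbed_right_neg w) (stp ^~ w) q q0).
  by move=> m j; rewrite -walk_sampled// => /stop_le; exact.
move=> m; have [al|dead] := pselect
  (alive S (noise B (t m)) (total N (t m)) x p sigma (t m) (steps m) w).
  by left; exact: stop_alive.
by right; rewrite -walk_sampled//; exact: stop_dead.
Qed.

Lemma integral_discounted_cvg :
  (\int[P]_w (disc m w)%:E)%E @[m --> \oo] --> (\int[P]_w (discounted q (tau w))%:E)%E.
Proof.
have [] := @dominated_convergence _ _ _ P setT measurableT (fun m w => (disc m w)%:E)
  (fun w => (discounted q (tau w))%:E) (cst 1%E).
- by move=> m; apply/measurable_EFinP.
- by apply/measurable_EFinP; apply: measurable_discounted; exact: measurable_ruin_time.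
- have h1 := poisson_start hN; have h2 := brownian_start hB.
  apply: filterS2 h1 h2 => w N0 B0 _.
  by apply: cvg_EFin; [exact: nearW|exact: disc_cvg].
- exact: finite_measure_integrable_cst.
- by apply: aeW => w m _; rewrite gee0_abs ?lee_fin.
by move=> _ _.
Qed.

Variables c1 c2 rho1 rho2 : R.
Hypotheses (c10 : 0 <= c1) (c20 : 0 <= c2) (c12 : c1 + c2 = 1)
  (rho10 : 0 < rho1) (rho20 : 0 < rho2) (rg1 : rho1 != gamma) (rg2 : rho2 != gamma)
  (com : c1 * (gamma / (gamma - rho1)) + c2 * (gamma / (gamma - rho2)) = 1)
  (kap1 : - rho1 * p + rho1 ^+ 2 * sigma ^+ 2 / 2 + lambda * (gamma / (gamma - rho1))
    = q + lambda)
  (kap2 : - rho2 * p + rho2 ^+ 2 * sigma ^+ 2 / 2 + lambda * (gamma / (gamma - rho2))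
    = q + lambda).

Section Gap.
Variable delta : R.
Hypothesis delta0 : 0 < delta.
Let F := clip_mix c1 c2 rho1 rho2 delta.
Let eta := clip_gap c1 c2 rho1 rho2 delta.
Let Z m := stopped S (noise B (t m)) (total N (t m)) x p sigma (t m) F q (steps m).

Let eta0 : 0 <= eta. Proof. exact: clip_gap_ge0. Qed.

Let F0 z : 0 <= F z. Proof. exact: clip_mix_ge0. Qed.

Let FM z : F z <= 1 + eta. Proof. exact: clip_mix_le. Qed.

Let gap (m : nat) := eta + (1 + eta) * expR (- q) ^+ m.

(** If the walk is ruined by the horizon, [F] lies between 1 and 1 + eta at the stop. If it is still
    alive there, the discount is e^(- q m) and [F] lies between 0 and 1 + eta. The two terms of
    [gap] cover these cases. *)
Let stopped_near m w : Z m w <= disc m w + gap m /\ disc m w <= Z m w + gap m.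
Proof.
have -> : Z m w = disc m w * F (Y m (stp m w) w).
  by rewrite /Z /stopped /disc -/(stp m w) /mesh -/(t m); congr (expR _ * _); ring.
have e0 : 0 <= expR (- q) ^+ m by rewrite exprn_ge0// expR_ge0.
have D0 := disc0 m w; have D1 := disc1 m w; have F0' := F0 (Y m (stp m w) w).
have FM' := FM (Y m (stp m w) w).
have [al|dead] := pselect (alive S (noise B (t m)) (total N (t m)) x p sigma (t m) (steps m) w).
  have dE : disc m w = expR (- q) ^+ m.
    by rewrite /disc /stp stop_alive// steps_mesh mulrC expRM_natl.
  have := ler_wpM2l e0 FM'; have := mulr_ge0 e0 F0'; have := mulr_ge0 e0 eta0.
  rewrite /gap -dE; move: D0 eta0; move: (disc m w) (F _) eta => D f g; split; lra.
have F1 : 1 <= F (Y m (stp m w) w).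
  by apply: clip_mix_ge1 => //; apply/ltW; exact: stop_dead.
have := ler_wpM2l D0 FM'; have := ler_wpM2l D0 F1; have := ler_wpM2r eta0 D1.
have := mulr_ge0 (addr_ge0 ler01 eta0) e0.
by rewrite /gap; move: D0 eta0; move: (expR _ ^+ m) (disc m w) (F _) eta => E D f g; split; lra.
Qed.

Let mZ m : measurable_fun setT (Z m).
Proof.
exact: (measurable_stopped x p sigma (t m) (measurable_counts hN (t m)) (claims_measurable hS)
  (measurable_noise hB (t m)) (total0 N (t m)) (totalS hN (t m)) (total_le hN (t0 m))
  (measurable_clip_mix c1 c2 rho1 rho2 delta) q (steps m)).
Qed.

(** The one-step error t^2 (lambda eta + K t) + (1 + eta) (lambda t^2)^2 is multiplied by (1 + q) /
    (q t^2) in the discounted sum, so the powers t^2 cancel. The last term replaces [F] at the stop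
    by 1. *)
Lemma integral_disc_near : exists2 K, 0 <= K & forall m,
  let e := (lambda * eta + K * t m + (1 + eta) * (lambda ^+ 2) * t m ^+ 2) * ((1 + q) / q)
    + gap m in
  (\int[P]_w (disc m w)%:E <= (F x + e)%:E)%E /\
  ((F x)%:E <= \int[P]_w (disc m w)%:E + e%:E)%E.
Proof.
have mS : measurable_fun setT (S 0 : T -> measurableTypeR R).
  exact: claims_measurable hS 0%N.
pose S0 : {mfun T >-> measurableTypeR R} := HB.pack (S 0 : T -> measurableTypeR R)
  (isMeasurableFun.Build _ _ _ _ _ mS).
pose mu : probability (measurableTypeR R) R := distribution P S0.
have muE A : measurable A -> mu A = exponential_prob gamma A.
  exact: claims_law hS 0%N A.
have [K K0 HK] := @walk_step_clip_mix R p sigma lambda gamma q mu p0 lambda0 gamma0 q0 muE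
  c1 c2 rho1 rho2 delta c10 c20 c12 rho10 rho20 delta0 rg1 rg2 com kap1 kap2.
exists K => // m e.
have err0 : 0 <= t m ^+ 2 * (lambda * eta + K * t m).
  by rewrite mulr_ge0 ?sqr_ge0// addr_ge0// mulr_ge0// ltW.
have lawS k A : measurable A -> P (S k @^-1` A) = mu A.
  by move=> mA; rewrite muE//; exact: claims_law hS k A mA.
have l0 := ltW lambda0.
have sb := stopped_bound x (measurable_counts hN (t m)) (claims_measurable hS)
  (measurable_noise hB (t m)) (total0 N (t m)) (totalS hN (t m)) (total_le hN (t0 m))
  (sampled_indep (t := t m) hind) (counts_indep (t := t m) hN) (claims_independent hS)
  (noise_indep (t := t m) hB) (counts_law0 lambda0 hN (t0 m)) (counts_law1 lambda0 hN (t0 m))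
  (noise_law hB (t0 m)) lawS (measurable_clip_mix c1 c2 rho1 rho2 delta) F0 l0 q0 (t0 m) FM
  err0 (fun y y0 => HK (t m) y (t0 m) (t1 m) y0) (steps m) (t1 m).
move: sb; cbv zeta; rewrite -/(Z m).
set e1 := _ * ((1 + q) / _).
have e1E : e = e1 + gap m.
  rewrite /e /e1 /step_err; congr (_ + _); have := t0 m; have := q0.
  by move: (t m) eta => a h a0 q0'; field; rewrite !lt0r_neq0.
move=> [h1 h2]; have g0 : 0 <= gap m.
  rewrite /gap; apply: addr_ge0 => //; apply: mulr_ge0; first exact: addr_ge0.
  by rewrite exprn_ge0// expR_ge0.
have Z0 w : 0 <= Z m w by exact: stopped_ge0.
rewrite e1E addrA; split.
  apply: (@le_trans _ _ (\int[P]_w (Z m w + gap m)%:E)%E).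
    apply: le_integral_real => // w; last by case: (stopped_near m w).
    exact: measurable_funD.
  rewrite (integral_addr_cst P (mZ m) Z0 g0) [leRHS]EFinD; exact: leeD.
apply: (le_trans h2); rewrite (addrC e1) EFinD addeA; apply: leeD => //.
rewrite -(integral_addr_cst P (mdisc m) (disc0 m) g0); apply: le_integral_real => //; last first.
  by move=> w; case: (stopped_near m w).
exact: measurable_funD.
Qed.

End Gap.

(** For fixed delta, refining the grid bounds the difference of the two sides by a multiple of the
    clipping gap; then delta tends to 0. The order is forced because [K] depends on delta. *)
Theorem laplace_ruin_time : (\int[P]_w (discounted q (tau w))%:E)%E =
  (c1 * expR (- rho1 * x) + c2 * expR (- rho2 * x))%:E.
Proof.
have tc : t m @[m --> \oo] --> 0 := @cvg_half R.
have D0 w := discounted_ge0 q (tau w).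
have D1 w : discounted q (tau w) <= 1.
  by apply: discounted_le1; [exact: ltW|exact: ruin_time_ge0].
set I := (\int[P]_w _)%E; have I0 : (0 <= I)%E by apply: integral_ge0 => w _; rewrite lee_fin.
have I1 : (I <= 1)%E.
  rewrite -[leRHS](integral_probability_cst P 1); apply: le_integral_real => //.
  by apply: measurable_discounted; exact: measurable_ruin_time.
have IE : I = (fine I)%:E by rewrite fineK// ge0_fin_numE// (le_lt_trans I1)// ltry.
rewrite IE; congr (_%:E); move: (fine I) IE => a IE.
set b := _ + _.
have near delta : 0 < delta ->
    `|a - b| <= clip_gap c1 c2 rho1 rho2 delta * (lambda * ((1 + q) / q) + 1).
  move=> d0; have [K K0 HK] := integral_disc_near d0.
  set eta := clip_gap _ _ _ _ _ in HK *.
  have Ic := integral_discounted_cvg; rewrite -/I IE in Ic.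
  have /fine_cvg Ic' := Ic.
  have e_cvg : (lambda * eta + K * t m + (1 + eta) * (lambda ^+ 2) * t m ^+ 2) * ((1 + q) / q)
    + (eta + (1 + eta) * expR (- q) ^+ m) @[m --> \oo] -->
    (lambda * eta + K * 0 + (1 + eta) * (lambda ^+ 2) * (0 * 0)) * ((1 + q) / q)
    + (eta + (1 + eta) * 0).
    apply: cvgD.
      apply: cvgM; last exact: cvg_cst.
      apply: cvgD; first by apply: cvgD; [exact: cvg_cst|apply: cvgM; [exact: cvg_cst|exact: tc]].
      by apply: cvgM; [exact: cvg_cst|apply: cvgM; exact: tc].
    apply: cvgD; first exact: cvg_cst.
    apply: cvgM; first exact: cvg_cst.
    by apply: cvg_expr; rewrite ger0_norm ?expR_ge0// expR_lt1 oppr_lt0.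
  rewrite (_ : _ * _ = (lambda * eta + K * 0 + (1 + eta) * (lambda ^+ 2) * (0 * 0)) * ((1 + q) / q)
    + (eta + (1 + eta) * 0)); last by ring.
  have dc : `|fine (\int[P]_w (disc m w)%:E) - b| @[m --> \oo] --> `|a - b|.
    by apply: cvg_norm; apply: cvgB; [exact: Ic'|exact: cvg_cst].
  apply: ler_cvg_to dc e_cvg _; near=> m.
  have J0 : (0 <= \int[P]_w (disc m w)%:E)%E by apply: integral_ge0 => w _; rewrite lee_fin.
  have J1 : (\int[P]_w (disc m w)%:E <= 1)%E.
    by rewrite -[leRHS](integral_probability_cst P 1); apply: le_integral_real.
  have JE : (\int[P]_w (disc m w)%:E = (fine (\int[P]_w (disc m w)%:E))%:E)%E.
    by rewrite fineK// ge0_fin_numE// (le_lt_trans J1)// ltry.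
  have := HK m; cbv zeta; rewrite JE clip_mix_ge0E// -/b !lee_fin.
  by case=> h1 h2; rewrite ler_norml lerNl opprB !lerBlDl; apply/andP; split.
apply/eqP; rewrite -subr_eq0 -normr_le0.
rewrite -[leRHS](mul0r (lambda * ((1 + q) / q) + 1)).
apply: ler_cvg_to (cvg_cst _) (cvgM (cvg_clip_gap c1 c2 rho1 rho2) (cvg_cst _)) _.
by near=> delta; apply: near; near: delta; exact: nbhs_right_gt.
Unshelve. all: by end_near. Qed.

End Laplace.

Ltac cvg_arith := repeat lazymatch goal with
  | |- context [fmap (fun q => @GRing.add _ (@?f q) (@?g q))] => apply: cvgD
  | |- context [fmap (fun q => @GRing.mul _ (@?f q) (@?g q))] => apply: cvgM
  | |- context [fmap (fun q => @GRing.opp _ (@?f q))] => apply: cvgN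
  | |- context [fmap (@GRing.mul _ _)] => apply: cvgM
  | |- context [fmap (fun q => ?c)] => exact: cvg_cst
  | |- _ => eassumption
  end.

(** * Second-order expansions at 0 *)

Section Jets.
Context {R : realType}.
Implicit Types (f g : R -> R) (a b c x : R).

(** Mean value theorem for the remainder, whose derivative is the remainder of one order less. *)
Lemma norm_expR_sub2D x : `|expR x - 1 - x - x ^+ 2 / 2| <= `|x| ^+ 3 * expR `|x|.
Proof.
pose g z : R := expR z - 1 - z - z ^+ 2 / 2.
have dg (z : R) : is_derive z 1 g (expR z - 1 - z).
  rewrite /g; apply: is_derive_eq.
  by rewrite /GRing.scale/=; field.
have cg (I : interval R) : {within [set` I], continuous g}.
  apply: continuous_subspaceT => z; apply: differentiable_continuous.
  exact/derivable1_diffP/(ex_derive (is_derive := dg z)).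
have g0 : g 0 = 0 by rewrite /g expR0; ring.
have bnd (z : R) : `|z| <= `|x| -> `|expR z - 1 - z| <= `|x| ^+ 2 * expR `|x|.
  move=> zx; apply: (le_trans (norm_expR_sub1D z)); apply: ler_pM => //.
  - by rewrite lerXn2r ?nnegrE.
  - by rewrite ler_expR.
have [x0|x0] := leP 0 x.
  have [z /itvP zi gE] := MVT_segment x0 (fun z _ => dg z) (cg _).
  rewrite -/(g x) -[g x]subr0 -g0 gE subr0 normrM mulrC exprS -mulrA ler_wpM2l//.
  by apply: bnd; rewrite !ger0_norm ?zi.
have [z /itvP zi gE] := MVT_segment (ltW x0) (fun z _ => dg z) (cg _).
rewrite -/(g x) -[g x]opprK normrN -[- g x]add0r -g0 gE sub0r normrM normrN mulrC.
rewrite exprS -mulrA ler_wpM2l//.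
by apply: bnd; rewrite !ler0_norm ?zi ?lerN2 ?zi// ltW.
Qed.

(** The expansion f(q) = a + b q + c q^2 + o(q^2) as q decreases to 0, a property of the germ that
    involves no derivative of [f]. *)
Definition jet f a b c :=
  (f q - (a + b * q + c * q ^+ 2)) / q ^+ 2 @[q --> (0 : R)^'+] --> (0 : R).

Lemma jetP f a b c : jet f a b c <-> exists2 r : R -> R, r q @[q --> (0 : R)^'+] --> (0 : R) &
  \forall q \near (0 : R)^'+, f q = a + b * q + c * q ^+ 2 + r q * q ^+ 2.
Proof.
split=> [j|[r r0 fE]].
  exists (fun q => (f q - (a + b * q + c * q ^+ 2)) / q ^+ 2) => //.
  near=> q; have q0 : q != 0 by rewrite gt_eqF//; near: q; exact: nbhs_right_gt.
  by field.
apply: cvg_trans r0; apply: near_eq_cvg; near=> q.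
have q0 : q != 0 by rewrite gt_eqF//; near: q; exact: nbhs_right_gt.
by rewrite (near fE q)//; field.
Unshelve. all: by end_near. Qed.

Lemma cvg_right_id : q @[q --> (0 : R)^'+] --> (0 : R).
Proof. by apply: cvg_at_right_filter; exact: cvg_id. Qed.

Lemma jet_cst a : jet (cst a) a 0 0.
Proof.
apply/jetP; exists (cst 0); first exact: cvg_cst.
by near=> q; rewrite /=; ring.
Unshelve. all: by end_near. Qed.

Lemma jet_id : jet id 0 1 0.
Proof.
apply/jetP; exists (cst 0); first exact: cvg_cst.
by near=> q; rewrite /=; ring.
Unshelve. all: by end_near. Qed.

Lemma jet_near f g a b c : (\forall q \near (0 : R)^'+, f q = g q) ->
  jet f a b c -> jet g a b c.
Proof.
move=> fg /jetP[r r0 fE]; apply/jetP; exists r => //.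
by near=> q; rewrite -(near fg q)// (near fE q).
Unshelve. all: by end_near. Qed.

Lemma jet_eq f a b c a' b' c' : a = a' -> b = b' -> c = c' ->
  jet f a b c -> jet f a' b' c'.
Proof. by move=> -> -> ->. Qed.

Lemma jetD f g a b c a' b' c' : jet f a b c -> jet g a' b' c' ->
  jet (fun q => f q + g q) (a + a') (b + b') (c + c').
Proof.
move=> /jetP[r r0 fE] /jetP[s s0 gE]; apply/jetP; exists (fun q => r q + s q).
  by rewrite -[X in _ --> X](addr0 0); apply: cvgD.
by near=> q; rewrite (near fE q)// (near gE q)//; ring.
Unshelve. all: by end_near. Qed.

Lemma jetM f g a b c a' b' c' : jet f a b c -> jet g a' b' c' ->
  jet (fun q => f q * g q) (a * a') (a * b' + b * a') (a * c' + b * b' + c * a').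
Proof.
move=> /jetP[r r0 fE] /jetP[s s0 gE]; apply/jetP.
exists (fun q => (b * c' + c * b') * q + c * c' * (q * q) + r q * (a' + b' * q + c' * (q * q))
  + s q * (a + b * q + c * (q * q)) + r q * s q * (q * q)).
  have i := cvg_right_id.
  rewrite [X in _ --> X](_ : 0 = (b * c' + c * b') * 0 + c * c' * (0 * 0)
  + 0 * (a' + b' * 0 + c' * (0 * 0))
  + 0 * (a + b * 0 + c * (0 * 0)) + 0 * 0 * (0 * 0)); last by ring.
  by cvg_arith.
by near=> q; rewrite (near fE q)// (near gE q)//; ring.
Unshelve. all: by end_near. Qed.

Lemma jet_scale k f a b c : jet f a b c -> jet (fun q => k * f q) (k * a) (k * b) (k * c).
Proof.
by move=> jf; apply: jet_eq (jetM (jet_cst k) jf); ring.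
Qed.

Lemma jet_cvg f a b c : jet f a b c -> f q @[q --> (0 : R)^'+] --> a.
Proof.
move=> /jetP[r r0 fE]; have i := cvg_right_id.
have h : a + b * q + c * (q * q) + r q * (q * q) @[q --> (0 : R)^'+] --> a.
  rewrite [X in _ --> X](_ : a = a + b * 0 + c * (0 * 0) + 0 * (0 * 0)); last by ring.
  by cvg_arith.
apply: cvg_trans h; apply: near_eq_cvg.
by near=> q; rewrite (near fE q)//; ring.
Unshelve. all: by end_near. Qed.

(** For the candidate polynomial g, the product rule gives f g = 1 + r q^2 with r tending to 0,
    hence 1 / f = g - (r / f) q^2. *)
Lemma jetV f a b c : a != 0 -> jet f a b c ->
  jet (fun q => (f q)^-1) a^-1 (- b / a ^+ 2) (b ^+ 2 / a ^+ 3 - c / a ^+ 2).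
Proof.
move=> a0 jf.
set g := fun q : R => a^-1 + (- b / a ^+ 2) * q + (b ^+ 2 / a ^+ 3 - c / a ^+ 2) * q ^+ 2.
have jg : jet g a^-1 (- b / a ^+ 2) (b ^+ 2 / a ^+ 3 - c / a ^+ 2).
  by apply/jetP; exists (cst 0); [exact: cvg_cst|near=> q; rewrite /= mul0r addr0].
have jfg : jet (fun q => f q * g q) 1 0 0.
  by apply: jet_eq (jetM jf jg); field.
have fa := jet_cvg jf.
have fV : (f q)^-1 @[q --> (0 : R)^'+] --> a^-1 by exact: cvgV.
move: jfg => /jetP[r r0 fgE]; apply/jetP; exists (fun q => - (f q)^-1 * r q).
  by rewrite -[X in _ --> X](mulr0 (- a^-1)); apply: cvgM => //; exact: cvgN.
near=> q; rewrite -/(g q).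
have fq0 : f q != 0 by near: q; exact: cvgr_neq0 fa a0.
have := near fgE q; move=> /(_ _) fg.
have -> : g q = (f q)^-1 * (f q * g q) by field.
by rewrite fg//; field.
Unshelve. all: by end_near. Qed.

(** Write f = a + q z(q) with z tending to b; the second-order remainder of the exponential at q
    z(q) is O(q^3). *)
Lemma jet_expR f a b c : jet f a b c ->
  jet (fun q => expR (f q)) (expR a) (expR a * b) (expR a * (c + b ^+ 2 / 2)).
Proof.
move=> /jetP[r r0 fE]; have i := cvg_right_id.
pose z q := b + c * q + r q * q.
have zb : z q @[q --> (0 : R)^'+] --> b.
  rewrite [X in _ --> X](_ : b = b + c * 0 + 0 * 0); last by ring.
  by rewrite /z; cvg_arith.
pose h q := (expR (q * z q) - 1 - q * z q - (q * z q) ^+ 2 / 2) / q ^+ 2.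
have h0 : h q @[q --> (0 : R)^'+] --> (0 : R).
  have qz0 : `|q * z q| @[q --> (0 : R)^'+] --> `|0 * b| by apply: cvg_norm; exact: cvgM.
  have e1 : expR `|q * z q| @[q --> (0 : R)^'+] --> expR `|0 * b|.
    exact: (cvg_comp _ _ qz0 (@continuous_expR R _)).
  have nz : `|z q| @[q --> (0 : R)^'+] --> `|b| by exact: cvg_norm.
  have b0 : q * (`|z q| * (`|z q| * `|z q|)) * expR `|q * z q| @[q --> (0 : R)^'+] --> (0 : R).
    rewrite [X in _ --> X](_ : 0 = 0 * (`|b| * (`|b| * `|b|)) * expR `|0 * b|); last by ring.
    by cvg_arith.
  apply/cvgr0Pnorm_le => e e0; near=> q.
  have q0 : 0 < q by near: q; exact: nbhs_right_gt.
  apply: (@le_trans _ _ (q * (`|z q| * (`|z q| * `|z q|)) * expR `|q * z q|)); last first.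
    near: q; exact: (cvgr_le _ b0).
  rewrite /h normrM normfV (ger0_norm (sqr_ge0 q)) ler_pdivrMr ?exprn_gt0//.
  apply: (le_trans (norm_expR_sub2D _)); move: (expR _) => E.
  rewrite normrM (gtr0_norm q0).
  by rewrite le_eqVlt; apply/orP; left; apply/eqP; ring.
apply/jetP; exists (fun q => expR a * (r q + (z q * z q - b ^+ 2) / 2 + h q)).
  rewrite [X in _ --> X](_ : 0 = expR a * (0 + (b * b - b ^+ 2) / 2 + 0)); last by ring.
  by cvg_arith.
near=> q; have q0 : q != 0 by rewrite gt_eqF//; near: q; exact: nbhs_right_gt.
rewrite (near fE q)// (_ : a + _ + _ + _ = a + q * z q); last by rewrite /z; ring.
rewrite expRD /h; move: (expR (q * _)) (expR a) => E A; rewrite /z; field.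
Unshelve. all: by end_near. Qed.

End Jets.

(** * Expansion of the roots of psi(- rho) = q *)

Section RootJet.
Context {R : realType}.
Variables (v g al be : R).
Hypotheses (v0 : v != 0) (al0 : al != 0) (ab : al != be).

(** [D] and [E] are the derivative and half the second derivative at [al] of v / 2 z (z - al) (z -
    be). The coefficients below solve D a = al - g and D b + E a^2 = a, the orders q and q^2 of the
    equation. *)
Let D := v / 2 * al * (al - be).
Let E := v / 2 * (2 * al - be).

Definition root_jet1 : R := (al - g) / D.
Definition root_jet2 : R := (root_jet1 - E * root_jet1 ^+ 2) / D.
Let a := root_jet1.
Let b := root_jet2.

Let D0 : D != 0.
Proof. by rewrite !mulf_neq0 ?invr_eq0 ?subr_eq0 ?pnatr_eq0. Qed.

(* The roots of [cubic _ q] near [al] for small [q] are located by the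
   intermediate value theorem on an interval of length O(q^3) around the
   formal second-order solution. *)
Let cubic (z q : R) := v / 2 * z * (z - al) * (z - be) - q * (z - g).

(** The cubic at al + a q + b q^2 + s q^3, divided by q^3. As q tends to 0 it becomes affine in s,
    with slope [D], so s controls its sign. *)
Let quot (s q : R) := D * s
  + E * (2 * a * b + (b ^+ 2 + 2 * a * s) * q + 2 * b * s * (q * q) + s ^+ 2 * (q * (q * q)))
  + v / 2 * ((a + b * q + s * (q * q)) * ((a + b * q + s * (q * q)) * (a + b * q + s * (q * q))))
  - b - s * q.

Let cubicE s q : cubic (al + a * q + b * q ^+ 2 + s * q ^+ 3) q = q ^+ 3 * quot s q.
Proof.
have aE : D * a = al - g by rewrite /a /root_jet1 mulrC divfK.
have bE : D * b = a - E * a ^+ 2 by rewrite /b /root_jet2 mulrC divfK.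
rewrite -[LHS](subrK (q * (D * a - (al - g)) + q ^+ 2 * (D * b - (a - E * a ^+ 2)))).
rewrite {2}aE {2}bE !subrr !mulr0 !addr0 /cubic /quot /D /E.
by move: a b => a' b'; field.
Qed.

Let M := E * (2 * a * b) + v / 2 * (a * (a * a)) - b.

Let quot_cvg s : quot s q @[q --> (0 : R)^'+] --> D * s + M.
Proof.
have i := @cvg_right_id R.
rewrite [X in _ --> X](_ : _ = D * s
  + E * (2 * a * b + (b ^+ 2 + 2 * a * s) * 0 + 2 * b * s * (0 * 0) + s ^+ 2 * (0 * (0 * 0)))
  + v / 2 * ((a + b * 0 + s * (0 * 0)) * ((a + b * 0 + s * (0 * 0)) * (a + b * 0 + s * (0 * 0))))
  - b - s * 0); last by rewrite /M; ring.
by rewrite /quot; cvg_arith.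
Qed.

Lemma root_jetP : exists2 rho : R -> R, jet rho al root_jet1 root_jet2 &
  \forall q \near (0 : R)^'+, v / 2 * rho q * (rho q - al) * (rho q - be) = q * (rho q - g).
Proof.
(* Since |D K| exceeds |M|, the limits D K + M and - D K + M have opposite signs, and the cubic
   changes sign between s = - K and s = K. *)
pose K := (`|M| + 1) / `|D|.
have DK : `|D * K| = `|M| + 1.
  rewrite normrM (ger0_norm (_ : 0 <= K)) ?divr_ge0 ?addr_ge0//.
  by rewrite /K mulrC divfK// normr_eq0.
have K0 : 0 <= K by rewrite divr_ge0// addr_ge0.
have c : quot K q * quot (- K) q @[q --> (0 : R)^'+] --> (D * K + M) * (D * - K + M).
  by apply: cvgM; exact: quot_cvg.
have n : (D * K + M) * (D * - K + M) < 0.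
  rewrite (_ : _ * _ = M ^+ 2 - (D * K) ^+ 2); last by ring.
  rewrite -(real_normK (num_real M)) -(real_normK (num_real (D * K))) DK.
  by have := normr_ge0 M; move: `|M| => m; nra.
pose z s q := al + a * q + b * q ^+ 2 + s * q ^+ 3.
have root : \forall q \near (0 : R)^'+, exists y, `|y - (al + a * q + b * q ^+ 2)| <= K * q ^+ 3
    /\ cubic y q = 0.
  near=> q; have q0 : 0 < q by near: q; exact: nbhs_right_gt.
  have q3 : 0 < q ^+ 3 by rewrite exprn_gt0.
  have zz : z (- K) q <= z K q by rewrite lerD2l ler_wpM2r ?(ltW q3)// ge0_cp.
  have cc : {within `[z (- K) q, z K q], continuous (cubic ^~ q)}.
    apply: continuous_subspaceT => y.
    rewrite /cubic; apply: cvgB; apply: cvgM; try exact: cvg_cst.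
      apply: cvgM; first by apply: cvgM; [exact: cvg_cst|exact: cvg_id].
      by apply: cvgB; [exact: cvg_id|exact: cvg_cst].
      by apply: cvgB; [exact: cvg_id|exact: cvg_cst].
      by apply: cvgB; [exact: cvg_id|exact: cvg_cst].
  have neg : cubic (z K q) q * cubic (z (- K) q) q < 0.
    rewrite /z !cubicE mulrACA pmulr_rlt0 ?mulr_gt0//.
    by near: q; exact: (cvgr_lt _ c).
  have zero : Num.min (cubic (z (- K) q) q) (cubic (z K q) q) <= 0
      <= Num.max (cubic (z (- K) q) q) (cubic (z K q) q).
    move: neg; move: (cubic _ _) (cubic _ _) => s t st.
    rewrite ge_min le_max; apply/andP; split; apply/orP;
      by have [|] := leP s 0; have [|] := leP t 0; nra.
  have [y] := IVT zz cc zero; rewrite in_itv/= /z => /andP[y1 y2] yE.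
  by exists y; split => //; rewrite ler_norml; apply/andP; split; lra.
pose roots q : set R := [set y | `|y - (al + a * q + b * q ^+ 2)| <= K * q ^+ 3 /\ cubic y q = 0].
(* A root is chosen separately for each q; the bound K q^3 alone yields the expansion. *)
pose rho q := get (roots q).
have rhoP : \forall q \near (0 : R)^'+,
    `|rho q - (al + a * q + b * q ^+ 2)| <= K * q ^+ 3 /\ cubic (rho q) q = 0.
  near=> q; have [y yP] : exists y, `|y - (al + a * q + b * q ^+ 2)| <= K * q ^+ 3 /\ cubic y q = 0.
    by near: q; exact: root.
  by apply: (@getPex R (roots q)); exists y.
exists rho; last first.
  near=> q; apply/eqP; rewrite -subr_eq0; apply/eqP.
  by have [] : `|rho q - (al + a * q + b * q ^+ 2)| <= K * q ^+ 3 /\ cubic (rho q) q = 0 by near: q.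
have i := @cvg_right_id R.
apply/cvgr0Pnorm_le => e e0; near=> q.
have q0 : 0 < q by near: q; exact: nbhs_right_gt.
have [h _] : `|rho q - (al + a * q + b * q ^+ 2)| <= K * q ^+ 3 /\ cubic (rho q) q = 0 by near: q.
rewrite normrM normfV (ger0_norm (sqr_ge0 q)) ler_pdivrMr ?exprn_gt0//.
apply: (le_trans h); rewrite exprS mulrA ler_wpM2r ?sqr_ge0//.
near: q; apply: (cvgr_le 0) => //.
by rewrite -[X in _ --> X](mulr0 K); apply: cvgM => //; exact: cvg_cst.
Unshelve. all: by end_near. Qed.

End RootJet.

(** * The coefficients of the statement in terms of the roots *)

Section Coefficients.
Context {R : realType}.
Variables (v g al be : R).

(* Second-order expansion of the weight be(q) (g - al(q)) / (g (be(q) - al(q))). *)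
Definition weight0 : R := be * (g - al) / (g * (be - al)).

Definition weight1 : R :=
  (root_jet1 v g be al * (g - al) - be * root_jet1 v g al be
   - weight0 * (g * (root_jet1 v g be al - root_jet1 v g al be))) / (g * (be - al)).

Definition weight2 : R :=
  (root_jet2 v g be al * (g - al) - root_jet1 v g be al * root_jet1 v g al be
   - be * root_jet2 v g al be
   - weight1 * (g * (root_jet1 v g be al - root_jet1 v g al be))
   - weight0 * (g * (root_jet2 v g be al - root_jet2 v g al be))) / (g * (be - al)).

Variables (p lambda sigma s : R).
Hypotheses (v0 : v != 0) (g0 : g != 0) (al0 : al != 0) (be0 : be != 0)
  (alg : al != g) (beg : be != g) (ab : al != be).
Hypotheses (vE : sigma ^+ 2 = v) (pE : p = v / 2 * (al + be - g))
  (lE : lambda = v / 2 * ((g - al) * (be - g)))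
  (s1 : s = 1 \/ s = -1) (rE : rr p lambda g sigma = s * (v * (be - al))).

Let sr : s * rr p lambda g sigma = v * (be - al).
Proof. by rewrite rE; case: s1 => ->; ring. Qed.

Let f1 : g * sigma ^+ 2 + 2 * p - s * rr p lambda g sigma = 2 * v * al.
Proof. by rewrite sr vE pE; field. Qed.

Let f2 : g * sigma ^+ 2 - 2 * p + s * rr p lambda g sigma = 2 * v * (g - al).
Proof. by rewrite sr vE pE; field. Qed.

Let f3 : g * sigma ^+ 2 - 2 * p - s * rr p lambda g sigma = 2 * v * (g - be).
Proof. by rewrite sr vE pE; field. Qed.

Let f4 : p * g - lambda = v * al * be / 2.
Proof. by rewrite pE lE; field. Qed.

Let v4 : sigma ^+ 4 = v ^+ 2.
Proof. by rewrite -vE -exprM. Qed.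

Let v6 : sigma ^+ 6 = v ^+ 3.
Proof. by rewrite -vE -exprM. Qed.

Let ne : [/\ g - al != 0, al - g != 0, be - al != 0, al - be != 0 & be - g != 0].
Proof. by split; rewrite subr_eq0// eq_sym. Qed.

(** As s r = v (be - al), every factor is a multiple of al, g - al or g - be, and the claim becomes
    an identity between rational functions of v, g, al and be. The lower signs are obtained with s =
    - 1 and the roots exchanged. *)
Lemma slopeE : s * (2 / rr p lambda g sigma) * ((g * sigma ^+ 2 - 2 * p + s * rr p lambda g sigma)
  / (g * sigma ^+ 2 + 2 * p - s * rr p lambda g sigma)) = root_jet1 v g al be.
Proof.
have [n1 n2 n3 n4 n5] := ne.
rewrite f1 f2 rE /root_jet1.
by case: s1 => ->; field; rewrite ?n1 ?n2 ?n3 ?n4 ?n5 ?g0 ?al0 ?be0 ?v0.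
Qed.

(** Minus the logarithmic derivative at q = 0 of the weight of the branch. *)
Lemma A_upE : A_up p lambda g sigma s = - (weight1 / weight0).
Proof.
have [n1 n2 n3 n4 n5] := ne.
rewrite /A_up f1 f2 f4 v4 vE rE lE /weight1 /weight0 /root_jet1.
by case: s1 => ->; field; rewrite ?n1 ?n2 ?n3 ?n4 ?n5 ?g0 ?al0 ?be0 ?v0.
Qed.

(** The coefficient of x in twice the second-order term of one branch, relative to the leading term;
    [C_upE] gives the part constant in x. *)
Lemma B_upE : B_up p lambda g sigma s =
  - 2 * (weight1 / weight0) * root_jet1 v g al be - 2 * root_jet2 v g al be.
Proof.
have [n1 n2 n3 n4 n5] := ne.
rewrite /B_up f1 f2 f4 v4 vE rE lE /weight1 /weight0 /root_jet2 /root_jet1.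
by case: s1 => ->; field; rewrite ?n1 ?n2 ?n3 ?n4 ?n5 ?g0 ?al0 ?be0 ?v0.
Qed.

Lemma C_upE : C_up p lambda g sigma s = 2 * (weight2 / weight0).
Proof.
have [n1 n2 n3 n4 n5] := ne.
rewrite /C_up B_upE f1 f2 f3 f4 v4 v6 vE rE lE.
rewrite /weight2 /weight1 /weight0 /root_jet2 /root_jet1.
by case: s1 => ->; field; rewrite ?n1 ?n2 ?n3 ?n4 ?n5 ?g0 ?al0 ?be0 ?v0.
Qed.

End Coefficients.

Section JetLimits.
Context {R : realType}.
Implicit Types (f : R -> R) (a b c : R).

Lemma jet_slope f a b c : jet f a b c -> (a - f q) / q @[q --> (0 : R)^'+] --> - b.
Proof.
move=> /jetP[r r0 fE]; have i := @cvg_right_id R.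
have h : - b - c * q - r q * q @[q --> (0 : R)^'+] --> - b.
  by rewrite [X in _ --> X](_ : _ = - b - c * 0 - 0 * 0); [cvg_arith|ring].
apply: cvg_trans h; apply: near_eq_cvg; near=> q.
have q0 : q != 0 by rewrite gt_eqF//; near: q; exact: nbhs_right_gt.
by rewrite (near fE q)//; field.
Unshelve. all: by end_near. Qed.

Lemma jet_double f a b c : jet f a b c -> jet (fun q => f (2 * q)) a (2 * b) (4 * c).
Proof.
move=> jf; have d : 2 * q @[q --> (0 : R)^'+] --> (0 : R)^'+.
  move=> A /= [e e0 hA]; exists (e / 2); first by rewrite /= divr_gt0.
  move=> q /= qe q0; apply: hA => /=; last by rewrite mulr_gt0.
  by move: qe; rewrite /ball/= !sub0r !normrN !gtr0_norm ?mulr_gt0//; lra.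
move: jf => /jetP[r r0 fE]; apply/jetP; exists (fun q => 4 * r (2 * q)).
  have r2 : r (2 * q) @[q --> (0 : R)^'+] --> (0 : R) := cvg_comp _ _ d r0.
  by rewrite -[X in _ --> X](mulr0 4); apply: cvgM => //; exact: cvg_cst.
have fE2 : \forall q \near (0 : R)^'+, f (2 * q) =
  a + b * (2 * q) + c * (2 * q) ^+ 2 + r (2 * q) * (2 * q) ^+ 2 by exact: (d _ fE).
by near=> q; rewrite (near fE2 q)//; ring.
Unshelve. all: by end_near. Qed.

(** A second difference over 0, q and 2 q. For a Laplace transform it is the integral of ((1 - e^(-
    q tau)) / q)^2 on the event tau < +oo. *)
Lemma jet_second f a b c : jet f a b c ->
  (a + f (2 * q) - 2 * f q) / q ^+ 2 @[q --> (0 : R)^'+] --> 2 * c.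
Proof.
move=> jf; have /jetP[r r0 fE] := jf; have /jetP[s s0 gE] := jet_double jf.
have h : 2 * c + s q - 2 * r q @[q --> (0 : R)^'+] --> 2 * c.
  by rewrite [X in _ --> X](_ : _ = 2 * c + 0 - 2 * 0); [cvg_arith|ring].
apply: cvg_trans h; apply: near_eq_cvg; near=> q.
have q0 : q != 0 by rewrite gt_eqF//; near: q; exact: nbhs_right_gt.
by rewrite (near fE q)// (near gE q)//; field.
Unshelve. all: by end_near. Qed.

(** [weight1] and [weight2] come from comparing orders in the equation weight times denominator =
    numerator; the rules for products, inverses and exponentials produce the same rational
    functions. *)
Lemma jet_branch (v g al be x : R) (rho rho' : R -> R) : g != 0 -> al != be ->
  jet rho al (root_jet1 v g al be) (root_jet2 v g al be) ->
  jet rho' be (root_jet1 v g be al) (root_jet2 v g be al) ->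
  jet (fun q => rho' q * (g - rho q) / (g * (rho' q - rho q)) * expR (- rho q * x))
    (weight0 g al be * expR (- al * x))
    ((weight1 v g al be - weight0 g al be * root_jet1 v g al be * x) * expR (- al * x))
    ((weight2 v g al be - weight1 v g al be * root_jet1 v g al be * x
      + weight0 g al be * (root_jet1 v g al be ^+ 2 * x ^+ 2 / 2 - root_jet2 v g al be * x))
     * expR (- al * x)).
Proof.
move=> g0 ab jr jr'; have ba : be - al != 0 by rewrite subr_eq0 eq_sym.
have jn := jet_scale (-1) jr.
have jd : jet (fun q => g * (rho' q - rho q)) (g * (be - al))
    (g * (root_jet1 v g be al - root_jet1 v g al be))
    (g * (root_jet2 v g be al - root_jet2 v g al be)).
  apply: jet_near (jet_eq _ _ _ (jet_scale g (jetD jr' jn))); try ring.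
  by near=> q; ring.
have jw := jetM (jetM jr' (jetD (jet_cst g) jn)) (jetV (mulf_neq0 g0 ba) jd).
have je := jet_expR (jet_scale (- x) jr).
apply: jet_near (jet_eq _ _ _ (jetM jw je)).
- by near=> q; congr (_ * expR _); rewrite /=; ring.
- rewrite /weight0 (_ : - al * x = - x * al); last ring.
  by move: (expR _) => E; field; rewrite ba g0.
- rewrite /weight1 /weight0 (_ : - al * x = - x * al); last ring.
  by move: (root_jet1 _ _ _ _) (root_jet1 _ _ _ _) (expR _) => ? ? ?; field; rewrite ba g0.
- rewrite /weight2 /weight1 /weight0 (_ : - al * x = - x * al); last ring.
  move: (root_jet1 _ _ _ _) (root_jet1 _ _ _ _) (root_jet2 _ _ _ _) (root_jet2 _ _ _ _) (expR _).
  by move=> ? ? ? ? ?; field; rewrite ba g0.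
Unshelve. all: by end_near. Qed.

End JetLimits.

(** * Moments of the ruin time *)

Section Moments.
Context {R : realType} {d : measure_display} {T : measurableType d}.
Variables (P : probability T R) (tau : T -> \bar R) (u : R -> R) (u0 u1 u2 : R).
Hypotheses (mtau : measurable_fun setT tau) (tau0 : forall w, (0 <= tau w)%E)
  (uE : \forall q \near (0 : R)^'+, (\int[P]_w (discounted q (tau w))%:E)%E = (u q)%:E)
  (uj : jet u u0 u1 u2).
Let D := [set w | (tau w < +oo)%E].

Lemma measurable_finite_time : measurable D.
Proof.
by rewrite -[D]setTI; apply: emeasurable_fun_infty_o.
Qed.

Let mD := measurable_finite_time.

Let finE w : D w -> tau w = (fine (tau w))%:E.
Proof. by move=> Dw; rewrite fineK// ge0_fin_numE. Qed.

Let fin0 w : D w -> 0 <= fine (tau w).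
Proof. by move=> _; apply: fine_ge0. Qed.

Let mfin : measurable_fun setT (fun w => fine (tau w)).
Proof. exact: measurableT_comp. Qed.

(** Monotone convergence; finiteness of the limit integral is a conclusion, drawn from the
    convergence of the numbers [j n]. *)
Lemma monotone_limit (phi : nat -> R -> R) (psi : R -> R) (j : nat -> R) (l : R) :
  (forall n, measurable_fun setT (phi n)) ->
  (forall n t, 0 <= t -> 0 <= phi n t) ->
  (forall n t, 0 <= t -> phi n t <= phi n.+1 t) ->
  (forall t, 0 <= t -> phi n t @[n --> \oo] --> psi t) ->
  (forall n, (\int[P]_(w in D) (phi n (fine (tau w)))%:E = (j n)%:E)%E) ->
  j n @[n --> \oo] --> l ->
  (\int[P]_(w in D) (psi (fine (tau w)))%:E = l%:E)%E.
Proof.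
move=> mphi phi0 phiS phil jE jl.
have h := @cvg_monotone_convergence _ _ _ P D mD (fun n w => (phi n (fine (tau w)))%:E) _ _ _.
have {h} : (\int[P]_(w in D) (phi n (fine (tau w)))%:E)%E @[n --> \oo] -->
    (\int[P]_(w in D) limn (fun n => (phi n (fine (tau w)))%:E))%E.
  apply: h.
  - by move=> n; apply/measurable_EFinP; apply: measurable_funTS; exact: measurableT_comp.
  - by move=> n w Dw; rewrite lee_fin phi0// fin0.
  - by move=> w Dw; apply/nondecreasing_seqP => n; rewrite lee_fin phiS// fin0.
under eq_cvg do rewrite jE.
have -> : (\int[P]_(w in D) limn (fun n => (phi n (fine (tau w)))%:E) =
    \int[P]_(w in D) (psi (fine (tau w)))%:E)%E.
  apply: eq_integral => w; rewrite inE => Dw; apply: cvg_lim => //.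
  by apply: cvg_EFin; [exact: nearW|exact: phil (fin0 Dw)].
move=> h; apply: (cvg_unique _ h) => //.
by apply: cvg_EFin; [exact: nearW|exact: jl].
Qed.

(** The sequence halves because the slopes are compared between 2 q and q, and the second difference
    uses [u] at 2 q. Starting at e / 4 keeps both arguments inside the radius e where the Laplace
    transform is known. *)
Lemma halving_seq : exists2 s : nat -> R, [/\ (forall n, 0 < s n),
    (forall n, s n = 2 * s n.+1) & s n @[n --> \oo] --> (0 : R)] &
  forall n, (\int[P]_w (discounted (s n) (tau w))%:E)%E = (u (s n))%:E /\
    (\int[P]_w (discounted (2 * s n) (tau w))%:E)%E = (u (2 * s n))%:E.
Proof.
have [e /= e0 he] := uE.
have s0 n : 0 < e / 4 * 2^-1 ^+ n by rewrite mulr_gt0 ?divr_gt0 ?exprn_gt0// invr_gt0.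
have s1 n : e / 4 * 2^-1 ^+ n <= e / 4.
  by rewrite ler_piMr ?divr_ge0 ?(ltW e0)// exprn_ile1// ?invr_ge0//; lra.
exists (fun n => e / 4 * 2^-1 ^+ n).
  split => // [n|]; first by rewrite exprS; field.
  by rewrite -[X in _ --> X](mulr0 (e / 4)); apply: cvgM; [exact: cvg_cst|exact: cvg_half].
move=> n; have := s0 n; have := s1 n; move: (e / 4 * _) => q qe q0; split; apply: he => //=.
- by rewrite /ball/= sub0r normrN gtr0_norm//; have : 0 < e by []; lra.
- by rewrite /ball/= sub0r normrN gtr0_norm ?mulr_gt0//; have : 0 < e by []; lra.
- by rewrite mulr_gt0.
Qed.

Lemma integral_discounted_on q : (\int[P]_(w in D) (expR (- q * fine (tau w)))%:E =
  \int[P]_w (discounted q (tau w))%:E)%E.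
Proof.
rewrite integral_mkcond; apply: eq_integral => w _; rewrite patchE.
case: ifPn => [|]; rewrite ?inE ?notin_setE /D /=.
  by move=> /finE ->.
by move=> /negP; rewrite -leNgt leye_eq => /eqP ->.
Qed.

Let mexp q : measurable_fun setT (fun t : R => expR (- q * t)).
Proof. by apply: measurableT_comp => //; exact: measurable_funM. Qed.

(** [J] stands for an integral that could be infinite; the finite right-hand side excludes this. *)
Lemma solve_lin (a b c : R) (J : \bar R) : 0 < a ->
  (a%:E * J + b%:E = c%:E)%E -> J = ((c - b) / a)%:E.
Proof.
move=> a0; case: J => [r| |]; last 2 first.
- by rewrite gt0_muley ?lte_fin.
- by rewrite gt0_muleNy ?lte_fin.
rewrite -EFinM -EFinD => -[<-]; congr (_%:E).
by rewrite addrK mulrC mulKf// gt_eqF.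
Qed.

Let comb (a b : R) (f g : R -> R) : 0 <= a -> 0 <= b ->
  measurable_fun setT f -> measurable_fun setT g ->
  (forall t, 0 <= t -> 0 <= f t) -> (forall t, 0 <= t -> 0 <= g t) ->
  (a%:E * \int[P]_(w in D) (f (fine (tau w)))%:E + b%:E * \int[P]_(w in D) (g (fine (tau w)))%:E =
   \int[P]_(w in D) (a * f (fine (tau w)) + b * g (fine (tau w)))%:E)%E.
Proof.
move=> a0 b0 mf mg f0 g0.
have m (h : R -> R) : measurable_fun setT h -> measurable_fun D (fun w => (h (fine (tau w)))%:E).
  by move=> mh; apply/measurable_EFinP; apply: measurable_funTS; exact: measurableT_comp.
rewrite -!ge0_integralZl_EFin//.
all: try by move=> w Dw; rewrite lee_fin ?f0 ?g0 ?fin0.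
all: try exact: m.
rewrite -ge0_integralD//.
- by move=> w Dw; rewrite -EFinM lee_fin mulr_ge0 ?f0 ?fin0.
- by apply: (m (fun t => a * f t)); exact: measurable_funM.
- by move=> w Dw; rewrite -EFinM lee_fin mulr_ge0 ?g0 ?fin0.
- by apply: (m (fun t => b * g t)); exact: measurable_funM.
Qed.

Lemma finite_time_prob : P D = u0%:E.
Proof.
have [s [s0 sS sc] sE] := halving_seq.
have := @monotone_limit (fun n t => expR (- s n * t)) (fun=> 1) (fun n => u (s n)) u0.
rewrite integral_cst// mul1e; apply.
- by move=> n; exact: mexp.
- by move=> n t _; exact: expR_ge0.
- move=> n t t0; rewrite ler_expR !mulNr lerN2 ler_wpM2r// (sS n).
  by have := s0 n.+1; lra.
- move=> t _; have h : - s n * t @[n --> \oo] --> (0 : R).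
    rewrite [X in _ --> X](_ : 0 = - 0 * t); last by ring.
    by apply: cvgM; [exact: cvgN|exact: cvg_cst].
  by rewrite -[X in _ --> X](@expR0 R); exact: (cvg_comp _ _ h (@continuous_expR R 0)).
- by move=> n; rewrite integral_discounted_on; case: (sE n).
- by have /cvg_at_rightP := jet_cvg uj; apply.
Qed.

Let slope (q t : R) := (1 - expR (- q * t)) / q.

Let mslope q : measurable_fun setT (slope q).
Proof. by apply: measurable_funM => //; exact: measurable_funB. Qed.

Let exp_le1 (q t : R) : 0 < q -> 0 <= t -> expR (- q * t) <= 1.
Proof. by move=> q0 t0; rewrite expR_le1 mulNr oppr_le0 mulr_ge0// ltW. Qed.

Let slope_ge0 (q t : R) : 0 < q -> 0 <= t -> 0 <= slope q t.
Proof. by move=> q0 t0; rewrite divr_ge0 ?(ltW q0)// subr_ge0 exp_le1. Qed.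

(* Halving [q] increases the slope: this gives the monotone sequence along
   which the moments are obtained as limits. *)
Let slope_half (q t : R) : 0 < q -> 0 <= t -> slope (2 * q) t <= slope q t.
Proof.
move=> q0 t0; rewrite /slope (_ : - (2 * q) * t = 2%:R * (- q * t)); last by ring.
rewrite expRM_natl; have := exp_le1 q0 t0; have := expR_ge0 (- q * t).
move: (expR _) => E E0 E1; rewrite ler_pdivrMr ?mulr_gt0//.
by rewrite (_ : _ / q * _ = 2 * (1 - E)); [nra|field; rewrite gt_eqF].
Qed.

Let slope_cvg s t : (forall n, 0 < s n) -> s n @[n --> \oo] --> (0 : R) ->
  slope (s n) t @[n --> \oo] --> t.
Proof.
move=> s0 sc; have j : jet (fun q : R => expR (- t * q)) 1 (- t) (t ^+ 2 / 2).
  by apply: jet_eq (jet_expR (jet_scale (- t) (@jet_id R))); rewrite ?mulr0 ?expR0; ring.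
have /cvg_at_rightP/(_ s (conj s0 sc)) := jet_slope j; rewrite opprK.
rewrite (_ : (fun n => slope (s n) t) = fun n => (1 - expR (- t * s n)) / s n)//.
by apply/funext => n; rewrite /slope mulNr (mulrC (s n)) mulNr.
Qed.

Lemma finite_time_mean : (\int[P]_(w in D) tau w = (- u1)%:E)%E.
Proof.
have [s [s0 sS sc] sE] := halving_seq.
rewrite (_ : (\int[P]_(w in D) tau w = \int[P]_(w in D) (fine (tau w))%:E)%E); last first.
  by apply: eq_integral => w; rewrite inE => /finE.
apply: (@monotone_limit (fun n => slope (s n)) id (fun n => (u0 - u (s n)) / s n)).
- by move=> n; exact: mslope.
- by move=> n t; exact: slope_ge0.
- by move=> n t t0; rewrite (sS n) slope_half.
- by move=> t _; exact: slope_cvg.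
(* The identity q slope + e^(- q tau) = 1 is integrated over tau < +oo. It is kept additive so as
   not to subtract extended integrals. *)
- move=> n; apply: solve_lin => //; case: (sE n) => <- _; rewrite -integral_discounted_on.
  rewrite -[X in (_ + X)%E]mul1e (comb _ _ (mslope _) (mexp _)) ?ler01 ?(ltW (s0 n))//; last first.
    by move=> t; exact: slope_ge0.
  rewrite -finite_time_prob -[RHS]mul1e -integral_cst//; apply: eq_integral => w _.
  by rewrite /slope mulrC divfK ?gt_eqF// mul1r subrK.
- by have /cvg_at_rightP := jet_slope uj; apply.
Qed.

Lemma finite_time_second : (\int[P]_(w in D) (tau w ^+ 2) = (2 * u2)%:E)%E.
Proof.
have [s [s0 sS sc] sE] := halving_seq.
rewrite (_ : (\int[P]_(w in D) (tau w ^+ 2) =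
  \int[P]_(w in D) (fine (tau w) ^+ 2)%:E)%E); last first.
  by apply: eq_integral => w; rewrite inE => /finE ->.
have mslope2 q : measurable_fun setT (fun t => slope q t ^+ 2).
  exact: measurable_funX.
apply: (@monotone_limit (fun n t => slope (s n) t ^+ 2) (fun t => t ^+ 2)
  (fun n => (u0 + u (2 * s n) - 2 * u (s n)) / s n ^+ 2)).
- by [].
- by move=> n t _; rewrite sqr_ge0.
- by move=> n t t0; rewrite lerXn2r ?nnegrE ?slope_ge0// (sS n) slope_half.
- move=> t _; rewrite expr2.
  rewrite (_ : (fun n => slope (s n) t ^+ 2) = fun n => slope (s n) t * slope (s n) t).
    by apply: cvgM; exact: slope_cvg.
  by apply/funext => n; rewrite expr2.
(* The identity integrated is (1 - E)^2 + 2 E = 1 + E^2 with E = e^(- q tau), again without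
   subtraction. *)
- move=> n; have q0 := s0 n; apply: solve_lin; first by rewrite exprn_gt0.
  case: (sE n); rewrite -!integral_discounted_on => Eq E2q.
  have mc : measurable_fun setT (cst 1 : R -> R) by exact: measurable_cst.
  have PD : (P D = 1%:E * \int[P]_(w in D) (cst 1 (fine (tau w)))%:E)%E.
    by rewrite mul1e; have := integral_cst P mD 1%:E; rewrite mul1e => <-.
  have e0 (r t : R) (_ : 0 <= t) : 0 <= expR (- r * t) := expR_ge0 _.
  have l0 t (_ : 0 <= t) : 0 <= slope (s n) t ^+ 2 := sqr_ge0 _.
  rewrite [(2 * u _)%:E]EFinM -Eq [(u0 + _)%:E]EFinD -E2q -finite_time_prob PD.
  rewrite (comb (sqr_ge0 (s n)) (ler0n R 2) (mslope2 _) (mexp _) l0 (e0 _)).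
  rewrite -[X in (_ = _ + X)%E]mul1e (comb ler01 ler01 mc (mexp _) (fun _ _ => ler01) (e0 _)).
  apply: eq_integral => w _; congr (_%:E).
  rewrite (_ : - (2 * s n) * _ = 2%:R * (- s n * fine (tau w))); last by ring.
  rewrite expRM_natl /slope /=; move: (expR _) => E; field; exact: lt0r_neq0.
- by have /cvg_at_rightP := jet_second uj; apply.
Qed.

End Moments.

(** The two denominators encode the normalised weights w1 / (w1 + w2) and w2 / (w1 + w2):
    conditioning on ruin averages the two branches. *)
Lemma mixtureE (R : realFieldType) (w1 w2 e k1 k2 : R) : 0 < w1 -> 0 < w2 -> e = w2 / w1 ->
  k1 / (1 + e) + k2 / (1 + e^-1) = (k1 * w1 + k2 * w2) / (w1 + w2).
Proof.
move=> w10 w20 ->; have w0 : w1 + w2 != 0 by rewrite gt_eqF// addr_gt0.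
by field; rewrite ?(addrC w2) ?w0 !gt_eqF.
Qed.

Lemma cond_expectation_fin {R : realType} {d : measure_display} {T : measurableType d}
    (P : probability T R) (Y : T -> \bar R) (A : set T) (a b : R) : b != 0 ->
  (\int[P]_(w in A) Y w)%E = a%:E -> P A = b%:E -> cond_expectation P Y A = (a / b)%:E.
Proof. by move=> b0 YE PE; rewrite /cond_expectation YE PE inver (negbTE b0). Qed.

(** * The zeros of the Laplace exponent and the final formulas *)

Section Roots.
Context {R : realType}.
Variables p lambda gamma sigma : R.
Hypotheses (lambda0 : 0 < lambda) (gamma0 : 0 < gamma)
  (sigma0 : 0 < sigma ^+ 2) (drift : 0 < p - lambda / gamma).
Let r := rr p lambda gamma sigma.

(** [al] and [be] are the nonzero solutions of psi(- z) = 0, the roots of (v z / 2 - p) (gamma - z)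
    + lambda with v = sigma^2; r comes from its discriminant. *)
Let al : R := (2 * p + gamma * sigma ^+ 2 - r) / (2 * sigma ^+ 2).
Let be : R := (2 * p + gamma * sigma ^+ 2 + r) / (2 * sigma ^+ 2).

Let s0 : sigma ^+ 2 != 0. Proof. exact: lt0r_neq0. Qed.

Let r2 : r ^+ 2 = (gamma * sigma ^+ 2 - 2 * p) ^+ 2 + 8 * lambda * sigma ^+ 2.
Proof.
rewrite /r /rr sqr_sqrtr// addr_ge0 ?sqr_ge0//.
by rewrite mulr_ge0// ?(ltW sigma0)// mulr_ge0// ltW.
Qed.

Let r0 : 0 < r.
Proof. by rewrite /r /rr sqrtr_gt0 ltr_wpDl ?sqr_ge0// mulr_gt0// mulr_gt0. Qed.

Let roots_p : p = sigma ^+ 2 / 2 * (al + be - gamma).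
Proof. by rewrite /al /be; move: s0; move: (sigma ^+ 2) r => v q v0; field. Qed.

Let roots_r : r = sigma ^+ 2 * (be - al).
Proof. by rewrite /al /be; move: s0; move: (sigma ^+ 2) r => v q v0; field. Qed.

Let roots_lambda : lambda = sigma ^+ 2 / 2 * ((gamma - al) * (be - gamma)).
Proof.
have -> : (gamma - al) * (be - gamma) =
    (r ^+ 2 - (gamma * sigma ^+ 2 - 2 * p) ^+ 2) / (4 * (sigma ^+ 2) ^+ 2).
  by rewrite /al /be; move: s0; move: (sigma ^+ 2) r => v q v0; field.
by rewrite r2; move: s0; move: (sigma ^+ 2) => v v0; field.
Qed.

(** As lambda > 0, the product (gamma - al) (be - gamma) is positive and gamma separates the roots.
    The drift condition makes al be positive, hence al > 0. *)
Let roots_order : [/\ 0 < al, al < gamma & gamma < be].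
Proof.
have ab : al < be by rewrite -subr_gt0 -(pmulr_rgt0 _ sigma0) -roots_r.
have bg : gamma < be.
  have : 0 < (gamma - al) * (be - gamma).
    by rewrite -(pmulr_rgt0 _ (_ : 0 < sigma ^+ 2 / 2)) -?roots_lambda// divr_gt0.
  by have [//|bg] := ltP gamma be; have := lt_le_trans ab bg; nra.
have ag : al < gamma.
  have : 0 < (gamma - al) * (be - gamma).
    by rewrite -(pmulr_rgt0 _ (_ : 0 < sigma ^+ 2 / 2)) -?roots_lambda// divr_gt0.
  by rewrite pmulr_lgt0 subr_gt0.
split=> //; have ab0 : 0 < al * be.
  have -> : al * be = 2 / sigma ^+ 2 * (gamma * (p - lambda / gamma)).
    rewrite {1}roots_p {1}roots_lambda; move: s0 (lt0r_neq0 gamma0).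
    by move: al be (sigma ^+ 2) gamma => a b v g v0 g0; field; rewrite v0 g0.
  by rewrite mulr_gt0 ?divr_gt0// mulr_gt0.
by move: ab0; rewrite pmulr_lgt0// (lt_trans gamma0 bg).
Qed.

Lemma exponent_roots : exists al be,
  [/\ 0 < al, al < gamma & gamma < be] /\
  [/\ p = sigma ^+ 2 / 2 * (al + be - gamma),
     lambda = sigma ^+ 2 / 2 * ((gamma - al) * (be - gamma)) &
     rr p lambda gamma sigma = sigma ^+ 2 * (be - al)].
Proof.
exists al, be; split; first exact: roots_order.
by split; [exact: roots_p|exact: roots_lambda|exact: roots_r].
Qed.

End Roots.

Section RuinJet.
Context {R : realType} {d : measure_display} {T : measurableType d}.
Variable P : probability T R.
Variables (N : R -> T -> nat) (S : nat -> T -> R) (B : R -> T -> R).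
Variables (p lambda gamma sigma x al be : R).
Hypotheses (p0 : 0 < p) (lambda0 : 0 < lambda) (gamma0 : 0 < gamma) (x0 : 0 <= x)
  (sigma0 : 0 < sigma ^+ 2)
  (hN : poisson_process P lambda N) (hS : iid_exponential P gamma S)
  (hB : brownian_motion P B) (hind : independent_sources P N S B).
Hypotheses (al0 : 0 < al) (alg : al < gamma) (beg : gamma < be)
  (pE : p = sigma ^+ 2 / 2 * (al + be - gamma))
  (lE : lambda = sigma ^+ 2 / 2 * ((gamma - al) * (be - gamma))).
Let v := sigma ^+ 2.

(** The cubic is psi(- rho) = q cleared of its denominator, with p and lambda expressed by the
    roots. *)
Let laplace_equation (q rho : R) : rho != gamma ->
  v / 2 * rho * (rho - al) * (rho - be) = q * (rho - gamma) ->
  - rho * p + rho ^+ 2 * sigma ^+ 2 / 2 + lambda * (gamma / (gamma - rho)) = q + lambda.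
Proof.
move=> rg rE; have g0 : gamma - rho != 0 by rewrite subr_eq0 eq_sym.
apply: (mulIf g0); rewrite mulrDl -(mulrA lambda) divfK//.
have : (- rho * p + rho ^+ 2 * v / 2) * (gamma - rho) + lambda * gamma
    - (q + lambda) * (gamma - rho)
    = q * (rho - gamma) - v / 2 * rho * (rho - al) * (rho - be).
  by rewrite pE lE -/v; field.
by rewrite rE subrr => /eqP; rewrite subr_eq0 => /eqP.
Qed.

(** For small q the two roots stay near [al] and [be], on either side of gamma, so the weights
    solving the two linear conditions are nonnegative and the Laplace transform formula applies. *)
Lemma ruin_laplace_jet : exists2 u : R -> R,
  \forall q \near (0 : R)^'+, (\int[P]_w (discounted q
    (ruin_time (perturbed_cramer_lundberg p sigma N S B x) w))%:E)%E = (u q)%:E &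
  jet u
    (weight0 gamma al be * expR (- al * x) + weight0 gamma be al * expR (- be * x))
    ((weight1 v gamma al be - weight0 gamma al be * root_jet1 v gamma al be * x)
      * expR (- al * x) +
     (weight1 v gamma be al - weight0 gamma be al * root_jet1 v gamma be al * x)
      * expR (- be * x))
    ((weight2 v gamma al be - weight1 v gamma al be * root_jet1 v gamma al be * x
      + weight0 gamma al be * (root_jet1 v gamma al be ^+ 2 * x ^+ 2 / 2
                               - root_jet2 v gamma al be * x)) * expR (- al * x) +
     (weight2 v gamma be al - weight1 v gamma be al * root_jet1 v gamma be al * x
      + weight0 gamma be al * (root_jet1 v gamma be al ^+ 2 * x ^+ 2 / 2
                               - root_jet2 v gamma be al * x)) * expR (- be * x)).
Proof.
have v0 : v != 0 by exact: lt0r_neq0.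
have be0 : 0 < be by exact: lt_trans beg.
have ab : al != be by rewrite lt_eqF// (lt_trans alg).
have ba : be != al by rewrite eq_sym.
have [rho jr rE] := root_jetP gamma v0 (lt0r_neq0 al0) ab.
have [rho' jr' rE'] := root_jetP gamma v0 (lt0r_neq0 be0) ba.
exists (fun q => rho' q * (gamma - rho q) / (gamma * (rho' q - rho q)) * expR (- rho q * x)
  + rho q * (gamma - rho' q) / (gamma * (rho q - rho' q)) * expR (- rho' q * x)); last first.
  by apply: jetD; apply: jet_branch => //; exact: lt0r_neq0.
near=> q.
have q0 : 0 < q by near: q; exact: nbhs_right_gt.
have r0 : 0 < rho q by near: q; exact: cvgr_gt (jet_cvg jr) _ al0.
have rg : rho q < gamma by near: q; exact: cvgr_lt (jet_cvg jr) _ alg.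
have rg' : gamma < rho' q by near: q; exact: cvgr_gt (jet_cvg jr') _ beg.
have r0' : 0 < rho' q by exact: lt_trans rg'.
have n1 : rho q != gamma by rewrite lt_eqF.
have n2 : rho' q != gamma by rewrite gt_eqF.
have n3 : 0 < rho' q - rho q by rewrite subr_gt0 (lt_trans rg).
have E1 := laplace_equation n1 (near rE q _).
have E2 : v / 2 * rho' q * (rho' q - al) * (rho' q - be) = q * (rho' q - gamma).
  by rewrite -(near rE' q _)//; ring.
apply: (laplace_ruin_time p0 lambda0 gamma0 x0 hN hS hB hind q0 _ _ _ r0 r0' n1 n2 _ (E1 _)
  (laplace_equation n2 E2)) => //.
- by rewrite divr_ge0 ?mulr_ge0// ?subr_ge0 ltW// -subr_gt0.
- rewrite -mulrNN -invrN -!mulrN !opprB divr_ge0// mulr_ge0// ?subr_ge0 ltW// -subr_gt0//.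
- have n4 : rho' q - rho q != 0 by exact: lt0r_neq0.
  have n5 : rho q - rho' q != 0 by rewrite -opprB oppr_eq0.
  by field; rewrite n4 n5 lt0r_neq0.
- have n4 : rho' q - rho q != 0 by exact: lt0r_neq0.
  have n5 : rho q - rho' q != 0 by rewrite -opprB oppr_eq0.
  have n6 : gamma - rho q != 0 by rewrite subr_eq0 eq_sym.
  have n7 : gamma - rho' q != 0 by rewrite subr_eq0 eq_sym.
  by field; rewrite n4 n5 n6 n7 lt0r_neq0.
Unshelve. all: by end_near. Qed.

End RuinJet.

Theorem corollary5p2 (R : realType) (d : measure_display) (T : measurableType d)
    (P : probability T R)
    (N : R -> T -> nat) (S : nat -> T -> R) (B : R -> T -> R)
    (p lambda gamma sigma : R)
    (hp : 0 < p) (hlambda : 0 < lambda) (hgamma : 0 < gamma)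
    (hsigma : 0 < sigma ^+ 2)
    (hN : poisson_process P lambda N)
    (hS : iid_exponential P gamma S)
    (hB : brownian_motion P B)
    (hind : independent_sources P N S B)
    (hdrift : 0 < p - lambda / gamma) :
  forall x : R, 0 < x ->
  let tau := ruin_time (perturbed_cramer_lundberg p sigma N S B x) in
  let ruin := [set w | (tau w < +oo)%E] in
  let r := rr p lambda gamma sigma in
  let e := eps p lambda gamma sigma x in
  let Aup := A_up p lambda gamma sigma in
  let Bup := B_up p lambda gamma sigma in
  let Cup := C_up p lambda gamma sigma in
  cond_expectation P tau ruin =
    ((x * (2 / r) * ((gamma * sigma ^+ 2 - 2 * p + r)
                     / (gamma * sigma ^+ 2 + 2 * p - r)) + Aup 1) / (1 + e)
     + (x * (2 / r) * (- (gamma * sigma ^+ 2 - 2 * p - r)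
                       / (gamma * sigma ^+ 2 + 2 * p + r)) + Aup (- 1))
       / (1 + e^-1))%:E
  /\
  cond_expectation P (fun w => (tau w ^+ 2)%E) ruin =
    ((x ^+ 2 * (4 / r ^+ 2) * ((gamma * sigma ^+ 2 - 2 * p + r)
                               / (gamma * sigma ^+ 2 + 2 * p - r)) ^+ 2
      + x * Bup 1 + Cup 1) / (1 + e)
     + (x ^+ 2 * (4 / r ^+ 2) * ((gamma * sigma ^+ 2 - 2 * p - r)
                                 / (gamma * sigma ^+ 2 + 2 * p + r)) ^+ 2
        + x * Bup (- 1) + Cup (- 1)) / (1 + e^-1))%:E.
Proof.
move=> x x0 tau ruin r e Aup Bup Cup.
have [al [be [[al0 alg beg] [pE lE rE]]]] := exponent_roots hlambda hgamma hsigma hdrift.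
have [u uE uj] := ruin_laplace_jet hp hlambda hgamma (ltW x0) hsigma hN hS hB hind
  al0 alg beg pE lE.
have be0 : 0 < be by exact: lt_trans beg.
have ab : al < be by exact: lt_trans beg.
have v0 : sigma ^+ 2 != 0 by exact: lt0r_neq0.
have g0 := lt0r_neq0 hgamma.
have [aln ben] : al != 0 /\ be != 0 by split; exact: lt0r_neq0.
have [agn bgn abn ban] : [/\ al != gamma, be != gamma, al != be & be != al].
  by rewrite (lt_eqF alg) (gt_eqF beg) (lt_eqF ab) (gt_eqF ab).
set w1 := weight0 gamma al be * expR (- al * x) in uj.
set w2 := weight0 gamma be al * expR (- be * x) in uj.
have k1 : 0 < weight0 gamma al be.
  by rewrite /weight0 divr_gt0 ?mulr_gt0 ?subr_gt0.
have k2 : 0 < weight0 gamma be al.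
  by rewrite /weight0 -mulrNN -invrN -!mulrN !opprB divr_gt0 ?mulr_gt0 ?subr_gt0.
have w10 : 0 < w1 by rewrite mulr_gt0 ?expR_gt0.
have w20 : 0 < w2 by rewrite mulr_gt0 ?expR_gt0.
have wn : w1 + w2 != 0 by rewrite gt_eqF// addr_gt0.
have mtau := measurable_ruin_time p sigma x hN hS hB.
have tau0 := ruin_time_ge0 N S B p sigma x.
have rE1 : r = 1 * (sigma ^+ 2 * (be - al)) by rewrite mul1r.
(* The lower signs are the case s = - 1 with [al] and [be] exchanged. *)
have rE2 : r = -1 * (sigma ^+ 2 * (al - be)) by rewrite mulN1r -mulrN opprB.
have lE2 : lambda = sigma ^+ 2 / 2 * ((gamma - be) * (al - gamma)) by rewrite {1}lE; ring.
have pE2 : p = sigma ^+ 2 / 2 * (be + al - gamma) by rewrite {1}pE; ring.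
have o1 : 1 = 1 :> R \/ 1 = -1 :> R by left.
have o2 : -1 = 1 :> R \/ -1 = -1 :> R by right.
have A1 := A_upE v0 g0 aln ben agn bgn abn erefl pE lE o1 rE1.
have A2 := A_upE v0 g0 ben aln bgn agn ban erefl pE2 lE2 o2 rE2.
have B1 := B_upE v0 g0 aln ben agn bgn abn erefl pE lE o1 rE1.
have B2 := B_upE v0 g0 ben aln bgn agn ban erefl pE2 lE2 o2 rE2.
have C1 := C_upE v0 g0 aln ben agn bgn abn erefl pE lE o1 rE1.
have C2 := C_upE v0 g0 ben aln bgn agn ban erefl pE2 lE2 o2 rE2.
have S1 := slopeE v0 aln agn bgn abn erefl pE o1 rE1.
have S2 := slopeE v0 ben bgn agn ban erefl pE2 o2 rE2.
rewrite -/r in S1 S2; rewrite !mul1r in S1; rewrite !mulN1r opprK in S2.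
(* [e] is the ratio of the contributions of the two branches to the ruin probability w1 + w2. *)
have eE : e = w2 / w1.
  have f1 : gamma * sigma ^+ 2 + 2 * p - r = 2 * sigma ^+ 2 * al by rewrite /r rE {1}pE; field.
  have f2 : gamma * sigma ^+ 2 + 2 * p + r = 2 * sigma ^+ 2 * be by rewrite /r rE {1}pE; field.
  have f3 : gamma * sigma ^+ 2 - 2 * p - r = 2 * sigma ^+ 2 * (gamma - be).
    by rewrite /r rE {1}pE; field.
  have f4 : gamma * sigma ^+ 2 - 2 * p + r = 2 * sigma ^+ 2 * (gamma - al).
    by rewrite /r rE {1}pE; field.
  rewrite /e /eps -/r f1 f2 f3 f4 /w1 /w2 /weight0.
  rewrite (_ : - (r / sigma ^+ 2) * x = - be * x + - (- al * x)); last first.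
    by rewrite /r rE (mulrC _ (be - al)) mulfK//; ring.
  rewrite expRD expRN; have := expR_gt0 (- al * x).
  move: (expR _) (expR _) (sigma ^+ 2) v0 => E1 E2 v v0 E20.
  by field; rewrite ?v0 ?g0 ?aln ?ben ?subr_eq0 ?abn ?ban ?(eq_sym gamma) ?agn ?lt0r_neq0.
split.
  rewrite (cond_expectation_fin wn (finite_time_mean mtau tau0 uE uj)
    (finite_time_prob mtau tau0 uE uj)).
  congr (_%:E); rewrite (mixtureE _ _ w10 w20 eE); congr (_ / _).
  have S2' : 2 / r * (- (gamma * sigma ^+ 2 - 2 * p - r) / (gamma * sigma ^+ 2 + 2 * p + r))
      = root_jet1 (sigma ^+ 2) gamma be al by rewrite mulNr mulrN -mulNr.
  rewrite -!(mulrA x) S1 S2' /Aup A1 A2 /w1 /w2.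
  move: (lt0r_neq0 k1) (lt0r_neq0 k2); move: (expR _) (expR _) (weight0 _ _ _) (weight0 _ _ _).
  move: (weight1 _ _ _ _) (weight1 _ _ _ _) (root_jet1 _ _ _ _) (root_jet1 _ _ _ _).
  by move=> W1 W2 a1 a2 E1 E2 c1 c2 c10 c20; field; rewrite c10 c20.
rewrite (cond_expectation_fin wn (finite_time_second mtau tau0 uE uj)
  (finite_time_prob mtau tau0 uE uj)).
congr (_%:E); rewrite (mixtureE _ _ w10 w20 eE); congr (_ / _).
have sq (y z : R) : x ^+ 2 * (4 / y ^+ 2) * z ^+ 2 = x ^+ 2 * (2 / y * z) ^+ 2.
  by rewrite -exprVn; ring.
(* In the lower branch the slope appears with the opposite sign, which the square absorbs. *)
rewrite !sq S1 -(sqrrN (2 / r * _)) -(mulNr (2 / r)) S2 /Bup /Cup B1 B2 C1 C2 /w1 /w2.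
move: (lt0r_neq0 k1) (lt0r_neq0 k2); move: (expR _) (expR _) (weight0 _ _ _) (weight0 _ _ _).
move: (weight1 _ _ _ _) (weight1 _ _ _ _) (root_jet1 _ _ _ _) (root_jet1 _ _ _ _).
move: (weight2 _ _ _ _) (weight2 _ _ _ _) (root_jet2 _ _ _ _) (root_jet2 _ _ _ _).
by move=> V1 V2 b1 b2 W1 W2 a1 a2 E1 E2 c1 c2 c10 c20; field; rewrite c10 c20.
Qed.
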